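(* a) The map of $GL_2(\mathbb{Z})$-modules $\psi^{(2)}$ given, for a basis $(v_1,v_2)$ of $L_2$ and $v_1+v_2+v_3=0$, by $$[v_1,v_2]\longmapsto\varphi(v_1,v_2,v_3),\qquad [v_1]\wedge[v_2]\longmapsto\varphi(v_1,v_2)$$ is an isomorphism of complexes $M^{(2)}_\bullet\to V^{(2)}_\bullet$ from the rank $2$ modular complex to the Voronoi complex for $GL_2$. b) Let $\Gamma$ be a subgroup of $GL_2(\mathbb{Z})$. Then for any $GL_2$-module $V$ there are canonical isomorphisms $$HM^i_{(2)}(\Gamma,V)\otimes\mathbb{Q}\ =\ H^{i-1}(\Gamma,V)\otimes\mathbb{Q}.$$
   Context: **Rank 2 modular complex.** Let $L_2$ be a lattice of rank $2$, with $GL_2(\mathbb{Z})=GL(L_2)$. $M^1_{(2)}$ is the abelian group of (possibly infinite) $\mathbb{Z}$-linear combinations of symbols $[v_1,v_2]$, $(v_1,v_2)$ a basis of $L_2$, modulo the double shuffle relations $[v_1,v_2]+[v_2,v_1]=0$ and $[v_2-v_1,-v_2]+[v_1-v_2,-v_1]=0$. $M^2_{(2)}$ is the group of (possibly infinite) $\mathbb{Z}$-linear combinations of symbols $[v_1]\wedge[v_2]$, $(v_1,v_2)$ a basis, modulo $[v]=[-v]$ in either factor and $[v_1]\wedge[v_2]=-[v_2]\wedge[v_1]$. The differential is $\partial[v_1,v_2]=-[v_1]\wedge[v_2]-[v_2]\wedge[v_0]-[v_0]\wedge[v_1]$ with $v_0=-v_1-v_2$. As a homological complex, $M^{(2)}_2:=M^1_{(2)}$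 and $M^{(2)}_1:=M^2_{(2)}$. **Voronoi complex for $GL_2$.** Let $L_2\subset V_2^*$ be a lattice in the dual of a real plane $V_2$. For $f\in V_2^*$ let $\varphi(f)$ be the quadratic form $x\mapsto(f,x)^2$ on $V_2$. Let $\mathcal{P}$, resp. $\overline{\mathcal{P}}$, be the cone of positive definite, resp. nonnegative definite, quadratic forms on $V_2$; $\mathbb{H}_2=\mathcal{P}/\mathbb{R}_+^*$ is the hyperbolic plane. Project to $\overline{\mathcal{P}}/\mathbb{R}_+^*$ the faces of the convex hull of all $\varphi(l)$, $l\in L_2$ nonzero primitive; those with vertices $\varphi(l_1),\dots,\varphi(l_n)$ and $\operatorname{rk}\langle l_1,\dots,l_n\rangle=2$ are the cells of the Voronoi decomposition of $\mathbb{H}_2$, and such a cell is denoted $\varphi(l_1,\dots,l_n)$ (for a simplex, oriented by the order of its vertices). $V^{(2)}_k$ ($k=2,1$) is the group of (infinite) $\mathbb{Z}$-chains with closed supports on the oriented $k$-dimensional cells (reversing orientation changes the sign), and $d:V^{(2)}_2\to V^{(2)}_1$ is the boundary, normalized as minus the usual simplicial boundary. **Modular cohomology.** For a right $GL_2$-module $V$, $HM^i_{(2)}(\Gamma,V)$ is the $i$-th cohomology of the complex $V\otimes_\Gamma M^*_{(2)}$ (degrees $1,2$). $H^{*}(\Gamma,V)$ is group cohomology.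
   Formalization: In b) V on the cohomology side is twisted by det; untwisted only for Γ in SL_2(Z) (false for Γ=GL_2(Z), V=Z: HM^1⊗Q=0 but H^0⊗Q=Q). V⊗_Γ M uses formal sums with finitely many terms on each Γ-orbit, since literal infinite sums break b) for infinite Γ. Canonical means natural in V. *)

(* Defs.v *)
From HB Require Import structures.
From mathcomp Require Import all_boot all_order all_algebra.
From mathcomp Require Import zify ring.
From mathcomp Require Import boolp classical_sets functions cardinality fsbigop.
From mathcomp Require Import reals.

Set Implicit Arguments.
Unset Strict Implicit.
Unset Printing Implicit Defensive.

Import Order.TTheory GRing.Theory Num.Theory.

Local Open Scope classical_set_scope.
Local Open Scope ring_scope.

(** * Subgroups and subquotients of abelian groups *)

Definition subgroup (G : zmodType) (X : set G) : Prop :=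
  X 0 /\ forall x y, X x -> X y -> X (x - y).

Definition setpred (G : zmodType) (X : set G) : {pred G} := fun x => `[< X x >].

Lemma setpredE (G : zmodType) (X : set G) x : (x \in setpred X) = `[< X x >].
Proof. by []. Qed.

Lemma subgroup_zmod_closed (G : zmodType) (X : set G) :
  subgroup X -> zmod_closed (setpred X).
Proof.
move=> [X0 XB]; split; first by rewrite setpredE; apply/asboolP.
move=> x y; rewrite !setpredE => /asboolP Xx /asboolP Xy.
by apply/asboolP; exact: XB.
Qed.

Definition zclosed (G : zmodType) (X : set G) (H : subgroup X) : zmodClosed G :=
  HB.pack (setpred X)
    (GRing.isZmodClosed.Build G (setpred X) (subgroup_zmod_closed H)).

Record subz (G : zmodType) (Z : zmodClosed G) := Subz {
  subz_val : G;
  subz_valP : subz_val \in Z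
}.

HB.instance Definition _ (G : zmodType) (Z : zmodClosed G) :=
  [isSub for @subz_val G Z].
HB.instance Definition _ (G : zmodType) (Z : zmodClosed G) :=
  [Choice of subz Z by <:].
HB.instance Definition _ (G : zmodType) (Z : zmodClosed G) :=
  [SubChoice_isSubZmodule of subz Z by <:].

Section Subquotient.
Variables (G : zmodType) (Z B : zmodClosed G).

Definition subq_pred : {pred subz Z} := fun x => val x \in B.

Lemma subq_pred_closed : zmod_closed subq_pred.
Proof.
split; first by rewrite unfold_in /subq_pred raddf0; exact: rpred0.
move=> x y; rewrite !unfold_in /subq_pred raddfB => Bx By; exact: rpredB.
Qed.

Definition subq_closed : zmodClosed (subz Z) :=
  HB.pack subq_pred (GRing.isZmodClosed.Build (subz Z) subq_pred subq_pred_closed).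

(* Z / (Z n B) *)
Definition subquot : zmodType := Quotient.quot subq_closed.

Definition qcls (x : subz Z) : subquot := (\pi_(Quotient.quot subq_closed) x)%qT.

End Subquotient.

Section SubquotientMap.
Variables (G G' : zmodType) (Z B : zmodClosed G) (Z' B' : zmodClosed G').

Definition cls (x : G) : subquot Z B := qcls B (insubd 0 x).

Lemma clsE x (Zx : x \in Z) : cls x = qcls B (Subz Zx).
Proof. by rewrite /cls; congr (qcls B _); apply: val_inj; rewrite val_insubd Zx. Qed.

Lemma cls_surj (q : subquot Z B) : exists2 x, x \in Z & q = cls x.
Proof.
have [u ->] : exists u, q = qcls B u by exists (repr q); rewrite /qcls reprK.
exists (val u); first exact: subz_valP.
rewrite /cls; congr (qcls B _); apply: val_inj; rewrite val_insubd.
by rewrite ifT//; exact: subz_valP.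
Qed.

Lemma qcls_eq (u v : subz Z) : (qcls B u == qcls B v) = (val u - val v \in B).
Proof.
rewrite /qcls -Quotient.idealrBE !unfold_in /= /subq_pred.
by congr (_ \in B); rewrite raddfB.
Qed.

Lemma qclsB (u v : subz Z) : qcls B (u - v) = qcls B u - qcls B v.
Proof. by rewrite /qcls raddfB. Qed.

Lemma clsP x y : x \in Z -> y \in Z -> cls x = cls y <-> x - y \in B.
Proof.
move=> Zx Zy; rewrite (clsE Zx) (clsE Zy).
by split=> [/eqP|xy]; [|apply/eqP]; rewrite qcls_eq.
Qed.

Lemma clsB x y : x \in Z -> y \in Z -> cls (x - y) = cls x - cls y.
Proof.
move=> Zx Zy; rewrite (clsE Zx) (clsE Zy) (clsE (rpredB Zx Zy)) -qclsB.
by congr (qcls B _); apply: val_inj; rewrite raddfB.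
Qed.

End SubquotientMap.

(* the map Z/B -> Z'/B' induced by F *)
Definition qmap (G G' : zmodType) (Z B : zmodClosed G) (Z' B' : zmodClosed G')
    (F : G -> G') (q : subquot Z B) : subquot Z' B' :=
  cls Z' B' (F (val (repr q))).

Arguments qmap {G G' Z B Z' B'} F q.

Section QmapTheory.
Variables (G G' : zmodType) (Z B : zmodClosed G) (Z' B' : zmodClosed G').
Variable F : G -> G'.
Hypothesis FZ : forall x, x \in Z -> F x \in Z'.
Hypothesis FB : forall x, x \in Z -> x \in B -> F x \in B'.
Hypothesis FD : {in Z &, {morph F : x y / x - y}}.

Lemma qmapE x : x \in Z -> qmap F (cls Z B x) = cls Z' B' (F x).
Proof.
move=> Zx; rewrite /qmap; set u := repr _.
have Zu : val u \in Z by exact: subz_valP.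
have Bu : val u - x \in B.
  apply/(clsP B Zu Zx); rewrite (clsE B Zu) -[RHS](reprK (cls Z B x)) -/u.
  by rewrite /qcls; congr (\pi_ _)%qT; exact: val_inj.
by apply/(clsP B' (FZ Zu) (FZ Zx)); rewrite -FD// FB// rpredB.
Qed.

Lemma qmap_additive : zmod_morphism (@qmap G G' Z B Z' B' F).
Proof.
move=> p q; have [x Zx ->] := cls_surj p; have [y Zy ->] := cls_surj q.
by rewrite -clsB// !qmapE ?rpredB// FD// clsB ?FZ.
Qed.

End QmapTheory.

(** * Possibly infinite linear combinations of symbols *)

(* A function f : S -> A stands for the formal sum of the terms f x [x].  Given
   a labelling p of the symbols, only finitely many symbols of each label may
   occur in it: an injective p allows all infinite sums, a constant p only the
   finite ones. *)
Definition locfin (S I : Type) (A : zmodType) (p : S -> I) : set (S -> A) :=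
  [set f | forall i, finite_set (p @^-1` [set i] `&` f @^-1` [set~ 0])].

Lemma locfin_subgroup (S I : Type) (A : zmodType) (p : S -> I) :
  subgroup (@locfin S I A p).
Proof.
split=> [i|f g lf lg i].
  by apply: (sub_finite_set _ (finite_set0 S)) => x /= [_]; apply.
apply: (@sub_finite_set _ _ ((p @^-1` [set i] `&` f @^-1` [set~ 0]) `|`
                             (p @^-1` [set i] `&` g @^-1` [set~ 0]))).
  move=> x /= [px fgx]; case: (eqVneq (f x) 0) => [fx0|/eqP fx]; last by left.
  by right; split=> // gx0; apply: fgx; rewrite !fctE fx0 gx0 subr0.
by rewrite finite_setU.
Qed.

(* [x] |-> [h x], extended to infinite sums *)
Definition push (S T : choiceType) (A : zmodType) (h : S -> T) (f : S -> A) :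
    T -> A :=
  fun y => \sum_(x \in h @^-1` [set y]) f x.

Section Push.
Variables (S T : choiceType) (A : zmodType).
Implicit Types (h : S -> T) (f g : S -> A).

Definition pushable h f : Prop :=
  forall y, finite_set (h @^-1` [set y] `&` f @^-1` [set~ 0]).

Lemma locfin_pushable (I : Type) (p : S -> I) h f :
  (forall x y, h x = h y -> p x = p y) -> locfin p f -> pushable h f.
Proof.
move=> hp lf y.
case: (pselect (exists x, h x = y)) => [[x0 <-]|nx]; last first.
  by apply: (sub_finite_set _ (finite_set0 S)) => x /= [hx _]; case: nx; exists x.
by apply: sub_finite_set (lf (p x0)) => x /= [hx fx]; split=> //; exact: hp.
Qed.

Lemma pushB h f g : pushable h f -> pushable h g ->
  push h (f - g) = push h f - push h g.
Proof.
move=> hf hg; apply/funext => y; rewrite !fctE /push.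
pose D := (h @^-1` [set y] `&` f @^-1` [set~ 0]) `|`
          (h @^-1` [set y] `&` g @^-1` [set~ 0]).
have fD : finite_set D by rewrite finite_setU.
have DP : D `<=` h @^-1` [set y] by move=> x /= [[]|[]].
rewrite -[LHS](@fsbig_widen _ _ _ _ D)//; last first.
  move=> x /= [hx nD]; apply: contrapT => fgx; apply: nD.
  case: (eqVneq (f x) 0) => [fx0|/eqP fx]; last by left.
  by right; split=> // gx0; apply: fgx; rewrite fx0 gx0 subr0.
rewrite -[X in _ = X - _](@fsbig_widen _ _ _ _ D)//; last first.
  by move=> x /= [hx nD]; apply: contrapT => fx; apply: nD; left.
rewrite -[X in _ = _ - X](@fsbig_widen _ _ _ _ D)//; last first.
  by move=> x /= [hx nD]; apply: contrapT => gx; apply: nD; right.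
by rewrite !fsbig_finite// -sumrB.
Qed.

Lemma push_can h (k : T -> S) f : cancel h k -> cancel k h -> push h f = f \o k.
Proof.
move=> hk kh; apply/funext => y; rewrite /push /=.
rewrite (_ : h @^-1` [set y] = [set k y]) ?fsbig_set1//.
by apply/seteqP; split=> x /=; [move=> <-|move=> ->].
Qed.

End Push.

Lemma push_reindex (S T : choiceType) (A : zmodType) (h : S -> T) (f : S -> A)
    (K K' : S -> S) (k : T -> T) :
  cancel K K' -> cancel K' K -> injective k -> (forall x, h (K x) = k (h x)) ->
  push h f \o k = push h (f \o K).
Proof.
move=> KK' K'K ik hK; apply/funext => y; rewrite /push /=.
apply: reindex_fsbig; split.
- by move=> x /= <-.
- by move=> x x' _ _; exact: (can_inj KK').
- by move=> x /= hx; exists (K' x); rewrite ?K'K//=; apply: ik; rewrite -hK K'K.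
Qed.

Definition setadd (G : zmodType) (X Y : set G) : set G :=
  [set x + y | x in X & y in Y].

Lemma setadd_subgroup (G : zmodType) (X Y : set G) :
  subgroup X -> subgroup Y -> subgroup (setadd X Y).
Proof.
move=> [X0 XB] [Y0 YB]; split; first by exists 0 => //; exists 0 => //; exact: addr0.
move=> _ _ [x Xx [y Yy <-]] [x' Xx' [y' Yy' <-]].
exists (x - x'); first exact: XB.
by exists (y - y'); [exact: YB | rewrite opprD addrACA].
Qed.

(** * The tensor product of two abelian groups *)

Section Tensor.
Variables A B : zmodType.

Definition tens_rels : set (A * B -> int) :=
  [set r | exists c : A * A * B -> int, exists d : A * B * B -> int,
     [/\ locfin (fun=> tt) c, locfin (fun=> tt) d &
         r = (push (fun t => (t.1.1 + t.1.2, t.2)) c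
                - push (fun t => (t.1.1, t.2)) c
                - push (fun t => (t.1.2, t.2)) c)
           + (push (fun t => (t.1.1, t.1.2 + t.2)) d
                - push (fun t => (t.1.1, t.1.2)) d
                - push (fun t => (t.1.1, t.2)) d)]].

Lemma tens_rels_subgroup : subgroup tens_rels.
Proof.
have fP (S T : choiceType) (h : S -> T) (f : S -> int) :
    locfin (fun=> tt) f -> pushable h f by exact: locfin_pushable.
have l0 (S : choiceType) : locfin (fun=> tt) (0 : S -> int).
  exact: (locfin_subgroup _ _).1.
have p0 (S T : choiceType) (h : S -> T) : push h (0 : S -> int) = 0.
  have f0 : pushable h (0 : S -> int) by exact: fP.
  by rewrite -[X in push h X](subrr 0) pushB// subrr.
split; first by exists 0, 0; split=> //; rewrite !p0 !(subrr, addr0).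
move=> _ _ [c [d [lc ld ->]]] [c' [d' [lc' ld' ->]]].
exists (c - c'), (d - d'); split; try exact: (locfin_subgroup _ _).2.
rewrite !pushB; try exact: fP.
apply/funext => x; rewrite !fctE; ring.
Qed.

Definition tens : zmodType :=
  subquot (zclosed (@locfin_subgroup (A * B)%type unit int (fun=> tt)))
          (zclosed tens_rels_subgroup).

End Tensor.

(* f (x) id *)
Definition tens_map (A A' B : zmodType) (f : A -> A') :
    tens A B -> tens A' B :=
  qmap (push (fun x : A * B => (f x.1, x.2))).

(** * Cochain complexes *)

Record complex := Complex {
  cob :> nat -> zmodType;
  cdiff : forall n, {additive cob n -> cob n.+1};
  cdiffK : forall n x, cdiff n.+1 (cdiff n x) = 0
}.

Section Cohomology.
Variable C : complex.

Definition cocycles n : set (C n) := [set x | cdiff C n x = 0].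

Arguments cocycles n : clear implicits.

Definition coboundaries n : set (C n) :=
  match n with
  | 0 => [set 0]
  | m.+1 => range (cdiff C m)
  end.

Arguments coboundaries n : clear implicits.

Lemma cocycles_subgroup n : subgroup (cocycles n).
Proof.
split=> [|x y]; rewrite /cocycles /= ?raddf0// => dx dy.
by rewrite raddfB dx dy subrr.
Qed.

Lemma coboundaries_subgroup n : subgroup (coboundaries n).
Proof.
case: n => [|n]; first by split=> [//|x y -> ->]; rewrite /= subrr.
split=> [|_ _ [x _ <-] [y _ <-]]; first by exists 0; rewrite ?raddf0.
by exists (x - y); rewrite ?raddfB.
Qed.

Definition cohom n : zmodType :=
  subquot (zclosed (cocycles_subgroup n)) (zclosed (coboundaries_subgroup n)).

End Cohomology.

(* the map in cohomology induced by a morphism of complexes *)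
Definition cohom_map (C C' : complex) (f : forall n, C n -> C' n) n :
    cohom C n -> cohom C' n :=
  qmap (f n).

(** * Right modules and group cohomology *)

Record rmod (G : groupType) := RMod {
  rcar :> zmodType;
  ract : rcar -> G -> rcar;
  ractB : forall g, {morph ract^~ g : v w / v - w};
  ract1 : forall v, ract v 1%g = v;
  ractM : forall v g h, ract (ract v g) h = ract v (g * h)%g
}.

Definition rmod_hom (G : groupType) (V W : rmod G) (f : V -> W) : Prop :=
  {morph f : v w / v - w} /\ forall v g, f (ract v g) = ract (f v) g.

Record subG (G : groupType) (H : groupClosed G) := SubG {
  subG_val : G;
  subG_valP : subG_val \in H
}.

HB.instance Definition _ (G : groupType) (H : groupClosed G) :=
  [isSub for @subG_val G H].
HB.instance Definition _ (G : groupType) (H : groupClosed G) :=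
  [Choice of subG H by <:].

Lemma groupClosed_closed (G : groupType) (H : groupClosed G) : group_closed H.
Proof. by split=> [|x y Hx Hy]; rewrite ?gpred1// gpredF. Qed.

HB.instance Definition _ (G : groupType) (H : groupClosed G) :=
  SubChoice_isSubGroup.Build G _ (subG H) (groupClosed_closed H).

Section Restriction.
Variables (G : groupType) (H : groupClosed G) (V : rmod G).

Definition res_act (v : V) (h : subG H) : V := ract v (val h).

Lemma res_act1 v : res_act v 1%g = v.
Proof. exact: ract1. Qed.

Lemma res_actM v g h : res_act (res_act v g) h = res_act v (g * h)%g.
Proof. exact: ractM. Qed.

Definition res : rmod (subG H) :=
  RMod (fun h => @ractB _ V (val h)) res_act1 res_actM.

End Restriction.

Section GroupCohomology.
Variables (G : groupType) (V : rmod G).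

(* homogeneous cochains; left multiplication by g on V is the right action of
   g^-1, so left equivariance becomes the right equivariance below *)
Definition cochains n : set (('I_n.+1 -> G) -> V) :=
  [set f | forall g x, f (fun i => x i * g)%g = ract (f x) g].
Arguments cochains n : clear implicits.

Lemma cochains_subgroup n : subgroup (cochains n).
Proof.
have r0 g : ract (0 : V) g = 0 by rewrite -[X in ract X](subrr 0) ractB subrr.
split=> [g x|f f' hf hf' g x]; first by rewrite /= r0.
by rewrite !fctE hf hf' ractB.
Qed.

Definition cochain n : zmodType := subz (zclosed (@cochains_subgroup n)).

Definition cobd n (f : ('I_n.+1 -> G) -> V) (x : 'I_n.+2 -> G) : V :=
  \sum_(i < n.+2) f (x \o lift i) *~ (-1) ^+ i.

Lemma cobdB n : {morph @cobd n : f f' / f - f'}.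
Proof.
move=> f f'; apply/funext => x; rewrite !fctE /cobd -sumrB.
by apply: eq_bigr => i _; rewrite mulrzBl.
Qed.

Lemma cobd_cochains n f : cochains n f -> cochains n.+1 (cobd f).
Proof.
move=> hf g x; rewrite /cobd.
have ractD (v w : V) : ract (v + w) g = ract v g + ract w g.
  have r0 : ract (0 : V) g = 0 by rewrite -[X in ract X](subrr 0) ractB subrr.
  by rewrite -{1}[w]opprK ractB -[- w]sub0r ractB r0 sub0r opprK.
have ractMz (v : V) (z : int) : ract (v *~ z) g = ract v g *~ z.
  pose r := fun v : V => ract v g.
  pose rA := GRing.isZmodMorphism.Build V V r (@ractB _ V g).
  pose ra : {additive V -> V} := HB.pack r rA.
  exact: (raddfMz ra).
rewrite (big_morph (fun v : V => ract v g) ractD (id1 := 0)); last first.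
  by rewrite -[X in ract X](subrr 0) ractB subrr.
by apply: eq_bigr => i _; rewrite ractMz -hf.
Qed.

Lemma cobdK n f : @cobd n.+1 (cobd f) = 0.
Proof.
apply/funext => x; rewrite [RHS]/(0 : V) /cobd /=.
pose T (p : 'I_n.+3 * 'I_n.+2) :=
  f ((x \o lift p.1) \o lift p.2) *~ (-1) ^+ (p.1 + p.2).
transitivity (\sum_p T p).
  rewrite -(pair_bigA _ (fun i j => T (i, j))) /=; apply: eq_bigr => i _.
  rewrite mulrz_suml; apply: eq_bigr => j _.
  by rewrite /T /= -mulrzA exprD mulrC.
rewrite (bigID (fun p : 'I_n.+3 * 'I_n.+2 => (p.1 <= p.2)%N)) /=.
pose h (p : 'I_n.+3 * 'I_n.+2) : 'I_n.+3 * 'I_n.+2 :=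
  (inord p.2.+1, inord p.1).
pose h' (p : 'I_n.+3 * 'I_n.+2) : 'I_n.+3 * 'I_n.+2 :=
  (inord p.2, inord p.1.-1).
rewrite [X in _ + X](reindex_onto h h') /=; last first.
  move=> [i j] /=; rewrite -ltnNge => ji; have := ltn_ord i; have := ltn_ord j.
  move=> jn iN; congr (_, _); apply: val_inj; rewrite /= !inordK //=; lia.
rewrite [X in _ + X](eq_bigl (fun p : 'I_n.+3 * 'I_n.+2 => (p.1 <= p.2)%N)).
  rewrite -big_split /= big1// => -[i j] /= ij.
  have := ltn_ord i; have := ltn_ord j => jn iN.
  rewrite /T /= !inordK; try lia.
  rewrite (_ : (x \o lift (inord j.+1)) \o lift (inord i)
    = (x \o lift i) \o lift j); last first.
    apply/funext => k /=; congr x; apply: val_inj.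
    rewrite /= /bump !inordK; lia.
  by rewrite addSn exprS addnC mulN1r mulrNz subrr.
move=> [i j] /=; have := ltn_ord i; have := ltn_ord j => jn iN.
rewrite -ltnNge; apply/andP/idP => [[]|ij].
  move=> + /eqP [] /(congr1 val) /= + _.
  set m : 'I_n.+2 := inord i; have mn := ltn_ord m.
  rewrite (@inordK _ m); last lia.
  by move=> + mi; rewrite mi inordK; lia.
split; first by rewrite !inordK; lia.
by apply/eqP; congr (_, _); apply: val_inj; rewrite /= !inordK //=; lia.
Qed.

Lemma cochain_diff_subproof n (c : cochain n) :
  cobd (val c) \in zclosed (@cochains_subgroup n.+1).
Proof. by apply/asboolP/cobd_cochains/asboolP; exact: (subz_valP c). Qed.

Definition cochain_diff n (c : cochain n) : cochain n.+1 :=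
  Subz (cochain_diff_subproof c).

Lemma cochain_diff_additive n : zmod_morphism (@cochain_diff n).
Proof. by move=> c c'; apply: val_inj; rewrite /= cobdB. Qed.

HB.instance Definition _ n :=
  GRing.isZmodMorphism.Build (cochain n) (cochain n.+1) (@cochain_diff n)
    (@cochain_diff_additive n).

Lemma cochain_diffK n (c : cochain n) : cochain_diff (cochain_diff c) = 0.
Proof. by apply: val_inj; rewrite /= cobdK. Qed.

Definition cochain_complex : complex := Complex cochain_diffK.

Definition Hgrp n : zmodType := cohom cochain_complex n.

End GroupCohomology.

Arguments Hgrp : clear implicits.

Definition cochain_map (G : groupType) (V W : rmod G) (f : V -> W) n :
    cochain V n -> cochain W n :=
  fun c => insubd 0 (fun x => f (val c x)).

Definition Hgrp_map (G : groupType) (V W : rmod G) (f : V -> W) n :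
    Hgrp G V n -> Hgrp G W n :=
  cohom_map (C := cochain_complex V) (C' := cochain_complex W)
    (@cochain_map G V W f) (n := n).

Arguments Hgrp_map {G} V W f n _.

(** * The lattice Z^2, its bases and GL_2(Z) *)

Notation lat2 := 'cV[int]_2.

Record GL2Z := GL2 { GL2_val : 'M[int]_2; GL2_valP : GL2_val \in unitmx }.

HB.instance Definition _ := [isSub for GL2_val].
HB.instance Definition _ := [Choice of GL2Z by <:].

Section GL2Group.
Implicit Types g h : GL2Z.

Lemma GL2_one_subproof : (1%:M : 'M[int]_2) \in unitmx.
Proof. exact: unitmx1. Qed.

Lemma GL2_mul_subproof g h : val g *m val h \in unitmx.
Proof. by rewrite unitmx_mul !GL2_valP. Qed.

Lemma GL2_inv_subproof g : invmx (val g) \in unitmx.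
Proof. by rewrite unitmx_inv GL2_valP. Qed.

Definition GL2_mul g h : GL2Z := GL2 (GL2_mul_subproof g h).
Definition GL2_inv g : GL2Z := GL2 (GL2_inv_subproof g).

Lemma GL2_mulA : associative GL2_mul.
Proof. by move=> g h k; apply: val_inj; rewrite /= mulmxA. Qed.

Lemma GL2_mul1 : left_id (GL2 GL2_one_subproof) GL2_mul.
Proof. by move=> g; apply: val_inj; rewrite /= mul1mx. Qed.

Lemma GL2_1mul : right_id (GL2 GL2_one_subproof) GL2_mul.
Proof. by move=> g; apply: val_inj; rewrite /= mulmx1. Qed.

Lemma GL2_mulV : left_inverse (GL2 GL2_one_subproof) GL2_inv GL2_mul.
Proof. by move=> g; apply: val_inj; rewrite /= mulVmx// GL2_valP. Qed.

Lemma GL2_Vmul : right_inverse (GL2 GL2_one_subproof) GL2_inv GL2_mul.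
Proof. by move=> g; apply: val_inj; rewrite /= mulmxV// GL2_valP. Qed.

End GL2Group.

HB.instance Definition _ :=
  isGroup.Build GL2Z GL2_mulA GL2_mul1 GL2_1mul GL2_mulV GL2_Vmul.

Section DetTwist.
Variable V : rmod GL2Z.

Definition det_act (v : V) (g : GL2Z) : V := ract v g *~ \det (val g).

Lemma det_actB g : {morph det_act^~ g : v w / v - w}.
Proof. by move=> v w; rewrite /det_act ractB mulrzBl. Qed.

Lemma det_act1 v : det_act v 1%g = v.
Proof. by rewrite /det_act ract1 det1 mulr1z. Qed.

Lemma ractMz v g (z : int) : ract (v *~ z) g = ract v g *~ z :> V.
Proof.
pose r := fun v : V => ract v g.
pose rA := GRing.isZmodMorphism.Build V V r (@ractB _ V g).
pose ra : {additive V -> V} := HB.pack r rA.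
exact: (raddfMz ra).
Qed.

Lemma det_actM v g h : det_act (det_act v g) h = det_act v (g * h)%g.
Proof. by rewrite /det_act ractMz ractM -mulrzA det_mulmx. Qed.

(* V (x) det *)
Definition det_twist : rmod GL2Z := RMod det_actB det_act1 det_actM.

End DetTwist.

Definition isbasis (v w : lat2) : bool := row_mx v w \in unitmx.

Record basis := Basis { bas : lat2 * lat2; basP : isbasis bas.1 bas.2 }.

HB.instance Definition _ := [isSub for bas].
HB.instance Definition _ := [Choice of basis by <:].

Lemma det22 (A : 'M[int]_2) :
  \det A = A ord0 ord0 * A ord_max ord_max - A ord0 ord_max * A ord_max ord0.
Proof.
rewrite (expand_det_row _ ord0) !big_ord_recl big_ord0 /cofactor !det_mx11 !mxE.
rewrite (_ : lift ord0 0 = ord_max); last exact: val_inj.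
rewrite (_ : lift ord_max 0 = ord0); last exact: val_inj.
by rewrite /= /bump /=; ring.
Qed.

Lemma isbasisE (v w : lat2) :
  isbasis v w = (v ord0 ord0 * w ord_max ord0 - w ord0 ord0 * v ord_max ord0
                   \is a GRing.unit).
Proof.
have rl i : (row_mx v w : 'M_2) i ord0 = v i ord0.
  by rewrite -(row_mxEl v w i ord0); congr (row_mx v w _ _); exact: val_inj.
have rr i : (row_mx v w : 'M_2) i ord_max = w i ord0.
  by rewrite -(row_mxEr v w i ord0); congr (row_mx v w _ _); exact: val_inj.
by rewrite /isbasis unitmxE (det22 (row_mx v w)) !rl !rr.
Qed.

Lemma isbasis_lin (a b c d : int) (v w : lat2) : isbasis v w ->
  a * d - b * c \is a GRing.unit ->
  isbasis (a *: v + b *: w) (c *: v + d *: w).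
Proof.
rewrite !isbasisE !mxE => vw abcd.
set D := (X in X \is a _) in vw; set E := (X in X \is a _) in abcd.
suff -> : (a * v ord0 ord0 + b * w ord0 ord0) *
   (c * v ord_max ord0 + d * w ord_max ord0) -
   (c * v ord0 ord0 + d * w ord0 ord0) *
   (a * v ord_max ord0 + b * w ord_max ord0) = D * E by rewrite unitrM vw.
by rewrite /D /E; ring.
Qed.

Definition basis_op_closed (f : lat2 -> lat2 -> lat2 * lat2) : Prop :=
  forall v w, isbasis v w -> isbasis (f v w).1 (f v w).2.

Ltac basis_lin a b c d :=
  let H := fresh in
  move=> v w H; have := @isbasis_lin a b c d v w H isT;
  rewrite ?(scale0r, scale1r, scaleN1r, addr0, add0r).

Lemma swap_closed : basis_op_closed (fun v w => (w, v)).
Proof. by basis_lin (0 : int) (1 : int) (1 : int) (0 : int). Qed.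

Lemma neg1_closed : basis_op_closed (fun v w => (- v, w)).
Proof. by basis_lin (- 1 : int) (0 : int) (0 : int) (1 : int). Qed.

Lemma neg2_closed : basis_op_closed (fun v w => (v, - w)).
Proof. by basis_lin (1 : int) (0 : int) (0 : int) (- 1 : int). Qed.

Lemma rot_closed : basis_op_closed (fun v w => (w, - v - w)).
Proof. by basis_lin (0 : int) (1 : int) (- 1 : int) (- 1 : int). Qed.

Lemma rot2_closed : basis_op_closed (fun v w => (- v - w, v)).
Proof. by basis_lin (- 1 : int) (- 1 : int) (1 : int) (0 : int). Qed.

Lemma shl_closed : basis_op_closed (fun v w => (w - v, - w)).
Proof. by basis_lin (- 1 : int) (1 : int) (0 : int) (- 1 : int); rewrite addrC. Qed.

Lemma shr_closed : basis_op_closed (fun v w => (v - w, - v)).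
Proof. by basis_lin (1 : int) (- 1 : int) (- 1 : int) (0 : int). Qed.

Definition bop f (H : basis_op_closed f) (b : basis) : basis :=
  @Basis (f (val b).1 (val b).2) (H _ _ (basP b)).

Definition swap := bop swap_closed.
Definition neg1 := bop neg1_closed.
Definition neg2 := bop neg2_closed.
Definition rot := bop rot_closed.
Definition rot2 := bop rot2_closed.
Definition shl := bop shl_closed.
Definition shr := bop shr_closed.

Lemma bact_subproof (g : GL2Z) (b : basis) :
  isbasis (val g *m (val b).1) (val g *m (val b).2).
Proof.
by have := basP b; rewrite /isbasis -mul_mx_row unitmx_mul GL2_valP.
Qed.

(* left action of GL_2(Z) on bases *)
Definition bact (g : GL2Z) (b : basis) : basis :=
  @Basis (val g *m (val b).1, val g *m (val b).2) (bact_subproof g b).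

Lemma bact1 b : bact 1%g b = b.
Proof. by apply: val_inj; rewrite /= !mul1mx; case: (val b). Qed.

Lemma bactM g h b : bact (g * h)%g b = bact g (bact h b).
Proof. by apply: val_inj; rewrite /= !mulmxA. Qed.

Lemma bactK g : cancel (bact g) (bact g^-1%g).
Proof. by move=> b; rewrite -bactM mulVg bact1. Qed.

(* automorphisms of the GL_2(Z)-set of bases, with inverse k *)
Definition beq (h k : basis -> basis) : Prop :=
  [/\ cancel h k, cancel k h, forall g b, h (bact g b) = bact g (h b) &
      forall g b, k (bact g b) = bact g (k b)].

Ltac basis_eq :=
  match goal with b : basis |- _ =>
    apply: val_inj; rewrite /= ?(mulmxDr, mulmxN); case: (val b) => ? ? /=;
    congr (_, _); apply/matrixP => ? ?; rewrite !mxE; ring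
  end.

Lemma beq_swap : beq swap swap.
Proof. by split; [move=> b|move=> b|move=> g b|move=> g b]; basis_eq. Qed.

Lemma beq_neg1 : beq neg1 neg1.
Proof. by split; [move=> b|move=> b|move=> g b|move=> g b]; basis_eq. Qed.

Lemma beq_neg2 : beq neg2 neg2.
Proof. by split; [move=> b|move=> b|move=> g b|move=> g b]; basis_eq. Qed.

Lemma beq_rot : beq rot rot2.
Proof. by split; [move=> b|move=> b|move=> g b|move=> g b]; basis_eq. Qed.

Lemma beq_sym h k : beq h k -> beq k h.
Proof. by case=> ? ? ? ?; split. Qed.

Definition beq_rot2 : beq rot2 rot := beq_sym beq_rot.

Lemma beq_comp h k h' k' : beq h k -> beq h' k' -> beq (h \o h') (k' \o k).
Proof.
move=> [hk kh hg kg] [hk' kh' hg' kg']; split; try exact: can_comp.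
  by move=> g b; rewrite /= hg' hg.
by move=> g b; rewrite /= kg kg'.
Qed.

Definition beq_neg : beq (neg1 \o neg2) (neg2 \o neg1) :=
  beq_comp beq_neg1 beq_neg2.

Lemma shlE : shl = neg1 \o neg2 \o (rot2 \o (neg2 \o swap)).
Proof. by apply/funext => b; basis_eq. Qed.

Lemma shrE : shr = shl \o swap.
Proof. by apply/funext => b; basis_eq. Qed.

Definition shlV := (swap \o neg2 \o rot) \o (neg2 \o neg1).
Definition shrV := swap \o shlV.

Lemma beq_shl : beq shl shlV.
Proof.
rewrite shlE /shlV; apply: beq_comp beq_neg _.
by apply: (beq_comp beq_rot2); apply: beq_comp beq_neg2 beq_swap.
Qed.

Lemma beq_shr : beq shr shrV.
Proof. by rewrite shrE /shrV; apply: beq_comp beq_shl beq_swap. Qed.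

(* labellings of the bases that only depend on orbits under a subgroup *)
Definition blabel (I : Type) (p : basis -> I) : Prop :=
  forall h k, beq h k -> forall b b', p b = p b' -> p (h b) = p (h b').

Lemma blabel_id : blabel idfun.
Proof. by move=> h k _ b b' /= ->. Qed.

Lemma locfin_comp (I : Type) (p : basis -> I) (A : zmodType) h k
    (f : basis -> A) : blabel p -> beq h k -> locfin p f -> locfin p (f \o k).
Proof.
move=> bp hk lf i; have [hkK khK _ _] := hk.
case: (pselect (exists b, p b = i)) => [[b0 <-]|nb]; last first.
  by apply: (sub_finite_set _ (finite_set0 _)) => b /= [pb _]; case: nb; exists b.
apply: (sub_finite_set _ (finite_image h (lf (p (k b0))))) => b /= [pb fb].
by exists (k b); [split=> //; exact: bp (beq_sym hk) _ _ pb | exact: khK].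
Qed.

(** * The rank 2 modular complex *)

Lemma subrDD (G : zmodType) (x y x' y' : G) :
  x + y - (x' + y') = (x - x') + (y - y').
Proof. by rewrite opprD addrACA. Qed.

Lemma subrBB (G : zmodType) (x y x' y' : G) :
  x - y - (x' - y') = (x - x') - (y - y').
Proof. by rewrite subrDD opprK [- (y - y')]opprB [- y + y']addrC. Qed.

Section ModularRelations.
Variables (I : Type) (p : basis -> I) (A : zmodType).
Hypothesis bp : blabel p.
Implicit Types a b c f : basis -> A.

(* sums of multiples of [v1,v2] + [v2,v1] and of
   [v2 - v1, - v2] + [v1 - v2, - v1] *)
Definition double_shuffles : set (basis -> A) :=
  [set r | exists a b, [/\ locfin p a, locfin p b &
     r = (a + push swap a) + (push shl b + push shr b)]].

(* sums of multiples of [v1]^[v2] - [-v1]^[v2], [v1]^[v2] - [v1]^[-v2] and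
   [v1]^[v2] + [v2]^[v1] *)
Definition wedge_rels : set (basis -> A) :=
  [set r | exists a b c, [/\ locfin p a, locfin p b, locfin p c &
     r = (a - push neg1 a) + (b - push neg2 b) + (c + push swap c)]].

(* [v1,v2] |-> - [v1]^[v2] - [v2]^[v0] - [v0]^[v1], with v0 = - v1 - v2 *)
Definition mdiff f : basis -> A := - f - push rot f - push rot2 f.

Lemma push_beq h k f : beq h k -> push h f = f \o k.
Proof. by case=> hk kh _ _; exact: push_can. Qed.

Lemma locfinB f b : locfin p f -> locfin p b -> locfin p (f - b).
Proof. exact: (locfin_subgroup _ _).2. Qed.

Lemma locfin0 : locfin p (0 : basis -> A).
Proof. exact: (locfin_subgroup _ _).1. Qed.

Lemma double_shuffles_subgroup : subgroup double_shuffles.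
Proof.
have e0 (k : basis -> basis) : (0 : basis -> A) \o k = 0 by [].
split=> [|_ _ [a [b [la lb ->]]] [a' [b' [la' lb' ->]]]].
  exists 0, 0; split; try exact: locfin0.
  rewrite (push_beq _ beq_swap) (push_beq _ beq_shl) (push_beq _ beq_shr).
  by rewrite !e0 !addr0.
exists (a - a'), (b - b'); split; try exact: locfinB.
rewrite !(push_beq _ beq_swap) !(push_beq _ beq_shl) !(push_beq _ beq_shr).
apply/funext => x; rewrite !fctE /= [LHS]subrDD.
by congr (_ + _); rewrite [LHS]subrDD.
Qed.

Lemma wedge_rels_subgroup : subgroup wedge_rels.
Proof.
have e0 (k : basis -> basis) : (0 : basis -> A) \o k = 0 by [].
split=> [|_ _ [a [b [c [la lb lc ->]]]] [a' [b' [c' [la' lb' lc' ->]]]]].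
  exists 0, 0, 0; split; try exact: locfin0.
  rewrite (push_beq _ beq_swap) (push_beq _ beq_neg1) (push_beq _ beq_neg2).
  by rewrite !e0 !(subrr, addr0).
exists (a - a'), (b - b'), (c - c'); split; try exact: locfinB.
rewrite !(push_beq _ beq_swap) !(push_beq _ beq_neg1) !(push_beq _ beq_neg2).
apply/funext => x; rewrite !fctE /= [LHS]subrDD [X in X + _ = _]subrDD.
congr (_ + _ + _); [by rewrite [LHS]subrBB | by rewrite [LHS]subrBB |].
by rewrite [LHS]subrDD.
Qed.

Lemma wedge_rels0 : wedge_rels 0.
Proof. exact: wedge_rels_subgroup.1. Qed.

Lemma wedge_relsN x : wedge_rels x -> wedge_rels (- x).
Proof.
by move=> wx; rewrite -sub0r; exact: (wedge_rels_subgroup.2 _ _ wedge_rels0 wx).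
Qed.

Lemma wedge_relsD x y : wedge_rels x -> wedge_rels y -> wedge_rels (x + y).
Proof.
move=> wx wy; rewrite -[y]opprK.
by apply: (wedge_rels_subgroup.2 _ _ wx); exact: wedge_relsN.
Qed.

Lemma wedge_neg1 a : locfin p a -> wedge_rels (a - (a \o neg1)).
Proof.
move=> la; exists a, 0, 0; split=> //; try exact: locfin0.
rewrite (push_beq _ beq_swap) (push_beq _ beq_neg1) (push_beq _ beq_neg2).
by apply/funext => x; rewrite !fctE /= !(subrr, addr0).
Qed.

Lemma wedge_neg2 a : locfin p a -> wedge_rels (a - (a \o neg2)).
Proof.
move=> la; exists 0, a, 0; split=> //; try exact: locfin0.
rewrite (push_beq _ beq_swap) (push_beq _ beq_neg1) (push_beq _ beq_neg2).
by apply/funext => x; rewrite !fctE /= !(subrr, addr0, add0r).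
Qed.

Lemma wedge_swap a : locfin p a -> wedge_rels (a + (a \o swap)).
Proof.
move=> la; exists 0, 0, a; split=> //; try exact: locfin0.
rewrite (push_beq _ beq_swap) (push_beq _ beq_neg1) (push_beq _ beq_neg2).
by apply/funext => x; rewrite !fctE /= !(subrr, add0r).
Qed.

Lemma mdiffE f : mdiff f = - (f + (f \o rot2) + (f \o rot)).
Proof.
by rewrite /mdiff (push_beq _ beq_rot) (push_beq _ beq_rot2) !opprD.
Qed.

Lemma mdiffB f b : mdiff (f - b) = mdiff f - mdiff b.
Proof.
rewrite !mdiffE -opprD; congr (- _); apply/funext => x; rewrite !fctE /=.
by rewrite [RHS]subrDD [X in _ = X + _]subrDD.
Qed.

Lemma locfinN f : locfin p f -> locfin p (- f).
Proof. by move=> lf; rewrite -sub0r; exact: locfinB locfin0 lf. Qed.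

Lemma locfinD f b : locfin p f -> locfin p b -> locfin p (f + b).
Proof. by move=> lf lb; rewrite -[b]opprK; exact: locfinB lf (locfinN lb). Qed.

Lemma locfin_mdiff f : locfin p f -> locfin p (mdiff f).
Proof.
move=> lf; rewrite mdiffE; apply/locfinN/locfinD.
  by apply: locfinD => //; exact: locfin_comp bp beq_rot lf.
exact: locfin_comp bp beq_rot2 lf.
Qed.

Lemma mdiff_swap f : mdiff (f \o swap) = mdiff f \o swap.
Proof.
rewrite !mdiffE; apply/funext => x; rewrite !fctE /= addrAC; congr (- (_ + f _ + f _)).
  by basis_eq.
by basis_eq.
Qed.

Lemma mdiff_neg f : mdiff (f \o (neg1 \o neg2)) = mdiff f \o (neg1 \o neg2).
Proof.
rewrite !mdiffE; apply/funext => x; rewrite !fctE /=; congr (- (_ + f _ + f _)).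
  by basis_eq.
by basis_eq.
Qed.

Lemma mdiff_rot f : mdiff (f \o rot) = mdiff f.
Proof.
rewrite !mdiffE; apply/funext => x; rewrite !fctE /=; congr (- _).
rewrite (_ : rot (rot2 x) = x); last by basis_eq.
rewrite (_ : rot (rot x) = rot2 x); last by basis_eq.
by rewrite -addrA addrC.
Qed.

Lemma mdiff_rels r : double_shuffles r -> wedge_rels (mdiff r).
Proof.
have mD a b : mdiff (a + b) = mdiff a + mdiff b.
  have m0 : mdiff 0 = 0 by rewrite -[X in mdiff X](subrr 0) mdiffB subrr.
  by rewrite -{1}[b]opprK mdiffB -[- b]sub0r mdiffB m0 sub0r opprK.
move=> [a [b [la lb ->]]].
rewrite (push_beq _ beq_swap) (push_beq _ beq_shl) (push_beq _ beq_shr).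
rewrite mD; apply: wedge_relsD.
  by rewrite mD mdiff_swap; apply: wedge_swap; exact: locfin_mdiff.
pose c := b \o shlV; rewrite -/c.
have lc : locfin p c by exact: locfin_comp bp beq_shl lb.
have -> : b \o shrV = ((c \o (neg1 \o neg2)) \o rot) \o swap.
  apply/funext => x /=; congr b.
  by basis_eq.
rewrite mD mdiff_swap mdiff_rot mdiff_neg.
have := locfin_mdiff lc; move: (mdiff c) => u lu.
have luN : locfin p (u \o (neg1 \o neg2)).
  exact: locfin_comp bp (beq_comp beq_neg2 beq_neg1) lu.
set y := u \o (neg1 \o neg2); pose x := u \o neg1.
have -> : u + (y \o swap) = ((u - x) + (x - y)) + (y + (y \o swap)).
  by rewrite [u - x + _]addrA subrK addrA subrK.
apply: wedge_relsD; last exact: wedge_swap.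
apply: wedge_relsD; first exact: wedge_neg1.
exact: (wedge_neg2 (locfin_comp bp beq_neg1 lu)).
Qed.

End ModularRelations.

(* the groups M^1 and M^2 of infinite integral combinations of symbols *)
Definition M1 : zmodType :=
  subquot (zclosed (@locfin_subgroup basis basis int idfun))
          (zclosed (@double_shuffles_subgroup basis idfun int)).

Definition M2 : zmodType :=
  subquot (zclosed (@locfin_subgroup basis basis int idfun))
          (zclosed (@wedge_rels_subgroup basis idfun int)).

(* the class of a formal sum of symbols; every f is locfin for idfun *)
Definition M1cls (f : basis -> int) : M1 := cls _ _ f.
Definition M2cls (f : basis -> int) : M2 := cls _ _ f.

Definition dM : M1 -> M2 := qmap (@mdiff int).

Lemma zclosedP (G : zmodType) (X : set G) (H : subgroup X) x :
  (x \in zclosed H) <-> X x.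
Proof. by split=> /asboolP. Qed.

Lemma locfin_id (f : basis -> int) : locfin idfun f.
Proof.
by move=> b; apply: (sub_finite_set _ (finite_set1 b)) => b' /= [].
Qed.

Lemma dM_cls f : dM (M1cls f) = M2cls (mdiff f).
Proof.
apply: qmapE => [x /zclosedP lx|x _ /zclosedP rx|x y _ _|].
- exact/zclosedP/locfin_id.
- exact/zclosedP/(mdiff_rels blabel_id).
- exact: mdiffB.
- exact/zclosedP/locfin_id.
Qed.

(** * Modular cohomology with coefficients *)

Section ModularCoefficients.
Variables (Gam : groupClosed GL2Z) (V : rmod GL2Z).

Definition orb (b : basis) : set basis :=
  [set b' | exists2 g, g \in Gam & b' = bact g b].

Lemma orb_refl b : orb b b.
Proof. by exists 1%g; rewrite ?gpred1 ?bact1. Qed.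

Lemma orb_eqP b b' : orb b = orb b' <-> orb b b'.
Proof.
split=> [->|[g Gg ->]]; first exact: orb_refl.
apply/seteqP; split=> _ /= [h Gh ->].
  by exists (h * g^-1)%g; rewrite ?bactM ?bactK// gpredM ?gpredV.
by exists (h * g)%g; rewrite ?bactM// gpredM.
Qed.

Lemma blabel_orb : blabel orb.
Proof.
move=> h k [_ _ hg _] b b' /orb_eqP [g Gg ->].
by apply/orb_eqP; exists g; rewrite ?hg.
Qed.

Definition ractf (c : subG Gam * basis -> V) : subG Gam * basis -> V :=
  fun t => ract (c t) (val t.1).

(* sums of terms  v g (x) [x] - v (x) g [x],  g in Gam *)
Definition coinv_rels : set (basis -> V) :=
  [set r | exists2 c : subG Gam * basis -> V, locfin (fun t => orb t.2) c &
     r = push snd (ractf c) - push (fun t => bact (val t.1) t.2) c].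

Lemma ract0 g : ract (0 : V) g = 0.
Proof. by rewrite -[X in ract X](subrr 0) ractB subrr. Qed.

Lemma ractf_locfin c : locfin (fun t : subG Gam * basis => orb t.2) c ->
  locfin (fun t => orb t.2) (ractf c).
Proof.
move=> lc i; apply: sub_finite_set (lc i) => t /= [ti rt]; split=> // ct0.
by apply: rt; rewrite /ractf ct0 ract0.
Qed.

Lemma snd_pushable (c : subG Gam * basis -> V) :
  locfin (fun t => orb t.2) c -> pushable snd c.
Proof. by apply: locfin_pushable => t t' ->. Qed.

Lemma bact_pushable (c : subG Gam * basis -> V) :
  locfin (fun t => orb t.2) c ->
  pushable (fun t : subG Gam * basis => bact (val t.1) t.2) c.
Proof.
apply: locfin_pushable => -[g b] [g' b'] /= gb.
transitivity (orb (bact (val g) b)).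
  by apply/orb_eqP; exists (val g) => //; exact: subG_valP.
by rewrite gb; apply/esym/orb_eqP; exists (val g') => //; exact: subG_valP.
Qed.

Lemma coinv_rels_subgroup : subgroup coinv_rels.
Proof.
have l0 := (@locfin_subgroup (subG Gam * basis) _ V (fun t => orb t.2)).1.
have lB := (@locfin_subgroup (subG Gam * basis) _ V (fun t => orb t.2)).2.
have rB c c' : ractf (c - c') = ractf c - ractf c'.
  by apply/funext => t; rewrite !fctE /ractf ractB.
have E c c' : locfin (fun t => orb t.2) c -> locfin (fun t => orb t.2) c' ->
    push snd (ractf (c - c'))
      - push (fun t : subG Gam * basis => bact (val t.1) t.2) (c - c')
    = (push snd (ractf c) - push (fun t => bact (val t.1) t.2) c)
      - (push snd (ractf c') - push (fun t => bact (val t.1) t.2) c').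
  move=> lc lc'.
  rewrite rB (pushB (snd_pushable (ractf_locfin lc)) (snd_pushable (ractf_locfin lc'))).
  by rewrite (pushB (bact_pushable lc) (bact_pushable lc')) subrBB.
split; first by exists (0 - 0); [exact: (lB _ _ l0 l0) | by rewrite (E _ _ l0 l0) subrr].
move=> _ _ [c lc ->] [c' lc' ->]; exists (c - c'); first exact: lB.
by rewrite (E _ _ lc lc').
Qed.

(* V (x)_Gam M^1 and V (x)_Gam M^2, where a formal sum may be infinite but has
   finitely many terms on each Gam-orbit of bases *)
Definition VM1 : zmodType :=
  subquot (zclosed (@locfin_subgroup basis _ V orb))
          (zclosed (setadd_subgroup (@double_shuffles_subgroup _ orb V)
                                    coinv_rels_subgroup)).

Definition VM2 : zmodType :=
  subquot (zclosed (@locfin_subgroup basis _ V orb))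
          (zclosed (setadd_subgroup (@wedge_rels_subgroup _ orb V)
                                    coinv_rels_subgroup)).

Definition dVM : VM1 -> VM2 := qmap (@mdiff V).

Lemma coinv_comp h k r : beq h k -> coinv_rels r -> coinv_rels (r \o k).
Proof.
move=> hk [c lc ->]; have [hkK khK hg kg] := hk.
pose K (t : subG Gam * basis) := (t.1, k t.2).
pose K' (t : subG Gam * basis) := (t.1, h t.2).
have KK' : cancel K K' by move=> [g b]; rewrite /K' /K /= khK.
have K'K : cancel K' K by move=> [g b]; rewrite /K' /K /= hkK.
have ik : injective k := can_inj khK.
exists (c \o K).
  move=> i; case: (pselect (exists b, orb b = i)) => [[b0 <-]|nb]; last first.
    by apply: (sub_finite_set _ (finite_set0 _)) => t /= [ti _]; case: nb; exists t.2.
  apply: (sub_finite_set _ (finite_image K' (lc (orb (k b0))))) => t /= [ti ct].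
  exists (K t); last exact: KK'.
  by split=> //=; exact: blabel_orb (beq_sym hk) _ _ ti.
rewrite -(push_reindex (k := k) c KK' K'K ik); last first.
  by move=> [g b] /=; rewrite kg.
by rewrite -[X in _ = X - _](push_reindex (k := k) (ractf c) KK' K'K ik).
Qed.

Lemma coinv_mdiff r : coinv_rels r -> coinv_rels (mdiff r).
Proof.
move=> cr; have [c0 cB] := coinv_rels_subgroup.
have cN x : coinv_rels x -> coinv_rels (- x).
  by move=> cx; rewrite -sub0r; exact: cB.
rewrite /mdiff (push_beq _ beq_rot) (push_beq _ beq_rot2).
apply: (cB _ _ _ (coinv_comp beq_rot2 cr)).
exact: (cB _ _ (cN _ cr) (coinv_comp beq_rot cr)).
Qed.

Lemma mdiffD (f f' : basis -> V) : mdiff (f + f') = mdiff f + mdiff f'.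
Proof.
have m0 : mdiff (0 : basis -> V) = 0.
  by rewrite -[X in mdiff X](subrr 0) mdiffB subrr.
by rewrite -{1}[f']opprK mdiffB -[- f']sub0r mdiffB m0 sub0r opprK.
Qed.

Lemma dVM_cls f : locfin orb f -> dVM (cls _ _ f) = cls _ _ (mdiff f).
Proof.
move=> lf; apply: qmapE => [x /zclosedP lx|x _ /zclosedP rx|x y _ _|].
- exact/zclosedP/(locfin_mdiff blabel_orb).
- case: rx => a ra [b rb <-]; rewrite mdiffD; apply/zclosedP.
  exists (mdiff a); first exact: mdiff_rels blabel_orb _ ra.
  by exists (mdiff b) => //; exact: coinv_mdiff.
- exact: mdiffB.
- exact/zclosedP.
Qed.

Lemma dVM_additive : zmod_morphism dVM.
Proof.
apply: qmap_additive => [x /zclosedP lx|x _ /zclosedP rx|x y _ _].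
- exact/zclosedP/(locfin_mdiff blabel_orb).
- case: rx => a ra [b rb <-]; rewrite mdiffD; apply/zclosedP.
  exists (mdiff a); first exact: mdiff_rels blabel_orb _ ra.
  by exists (mdiff b) => //; exact: coinv_mdiff.
- exact: mdiffB.
Qed.

HB.instance Definition _ :=
  GRing.isZmodMorphism.Build VM1 VM2 dVM dVM_additive.

(* the complex V (x)_Gam M^*, in degrees 1 and 2 *)
Definition VMob (i : nat) : zmodType :=
  match i with 1 => VM1 | 2 => VM2 | _ => 'rV[int]_0 end.

Definition VMdiff (i : nat) : {additive VMob i -> VMob i.+1} :=
  match i with 1 => dVM | _ => \0 end.

Lemma VMdiffK i (x : VMob i) : VMdiff i.+1 (VMdiff i x) = 0.
Proof. by case: i x => [|[|i]] x //=; rewrite raddf0. Qed.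

Definition VMcomplex : complex := Complex VMdiffK.

Definition HM (i : nat) : zmodType := cohom VMcomplex i.

End ModularCoefficients.

(* the map induced on V (x)_Gam M^* by a homomorphism V -> W *)
Definition VM_map (Gam : groupClosed GL2Z) (V W : rmod GL2Z) (f : V -> W) i :
    VMcomplex Gam V i -> VMcomplex Gam W i :=
  match i with
  | 1 => qmap (fun c : basis -> V => f \o c)
  | 2 => qmap (fun c : basis -> V => f \o c)
  | _ => idfun
  end.

Definition HM_map (Gam : groupClosed GL2Z) (V W : rmod GL2Z) (f : V -> W) i :
    HM Gam V i -> HM Gam W i :=
  cohom_map (C := VMcomplex Gam V) (C' := VMcomplex Gam W)
    (@VM_map Gam V W f) (n := i).

Arguments HM_map Gam {V W} f i _.

Section ModularAction.
Variable g : GL2Z.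

(* the action of g on M^1 and M^2 *)
Definition M1act : M1 -> M1 := qmap (push (bact g)).
Definition M2act : M2 -> M2 := qmap (push (bact g)).

Lemma push_bact (A : zmodType) (f : basis -> A) :
  push (bact g) f = f \o bact g^-1%g.
Proof. by apply: push_can => b; rewrite -bactM ?mulVg ?mulgV bact1. Qed.

Lemma push_bactC (A : zmodType) h k (f : basis -> A) : beq h k ->
  push h f \o bact g^-1%g = push h (f \o bact g^-1%g).
Proof.
move=> hk; rewrite !(push_beq _ hk); have [_ _ _ kg] := hk.
by apply/funext => b /=; rewrite kg.
Qed.

Lemma M1act_cls f : M1act (M1cls f) = M1cls (push (bact g) f).
Proof.
apply: qmapE => [x _|x _ /zclosedP rx|x y _ _|]; try exact/zclosedP/locfin_id.
  case: rx => a [b [_ _ ->]]; apply/zclosedP.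
  exists (a \o bact g^-1%g), (b \o bact g^-1%g).
  split; try exact: locfin_id.
  by rewrite -(push_bactC _ beq_swap) -(push_bactC _ beq_shl)
    -(push_bactC _ beq_shr) push_bact.
by rewrite !push_bact.
Qed.

Lemma M2act_cls f : M2act (M2cls f) = M2cls (push (bact g) f).
Proof.
apply: qmapE => [x _|x _ /zclosedP rx|x y _ _|]; try exact/zclosedP/locfin_id.
  case: rx => a [b [c [_ _ _ ->]]]; apply/zclosedP.
  exists (a \o bact g^-1%g), (b \o bact g^-1%g), (c \o bact g^-1%g).
  split; try exact: locfin_id.
  by rewrite -(push_bactC _ beq_swap) -(push_bactC _ beq_neg1)
    -(push_bactC _ beq_neg2) push_bact.
by rewrite !push_bact.
Qed.

End ModularAction.

(** * The Voronoi complex *)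

Section Voronoi.
Variable R : realType.
(* V_2 is R^2 and V_2^* is R^2 in the dual coordinates.  The columns of E form a
   Z-basis of the lattice L_2 in V_2^*, which identifies L_2 with Z^2. *)
Variable E : 'M[R]_2.

Definition lvec (l : lat2) : 'cV[R]_2 := E *m map_mx intr l.

(* the Gram matrix of x |-> (f, x)^2 *)
Definition phi (f : 'cV[R]_2) : 'M[R]_2 := f *m f^T.

Definition primitive (l : lat2) : Prop :=
  l != 0 /\ forall (k : int) (m : lat2), l = k *: m -> k \is a GRing.unit.

Definition convex_hull (X : set 'M[R]_2) : set 'M[R]_2 :=
  [set q | exists n, exists t : 'I_n -> R, exists x : 'I_n -> 'M[R]_2,
     [/\ forall i, 0 <= t i, \sum_i t i = 1, forall i, X (x i) &
         q = \sum_i t i *: x i]].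

Definition voronoi_hull : set 'M[R]_2 :=
  convex_hull [set phi (lvec l) | l in primitive].

(* intersections with supporting hyperplanes *)
Definition face (K F : set 'M[R]_2) : Prop :=
  exists u : {linear 'M[R]_2 -> R^o}, exists c : R,
    (forall q, K q -> c <= u q) /\ F = [set q | K q /\ u q = c].

Definition vertex (F : set 'M[R]_2) (q : 'M[R]_2) : Prop :=
  F q /\ forall x y (t : R), F x -> F y -> 0 < t < 1 ->
    q = t *: x + (1 - t) *: y -> x = q /\ y = q.

(* a subset of (P closure)/R_+^*, given as a union of open rays *)
Definition cone (F : set 'M[R]_2) : set 'M[R]_2 :=
  [set q | exists2 t : R, 0 < t & exists2 x, F x & q = t *: x].

Definition cell (C : set 'M[R]_2) : Prop :=
  exists F : set 'M[R]_2, exists n, exists l : 'I_n -> lat2,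
    [/\ face voronoi_hull F, forall i, primitive (l i),
        vertex F = [set phi (lvec (l i)) | i in [set: 'I_n]],
        \rank (\matrix_(i < n, j < 2) ((l i) j ord0)%:~R : 'M[rat]_(n, 2)) = 2%N
      & C = cone F].

Definition frame n (C : set 'M[R]_2) (b : n.-tuple 'M[R]_2) : Prop :=
  [/\ forall i, C (tnth b i), free b & forall q, C q -> q \in <<b>>%VS].

(* a k-dimensional cell is one with a frame of size k.+1; an orientation is a
   frame up to base changes of positive determinant *)
Definition orient n (b b' : n.-tuple 'M[R]_2) : int :=
  sgz (\det (\matrix_(i < n, j < n) coord b j (tnth b' i))).

(* infinite chains on the oriented k-dimensional cells *)
Definition vchain k : set (set 'M[R]_2 -> k.+1.-tuple 'M[R]_2 -> int) :=
  [set c | (forall C b, ~ (cell C /\ frame C b) -> c C b = 0) /\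
           (forall C b b', cell C -> frame C b -> frame C b' ->
              c C b' = orient b b' * c C b)].
Arguments vchain k : clear implicits.

Lemma vchain_subgroup k : subgroup (vchain k).
Proof.
split; first by split=> // *; rewrite /= mulr0.
move=> c c' [c0 cE] [c0' cE']; split=> [C b nb|C b b' ? ? ?].
  by rewrite !fctE c0 ?c0' ?subrr.
by rewrite !fctE (cE _ b) // (cE' _ b) // mulrBr.
Qed.

Definition Vor k : zmodType := subz (zclosed (vchain_subgroup k)).

Definition simplex k (l : 'I_k.+1 -> lat2) : set 'M[R]_2 :=
  cone (convex_hull [set phi (lvec (l i)) | i in [set: 'I_k.+1]]).

(* the cell phi(l_0,...,l_k), oriented by the order of its vertices *)
Definition simplex_chain k (l : 'I_k.+1 -> lat2)
    (C : set 'M[R]_2) (b : k.+1.-tuple 'M[R]_2) : int :=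
  if `[< [/\ cell C, frame C b & C = simplex l] >]
  then orient [tuple phi (lvec (l i)) | i < k.+1] b else 0.

(* s is the sum of the infinite family of the F x, which is finite on every
   oriented cell *)
Definition infinite_sum (X : choiceType) k
    (F : X -> set 'M[R]_2 -> k.+1.-tuple 'M[R]_2 -> int)
    (s : set 'M[R]_2 -> k.+1.-tuple 'M[R]_2 -> int) : Prop :=
  forall C b, finite_set [set x | F x C b <> 0] /\
              s C b = \sum_(x \in [set: X]) F x C b.

(* minus the usual boundary: the edge C inherits the orientation b from the
   orientation (q, b) of C', q being any point of C' off the span of C *)
Definition vboundary (c : set 'M[R]_2 -> 3.-tuple 'M[R]_2 -> int)
    (C : set 'M[R]_2) (b : 2.-tuple 'M[R]_2) : int :=
  if `[< cell C /\ frame C b >] then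
    - \sum_(C' \in [set C' | cell C' /\ C `<=` C'])
        c C' [tuple of xget 0 [set q | C' q /\ q \notin <<b>>%VS] :: b]
  else 0.

(* the action of g on quadratic forms: phi (lvec l) |-> phi (lvec (g *m l)) *)
Definition gform (g : GL2Z) (q : 'M[R]_2) : 'M[R]_2 :=
  let h := E *m map_mx intr (val g) *m invmx E in h *m q *m h^T.

Definition vact (g : GL2Z) k (c : set 'M[R]_2 -> k.+1.-tuple 'M[R]_2 -> int) :
    set 'M[R]_2 -> k.+1.-tuple 'M[R]_2 -> int :=
  fun C b => c (gform g^-1%g @` C) [tuple of map (gform g^-1%g) b].

End Voronoi.

(* Main.v *)
(* (b) The Farey tessellation, on which GL_2(Z) acts, has for dual graph a tree T.
   Modular chains with coefficients in V are, up to torsion, the equivariant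
   functions on the vertices (triangles) and oriented edges of T, through the sum
   over the group followed by the sum over the finite stabilisers; the sign of a
   basis produces the twist by the determinant.  Since T is a tree, a function on
   the edges is the coboundary of a function on the vertices, unique up to a
   constant; the differences of its values on an orbit form a 1-cocycle.  This
   gives the comparison with H^0 and H^1, with kernel and cokernel killed by 96,
   and the same contraction kills 96 H^n for n >= 2.

   (a) On a supporting hyperplane of the hull, take a basis (v_1, v_2) with v_1 a
   minimal vector, reduced with respect to it.  The minimal vectors are then those
   of a^2 + b^2 - a b or of a^2 + b^2, up to a factor, so that the cells are the
   triangles phi(v_1, v_2, v_3) and the edges phi(v_1, v_2).  A symbol is
   determined by its cell up to the stabiliser of the cell, of order 12 or 8,
   and the relations account exactly for these stabilisers. *)
Require Import Defs.
From HB Require Import structures.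
From mathcomp Require Import fingroup perm all_boot all_order all_algebra.
From mathcomp Require Import zify ring lra.
From mathcomp Require Import boolp classical_sets functions cardinality fsbigop.
From mathcomp Require Import reals.

Set Implicit Arguments.
Unset Strict Implicit.
Unset Printing Implicit Defensive.

Import Order.TTheory GRing.Theory Num.Theory.

Local Open Scope classical_set_scope.
Local Open Scope ring_scope.

(** GL_2(Z) acts freely on bases, so the sum over [Gam] identifies coinvariants with equivariant
    functions without any torsion, whatever the index or the torsion of [Gam]. All the torsion comes
    from the two finite sums: a triangle has twelve bases and an edge eight, which is the origin of
    96 = 12 * 8. Every comparison is kept integral up to these factors, and the rationals enter
    once, through a map with kernel and cokernel of bounded exponent. A primitive on the tree is
    unique only up to a constant, so it cannot in general be chosen equivariant. In degree 1 this
    failure is the cocycle itself. In degrees at least 2 the averaged cone over a cocycle [f] is a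
    function on triangles with coboundary 12 [f]; its increments across edges form a cocycle,
    contracted a second time at the cost of 8, and a primitive of the result corrects the first cone
    into a function constant on the tree, that is, a cochain with coboundary 96 [f]. In (a) no
    division by 12 or 8 is possible. Injectivity comes from moving all the coefficients of a cell to
    one chosen basis, where the vanishing of their signed sum cancels them. *)

Notation rot := Defs.rot (only parsing).

(* Linear identities in an abelian group, which [ring] does not treat. *)
Inductive zexp :=
  | ZVar of nat | ZZero | ZAdd of zexp & zexp | ZOpp of zexp | ZMulz of zexp & int.

Fixpoint zeval (V : zmodType) (env : seq V) (e : zexp) : V :=
  match e with
  | ZVar i => nth 0 env i
  | ZZero => 0
  | ZAdd a b => zeval env a + zeval env b
  | ZOpp a => - zeval env a
  | ZMulz a z => zeval env a *~ z
  end.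

Fixpoint zcoef (e : zexp) (i : nat) : int :=
  match e with
  | ZVar j => if i == j then 1 else 0
  | ZZero => 0
  | ZAdd a b => zcoef a i + zcoef b i
  | ZOpp a => - zcoef a i
  | ZMulz a z => zcoef a i * z
  end.

Lemma zevalE (V : zmodType) (env : seq V) e :
  zeval env e = \sum_(i < size env) env`_i *~ zcoef e i.
Proof.
elim: e => [j||a IHa b IHb|a IHa|a IHa z] /=.
- case: (ltnP j (size env)) => [js|sj]; last first.
    rewrite nth_default// big1// => i _; rewrite ifN ?mulr0z//.
    by rewrite ltn_eqF// (leq_trans (ltn_ord i)).
  rewrite (bigD1 (Ordinal js))//= eqxx mulr1z big1 ?addr0// => i.
  by rewrite -val_eqE /= => /negbTE ->; rewrite mulr0z.
- by rewrite big1// => i _; rewrite mulr0z.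
- by rewrite IHa IHb -big_split; apply: eq_bigr => i _; rewrite mulrzDr.
- by rewrite IHa -sumrN; apply: eq_bigr => i _; rewrite mulrNz.
- by rewrite IHa mulrz_suml; apply: eq_bigr => i _; rewrite mulrzA.
Qed.

Lemma zeval_eq (V : zmodType) (env : seq V) e1 e2 :
  all (fun i => zcoef e1 i == zcoef e2 i) (iota 0 (size env)) ->
  zeval env e1 = zeval env e2.
Proof.
move=> /allP H; rewrite !zevalE; apply: eq_bigr => i _; congr (_ *~ _).
by apply/eqP; apply: H; rewrite mem_iota /= add0n ltn_ord.
Qed.

Ltac zmod_mem x l :=
  lazymatch l with
  | nil => constr:(false)
  | x :: _ => constr:(true)
  | _ :: ?l' => zmod_mem x l'
  end.

Ltac zmod_atoms t l :=
  lazymatch t with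
  | 0%R => l
  | (?a + ?b)%R => let l' := zmod_atoms a l in zmod_atoms b l'
  | (- ?a)%R => zmod_atoms a l
  | (?a *+ _)%R => zmod_atoms a l
  | _ => lazymatch zmod_mem t l with true => l | false => constr:(t :: l) end
  end.

Ltac zmod_index t l :=
  lazymatch l with
  | t :: _ => constr:(0%N)
  | _ :: ?l' => let n := zmod_index t l' in constr:(n.+1)
  end.

Ltac zmod_reify t l :=
  lazymatch t with
  | 0%R => constr:(ZZero)
  | (?a + ?b)%R =>
      let a' := zmod_reify a l in let b' := zmod_reify b l in constr:(ZAdd a' b')
  | (- ?a)%R => let a' := zmod_reify a l in constr:(ZOpp a')
  | (?a *+ ?n)%R => let a' := zmod_reify a l in constr:(ZMulz a' (Posz n))
  | _ => let n := zmod_index t l in constr:(ZVar n)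
  end.

(** Both sides are reified over a common list of atoms; the coefficients are compared in the virtual
    machine ([<:]), and the goal is convertible to the equality of the two [zeval]. *)
Ltac zmod :=
  lazymatch goal with
  | |- @eq ?T ?a ?b =>
      let l0 := constr:(@nil T) in
      let l1 := zmod_atoms a l0 in
      let l := zmod_atoms b l1 in
      let e1 := zmod_reify a l in
      let e2 := zmod_reify b l in
      exact (@zeval_eq _ l e1 e2 (isT <: all (fun i => zcoef e1 i == zcoef e2 i) (iota 0 (size l))))
  end.

(** * Symmetries of a basis *)

Definition cor (v : lat2) : int * int := (v ord0 ord0, v ord_max ord0).

Lemma lat2P (v w : lat2) : cor v = cor w -> v = w.
Proof.
move=> [v0 v1]; apply/matrixP => i j; rewrite (ord1 j).
by case: i => [[|[|//]] i]; [move: v0|move: v1];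
  congr (v _ _ = w _ _); exact: val_inj.
Qed.

Lemma basisP (y y' : basis) : cor (val y).1 = cor (val y').1 ->
  cor (val y).2 = cor (val y').2 -> y = y'.
Proof.
move=> /lat2P e1 /lat2P e2; apply: val_inj.
by case: (val y) (val y') e1 e2 => [? ?] [? ?] /= -> ->.
Qed.

Definition bdet (y : basis) : int :=
  (cor (val y).1).1 * (cor (val y).2).2 - (cor (val y).2).1 * (cor (val y).1).2.

Lemma unitz (d : int) : d \is a GRing.unit -> d = 1 \/ d = -1.
Proof. by move=> /orP [] /eqP ->; [left|right]. Qed.

Lemma bdet_unit y : bdet y = 1 \/ bdet y = -1.
Proof. by apply: unitz; have := basP y; rewrite isbasisE. Qed.

Lemma bdet2 y : bdet y * bdet y = 1.
Proof. by case: (bdet_unit y) => ->. Qed.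

Definition neg : basis -> basis := neg1 \o neg2.

Lemma bdet_swap y : bdet (swap y) = - bdet y.
Proof. by rewrite /bdet /cor /=; ring. Qed.

Lemma bdet_neg1 y : bdet (neg1 y) = - bdet y.
Proof. by rewrite /bdet /cor /= !mxE; ring. Qed.

Lemma bdet_neg y : bdet (neg y) = bdet y.
Proof. by rewrite /bdet /cor /= !mxE; ring. Qed.

Lemma bdet_rot y : bdet (rot y) = bdet y.
Proof. by rewrite /bdet /cor /= !mxE; ring. Qed.

Lemma bdet_rot2 y : bdet (rot2 y) = bdet y.
Proof. by rewrite /bdet /cor /= !mxE; ring. Qed.

Lemma bdet_bact g y : bdet (bact g y) = \det (val g) * bdet y.
Proof.
have cE (v : lat2) i : (val g *m v) i ord0 =
    val g i ord0 * v ord0 ord0 + val g i ord_max * v ord_max ord0.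
  rewrite mxE !big_ord_recl big_ord0 addr0.
  by congr (_ + val g i _ * v _ _); exact: val_inj.
by rewrite det22 /bdet /cor /= !cE; ring.
Qed.

Lemma swapK y : swap (swap y) = y. Proof. basis_eq. Qed.
Lemma negK y : neg (neg y) = y. Proof. rewrite /neg; basis_eq. Qed.
Lemma neg1K y : neg1 (neg1 y) = y. Proof. basis_eq. Qed.
Lemma bas_rot_rot y : rot (rot y) = rot2 y. Proof. basis_eq. Qed.
Lemma bas_rotK y : rot2 (rot y) = y. Proof. basis_eq. Qed.
Lemma bas_rot2K y : rot (rot2 y) = y. Proof. basis_eq. Qed.
Lemma rot2_rot2 y : rot2 (rot2 y) = rot y. Proof. basis_eq. Qed.
Lemma rot_swap y : rot (swap y) = swap (rot2 y). Proof. basis_eq. Qed.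
Lemma rot2_swap y : rot2 (swap y) = swap (rot y). Proof. basis_eq. Qed.
Lemma rot_neg y : rot (neg y) = neg (rot y). Proof. rewrite /neg; basis_eq. Qed.
Lemma rot2_neg y : rot2 (neg y) = neg (rot2 y). Proof. rewrite /neg; basis_eq. Qed.
Lemma neg_swap y : neg (swap y) = swap (neg y). Proof. rewrite /neg; basis_eq. Qed.
Lemma neg2K y : neg2 (neg2 y) = y. Proof. basis_eq. Qed.
Lemma neg_neg1 y : neg (neg1 y) = neg2 y. Proof. rewrite /neg; basis_eq. Qed.
Lemma neg_neg2 y : neg (neg2 y) = neg1 y. Proof. rewrite /neg; basis_eq. Qed.
Lemma neg1_neg y : neg1 (neg y) = neg2 y. Proof. rewrite /neg; basis_eq. Qed.
Lemma neg2_neg y : neg2 (neg y) = neg1 y. Proof. rewrite /neg; basis_eq. Qed.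
Lemma neg1_neg2 y : neg1 (neg2 y) = neg y. Proof. by []. Qed.
Lemma neg2_neg1 y : neg2 (neg1 y) = neg y. Proof. rewrite /neg; basis_eq. Qed.
Lemma neg1_swap y : neg1 (swap y) = swap (neg2 y). Proof. basis_eq. Qed.
Lemma neg2_swap y : neg2 (swap y) = swap (neg1 y). Proof. basis_eq. Qed.
Lemma shlVtE y : shlV (shl y) = y. Proof. by have [-> _ _ _] := beq_shl. Qed.
Lemma shl_swap_shlV y : shl (swap (shlV y)) = swap (neg (rot2 y)).
Proof. rewrite /shlV /neg /=; basis_eq. Qed.

Lemma val_swap y : val (swap y) = ((val y).2, (val y).1). Proof. by []. Qed.
Lemma val_rot y : val (rot y) = ((val y).2, - (val y).1 - (val y).2).
Proof. by []. Qed.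
Lemma val_rot2 y : val (rot2 y) = (- (val y).1 - (val y).2, (val y).1).
Proof. by []. Qed.
Lemma val_neg y : val (neg y) = (- (val y).1, - (val y).2). Proof. by []. Qed.
Lemma val_neg1 y : val (neg1 y) = (- (val y).1, (val y).2). Proof. by []. Qed.

Lemma beq_negneg : beq neg neg.
Proof. by split; [move=> b|move=> b|move=> g b|move=> g b]; basis_eq. Qed.

Opaque swap Defs.rot rot2 neg1 neg2 neg shl shr shlV.

(** Rules that normalise words in the symmetries: [swap] moves outermost and [neg] outside [rot], so
    that equal words in the group of a triangle, or in that of an edge, become identical. The
    symmetries are opaque so that their coordinates do not interfere. *)
Definition wE := (swapK, negK, neg1K, bas_rot_rot, bas_rotK, bas_rot2K, rot2_rot2, rot_swap,
  rot2_swap, rot_neg, rot2_neg, neg_swap, neg_neg1, neg_neg2,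
  neg1_neg, neg2_neg, neg1_neg2, neg2_neg1, neg1_swap, neg2_swap, neg2K).

Lemma bdet_neg2 y : bdet (neg2 y) = - bdet y.
Proof. by rewrite -neg1_neg bdet_neg1 bdet_neg. Qed.

(** * Signed averages over the bases of a triangle or of an edge *)

Section Averages.
Variable A : zmodType.
Implicit Types (u f : basis -> A) (y : basis).

(** Symbols are antisymmetric under [swap], which reverses the determinant; multiplying by it
    replaces signs by invariance. On edges the invariance under [neg1] becomes oddness. The twist of
    the coefficients originates here. *)
Definition sgn f y : A := f y *~ bdet y.

(** The four terms of [ssum] are the bases with both the triangle and the edge of [y]. Hence [vavg]
    sums over the twelve bases of a triangle, and [eavg] is the sum over the eight bases of an edge,
    with opposite signs on its two sides. *)
Definition rsum u y : A := u y + u (rot y) + u (rot2 y).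
Definition ssum u y : A := u y + u (swap y) + u (neg y) + u (swap (neg y)).
Definition vavg u : basis -> A := ssum (rsum u).
Definition eavg u y : A := ssum u y - ssum u (neg1 y).

(* Functions on the triangles, and odd functions on the edges with a side. *)
Definition vfun u : Prop :=
  [/\ forall y, u (swap y) = u y, forall y, u (rot y) = u y &
      forall y, u (neg y) = u y].
Definition efun u : Prop :=
  [/\ forall y, u (swap y) = u y, forall y, u (neg1 y) = - u y &
      forall y, u (neg y) = u y].

Lemma sgnK f : sgn (sgn f) = f.
Proof. by apply/funext => y; rewrite /sgn -mulrzA bdet2 mulr1z. Qed.

Lemma mdiff_sgn f y : sgn (mdiff f) y = - rsum (sgn f) y.
Proof.
rewrite /rsum /sgn mdiffE !fctE /= bdet_rot bdet_rot2 mulNrz !mulrzDl.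
by zmod.
Qed.

(** Together with [mdiff_sgn] this turns the differential of the modular complex into minus the
    coboundary from the triangles to the edges of the tree. *)
Lemma eavg_rsum u y : eavg (rsum u) y = vavg u y - vavg u (neg1 y).
Proof. by []. Qed.

Lemma vfun_rot2 u y : vfun u -> u (rot2 y) = u y.
Proof. by move=> [_ r _]; rewrite -bas_rot_rot !r. Qed.

Lemma vavg_vfun u : vfun (vavg u).
Proof. by split=> y; rewrite /vavg /ssum /rsum !wE; zmod. Qed.

Lemma eavg_efun u : efun (eavg u).
Proof. by split=> y; rewrite /eavg /ssum !wE; zmod. Qed.

Lemma vavg_id u y : vfun u -> vavg u y = u y *+ 12.
Proof.
move=> vu; have [s r n] := vu; rewrite /vavg /ssum /rsum !(vfun_rot2 _ vu, r, s, n).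
by zmod.
Qed.

Lemma eavg_id u y : efun u -> eavg u y = u y *+ 8.
Proof. move=> [s n1 n]; rewrite /eavg /ssum !wE !s -neg1_neg !(n1, n); zmod. Qed.

End Averages.

(** * The relations as symmetries of the coefficients *)

Section Relations.
Variables (I : Type) (p : basis -> I) (A : zmodType).
Hypothesis bp : blabel p.
Implicit Types r f : basis -> A.

Local Notation DS := (@double_shuffles I p A).
Local Notation WR := (@wedge_rels I p A).

Lemma DS0 : DS 0. Proof. exact: (double_shuffles_subgroup p A).1. Qed.
Lemma DSB f r : DS f -> DS r -> DS (f - r).
Proof. exact: (double_shuffles_subgroup p A).2. Qed.
Lemma DSN r : DS r -> DS (- r).
Proof. by move=> h; rewrite -sub0r; apply: DSB => //; exact: DS0. Qed.
Lemma DSD f r : DS f -> DS r -> DS (f + r).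
Proof. by move=> hf hr; rewrite -[r]opprK; exact: DSB hf (DSN hr). Qed.

Lemma DS_swap r : locfin p r -> DS (r + (r \o swap)).
Proof.
move=> lr; exists r, 0; split=> //; first exact: locfin0.
rewrite (push_beq _ beq_swap) (push_beq _ beq_shl) (push_beq _ beq_shr).
by apply/funext => x; rewrite !fctE /= !addr0.
Qed.

(** Reindexing by [shl] makes the second shuffle relation a sign rule for the involution
    [swap \o neg \o rot2]. *)
Lemma DS_shl r : locfin p r -> DS (r + (r \o (swap \o neg \o rot2))).
Proof.
move=> lr; exists 0, (r \o shl); split; first exact: locfin0.
  exact: locfin_comp bp (beq_sym beq_shl) lr.
rewrite (push_beq _ beq_swap) (push_beq _ beq_shl) (push_beq _ beq_shr).
have shlK y : shl (shlV y) = y by have [_ -> _ _] := beq_shl.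
apply/funext => x; rewrite !fctE /= /shrV /= addr0 add0r shlK.
by rewrite -shl_swap_shlV.
Qed.

Lemma locfin_swap r : locfin p r -> locfin p (r \o swap).
Proof. exact: locfin_comp bp beq_swap. Qed.
Lemma locfin_neg r : locfin p r -> locfin p (r \o neg).
Proof. exact: locfin_comp bp beq_negneg. Qed.
Lemma locfin_rot r : locfin p r -> locfin p (r \o rot).
Proof. exact: locfin_comp bp beq_rot2. Qed.
Lemma locfin_rot2 r : locfin p r -> locfin p (r \o rot2).
Proof. exact: locfin_comp bp beq_rot. Qed.
Lemma locfin_neg1 r : locfin p r -> locfin p (r \o neg1).
Proof. exact: locfin_comp bp beq_neg1. Qed.

(** The product of the two sign-reversing symmetries of the shuffle relations preserves the sign. It
    has order 6: its cube gives [DS_neg] and its square [DS_rot], both by telescoping. *)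
Lemma DS_negrot2 r : locfin p r -> DS (r - (r \o (neg \o rot2))).
Proof.
move=> lr; have := DSB (DS_swap lr) (DS_shl (locfin_swap lr)).
by congr DS; apply/funext => x; rewrite !fctE /= !wE; zmod.
Qed.

Lemma DS_neg r : locfin p r -> DS (r - (r \o neg)).
Proof.
move=> lr; have lr1 := locfin_rot2 (locfin_neg lr).
have lr2 := locfin_rot2 (locfin_neg lr1).
have := DSD (DS_negrot2 lr) (DSD (DS_negrot2 lr1) (DS_negrot2 lr2)).
by congr DS; apply/funext => x; rewrite !fctE /= !wE; zmod.
Qed.

Lemma DS_rot r : locfin p r -> DS (r - (r \o rot)).
Proof.
move=> lr; have lr1 := locfin_rot2 (locfin_neg lr).
have lr2 := locfin_rot2 (locfin_neg lr1).
have := DSD (DS_negrot2 lr) (DS_negrot2 lr1).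
by congr DS; apply/funext => x; rewrite !fctE /= !wE; zmod.
Qed.

Lemma sgn_DS r y : DS r -> vavg (sgn r) y = 0.
Proof.
move=> [a [b [_ _ ->]]].
rewrite (push_beq _ beq_swap) (push_beq _ beq_shl) (push_beq _ beq_shr).
have -> : b \o shrV = (b \o shlV) \o (swap \o neg \o rot2).
  by apply/funext => x /=; rewrite /shrV /= -shl_swap_shlV shlVtE.
move: (b \o shlV) => {}b.
rewrite /vavg /ssum /rsum /sgn !fctE /= !wE.
by rewrite !(bdet_swap, bdet_neg, bdet_rot, bdet_rot2) !mulrNz !mulrzDl; zmod.
Qed.

Lemma sgn_WR r y : WR r -> eavg (sgn r) y = 0.
Proof.
move=> [a [b [c [_ _ _ ->]]]].
rewrite (push_beq _ beq_swap) (push_beq _ beq_neg1) (push_beq _ beq_neg2).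
rewrite /eavg /ssum /sgn !fctE /= !wE.
rewrite !(bdet_swap, bdet_neg1, bdet_neg2, bdet_neg) ?mulrNz !(mulrzDl, mulNrz).
by zmod.
Qed.

End Relations.

(** * The Farey tree *)

(* The polar form of p^2 - p q + q^2, whose minimal vectors are those of the root
   triangle. *)
Definition hexb (v w : lat2) : int :=
  2 * (cor v).1 * (cor w).1 + 2 * (cor v).2 * (cor w).2
  - (cor v).1 * (cor w).2 - (cor v).2 * (cor w).1.

Definition wall (y : basis) : int := hexb (val y).1 (val y).2.

(** Half the sum of the values of the form at v1, v2 and -v1 - v2, hence a function of the triangle.
    Crossing the wall changes it by -2 [wall y]. *)
Definition height (y : basis) : int :=
  hexb (val y).1 (val y).1 + hexb (val y).2 (val y).2 + wall y.

Lemma hexb_ge0 v : 0 <= hexb v v.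
Proof.
rewrite /hexb; case: (cor v) => p q /=.
have -> : 2 * p * p + 2 * q * q - p * q - q * p = p ^+ 2 + q ^+ 2 + (p - q) ^+ 2.
  by ring.
by rewrite !addr_ge0// sqr_ge0.
Qed.

(** The Gram determinant of [hexb] is 3 in the standard basis, hence in every basis, since the
    square of [bdet] is 1. *)
Lemma hexb_det (y : basis) :
  hexb (val y).1 (val y).1 * hexb (val y).2 (val y).2 = wall y ^+ 2 + 3.
Proof.
have := bdet2 y; rewrite /wall /bdet /hexb.
case: (cor _) => p q; case: (cor _) => p' q' /= d.
transitivity ((2 * p * p' + 2 * q * q' - p * q' - q * p') ^+ 2
  + 3 * ((p * q' - p' * q) * (p * q' - p' * q))); last by rewrite d mulr1.
ring.
Qed.

Lemma wall_swap y : wall (swap y) = wall y.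
Proof. by rewrite /wall val_swap /hexb /=; ring. Qed.

Lemma wall_neg1 y : wall (neg1 y) = - wall y.
Proof. by rewrite /wall val_neg1 /hexb /cor /= !mxE; ring. Qed.

Lemma wall_neg y : wall (neg y) = wall y.
Proof. by rewrite /wall val_neg /hexb /cor /= !mxE; ring. Qed.

Lemma wall_rot y : wall (rot y) = - wall y - hexb (val y).2 (val y).2.
Proof. by rewrite /wall val_rot /hexb /cor /= !mxE; ring. Qed.

Lemma wall_rot2 y : wall (rot2 y) = - wall y - hexb (val y).1 (val y).1.
Proof. by rewrite /wall val_rot2 /hexb /cor /= !mxE; ring. Qed.

(** The form takes even values, so a vanishing wall would make 3 a product of two even integers.
    Every edge thus has a definite lower side. *)
Lemma wall_neq0 y : wall y != 0.
Proof.
apply/eqP => w0; have := hexb_det y; rewrite w0.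
have := hexb_ge0 (val y).1; have := hexb_ge0 (val y).2.
have odd v : exists k, hexb v v = 2 * k.
  by exists ((cor v).1 ^+ 2 + (cor v).2 ^+ 2 - (cor v).1 * (cor v).2);
    rewrite /hexb; ring.
have [k ->] := odd (val y).1; have [l ->] := odd (val y).2; lia.
Qed.

Lemma wall_pos y : 0 < wall y -> wall (rot y) < 0 /\ wall (rot2 y) < 0.
Proof.
rewrite wall_rot wall_rot2.
have := hexb_ge0 (val y).1; have := hexb_ge0 (val y).2; lia.
Qed.

Lemma height_ge0 y : 0 <= height y.
Proof.
have := hexb_ge0 (val y).1; have := hexb_ge0 (val y).2.
have := hexb_ge0 ((val y).1 + (val y).2).
have -> : hexb ((val y).1 + (val y).2) ((val y).1 + (val y).2) =
  height y + wall y by rewrite /height /wall /hexb /cor /= !mxE; ring.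
rewrite /height; lia.
Qed.

Lemma height_rot y : height (rot y) = height y.
Proof. by rewrite /height /wall val_rot /hexb /cor /= !mxE; ring. Qed.

Lemma height_neg1 y : height (neg1 y) = height y - 2 * wall y.
Proof. by rewrite /height /wall val_neg1 /hexb /cor /= !mxE; ring. Qed.

Lemma row_mx_cols (v w : lat2) i : let B : 'M[int]_2 := row_mx v w in
  B i ord0 = v i ord0 /\ B i ord_max = w i ord0.
Proof.
by split; [rewrite -(row_mxEl v w i ord0)|rewrite -(row_mxEr v w i ord0)];
  congr (row_mx _ _ _ _); exact: val_inj.
Qed.

Definition ybase : basis.
Proof.
exists (\col_i (i == ord0)%:Z, \col_i (i == ord_max)%:Z).
by rewrite isbasisE !mxE /=.
Defined.

(** The opposites [A], [s], [t] of the three walls (the Selling parameters of the form) are positive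
    integers, and the Gram determinant reads A s + A t + s t = 3. Hence all three are 1. *)
Lemma wall_root y : wall y < 0 -> wall (rot y) < 0 -> wall (rot2 y) < 0 ->
  [/\ hexb (val y).1 (val y).1 = 2, hexb (val y).2 (val y).2 = 2 & wall y = -1].
Proof.
rewrite wall_rot wall_rot2; have := hexb_det y.
move: (wall y) (hexb _ _) (hexb _ _) => a b c bc a0 b0 c0.
have [A aE] : exists A, a = - A by exists (- a); rewrite opprK.
have [s bE] : exists s, b = A + s by exists (b - A); rewrite addrC subrK.
have [t cE] : exists t, c = A + t by exists (c - A); rewrite addrC subrK.
subst a b c.
have A1 : 1 <= A by lia.
have s1 : 1 <= s by lia.
have t1 : 1 <= t by lia.
have e : A * (s + t) + s * t = 3 by move: bc; rewrite !expr2; lia.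
have st1 : 1 <= s * t by nia.
have Ast : A <= 1 by nia.
have s2 : s <= 1 by nia.
have t2 : t <= 1 by nia.
by split; lia.
Qed.

Definition hexagon : seq (int * int) :=
  [:: (1, 0); (0, 1); (1, 1); (-1, 0); (0, -1); (-1, -1)].
Definition square : seq (int * int) := [:: (1, 0); (0, 1); (-1, 0); (0, -1)].

Lemma hexb2 v : hexb v v = 2 -> cor v \in hexagon.
Proof.
rewrite /hexb /hexagon; case: (cor v) => p q /= e.
have p1 : -1 <= p <= 1 by nia.
have q1 : -1 <= q <= 1 by nia.
have : p \in [:: -1; 0; 1] by rewrite !inE; lia.
have : q \in [:: -1; 0; 1] by rewrite !inE; lia.
move/eqP: e; rewrite !inE.
by move=> H /or3P[] /eqP Eq /or3P[] /eqP Ep; move: H; rewrite Ep Eq; vm_compute.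
Qed.

(** The group of order 12 that permutes the bases of a triangle, split into rotation, transposition
    and sign. Only the component [j.1.2] reverses the orientation. *)
Definition tword (j : 'I_3 * bool * bool) (y : basis) : basis :=
  iter j.2 neg (iter j.1.2 swap (iter j.1.1 rot y)).

Lemma ord3_ex (i : 'I_3) : [\/ i = @Ordinal 3 0 isT, i = @Ordinal 3 1 isT |
  i = @Ordinal 3 2 isT].
Proof. by case: i => [[|[|[|//]]] i]; [apply: Or31|apply: Or32|apply: Or33]; exact: val_inj. Qed.

Definition corp (z : basis) := (cor (val z).1, cor (val z).2).

Lemma corp_inj : injective corp.
Proof. by move=> y z [e1 e2 e3 e4]; apply: basisP; rewrite /cor ?e1 ?e2 ?e3 ?e4. Qed.

Definition tindex : seq ('I_3 * bool * bool) :=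
  [seq (p, n) | p <- [seq (i, s) | i <- [:: @Ordinal 3 0 isT; @Ordinal 3 1 isT;
    @Ordinal 3 2 isT], s <- [:: false; true]], n <- [:: false; true]].

Lemma tindexP j : j \in tindex.
Proof. by case: j => [[i [|]] [|]]; case: (ord3_ex i) => ->. Qed.

Lemma tword_base : [seq corp (tword j ybase) | j <- tindex] =
  [:: ((1, 0), (0, 1)); ((-1, 0), (0, -1)); ((0, 1), (1, 0)); ((0, -1), (-1, 0));
      ((0, 1), (-1, -1)); ((0, -1), (1, 1)); ((-1, -1), (0, 1)); ((1, 1), (0, -1));
      ((-1, -1), (1, 0)); ((1, 1), (-1, 0)); ((1, 0), (-1, -1)); ((-1, 0), (1, 1))].
Proof.
rewrite /tindex /= /tword ![iter _ _ _]/= /corp !bas_rot_rot.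
by rewrite !(val_neg, val_swap, val_rot, val_rot2) /cor /= !mxE.
Qed.

(** By [wall_root] both vectors are among the six minimal ones and [wall y = -1]. The twelve pairs
    that remain are exactly the words applied to [ybase], so there is a single root triangle. *)
Lemma root_unique (T : Type) (u : basis -> T) y :
  (forall y, u (swap y) = u y) -> (forall y, u (rot y) = u y) ->
  (forall y, u (neg y) = u y) ->
  wall y < 0 -> wall (rot y) < 0 -> wall (rot2 y) < 0 -> u y = u ybase.
Proof.
move=> us ur un w0 w1 w2.
have [/hexb2 + /hexb2] := wall_root w0 w1 w2.
rewrite /wall => c1 c2 wE.
have ut j : u (tword j ybase) = u ybase.
  rewrite /tword; have -> z : u (iter j.2 neg z) = u z by case: j.2 => /=.
  have -> z : u (iter j.1.2 swap z) = u z by case: j.1.2 => /=.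
  by elim: (val j.1.1) => //= n <-.
have : corp y \in [seq corp (tword j ybase) | j <- tindex].
  rewrite tword_base; move/eqP: wE; rewrite /hexb /corp.
  move: c1 c2; move: (cor _) (cor _) => p q.
  rewrite /hexagon !inE => H1 H2; move: H1 H2.
  by do 2 case/or4P => [/eqP ->|/eqP ->|/eqP ->|/or3P[]/eqP ->];
    vm_compute.
by move=> /mapP [j _ /corp_inj ->].
Qed.

(* Crossing the wall of a triangle on which the form is positive descends;
   there is at most one such wall, and none exactly at the root triangle. *)
Section Tree.
Variable A : zmodType.
Implicit Types (u c : basis -> A) (y : basis).

Lemma wall_split y : [\/ 0 < wall y, 0 < wall (rot y), 0 < wall (rot2 y) |
  [/\ wall y < 0, wall (rot y) < 0 & wall (rot2 y) < 0]].
Proof.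
have := wall_neq0 y; have := wall_neq0 (rot y); have := wall_neq0 (rot2 y).
case: (ltgtP 0 (wall y)) => // [h0 _ _ _|h0]; first exact: Or41.
case: (ltgtP 0 (wall (rot y))) => // [h1 _ _ _|h1]; first exact: Or42.
case: (ltgtP 0 (wall (rot2 y))) => // [h2 _ _ _|h2 _ _ _]; first exact: Or43.
by apply: Or44.
Qed.

Lemma height_lt y (n : nat) : (`|height y| < n.+1)%N -> 0 < wall y ->
  (`|height (neg1 y)| < n)%N.
Proof.
rewrite height_neg1; have := height_ge0 (neg1 y); rewrite height_neg1.
have := height_ge0 y; lia.
Qed.

Lemma height_rot2 y : height (rot2 y) = height y.
Proof. by rewrite -bas_rot_rot !height_rot. Qed.

(** Connectedness of the tree: away from the root triangle some wall is positive, and the height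
    drops across it. *)
Lemma vfun_const u : vfun u -> (forall y, u (neg1 y) = u y) ->
  forall y, u y = u ybase.
Proof.
move=> vu u1 y; have [us ur un] := vu.
have [n] : exists n, (`|height y| < n)%N by exists `|height y|.+1.
elim: n y => // n IHn y hy.
case: (wall_split y) => [w|w|w|[w0 w1 w2]].
- by rewrite -u1; apply: IHn; exact: height_lt.
- by rewrite -ur -u1; apply: IHn; apply: height_lt => //; rewrite height_rot.
- rewrite -(vfun_rot2 _ vu) -u1; apply: IHn; apply: height_lt => //.
  by rewrite height_rot2.
- exact: root_unique.
Qed.

Section Primitive.
Variable c : basis -> A.

(** The sum of [c] along the path from the triangle of [y] down to the root. At most one of the
    three summands is nonzero, by [wall_pos]; writing all three makes the symmetry under [rot]
    immediate. [n] is fuel, and any value above the height gives the same result. *)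
Fixpoint prim (n : nat) (y : basis) : A :=
  if n is n'.+1 then
    let p z := if 0 < wall z then c z + prim n' (neg1 z) else 0 in
    p y + p (rot y) + p (rot2 y)
  else 0.

Hypothesis ec : efun c.

Lemma prim_vfun n : vfun (prim n).
Proof.
have [cs c1 cn] := ec; elim: n => [|n [IHs IHr IHn]]; first by split.
have IH2 y : prim n (neg2 y) = prim n (neg1 y) by rewrite -neg_neg1 IHn.
by split=> y /=; rewrite !wE ?(wall_swap, wall_neg) ?(cs, cn) ?IHs ?IH2; zmod.
Qed.

Lemma prim_stable n y : (`|height y| < n)%N -> prim n.+1 y = prim n y.
Proof.
elim: n y => // n IHn y hy.
have E z : (`|height z| < n.+1)%N ->
    (if 0 < wall z then c z + prim n.+1 (neg1 z) else 0) =
    (if 0 < wall z then c z + prim n (neg1 z) else 0).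
  by case: ifP => // wz hz; rewrite IHn// height_lt.
by rewrite {1}/prim -/prim E// E ?height_rot// E ?height_rot2.
Qed.

Lemma prim_stableD n m y : (`|height y| < n)%N -> prim (m + n) y = prim n y.
Proof.
by move=> hy; elim: m => // m IHm; rewrite addSn prim_stable ?IHm// ltn_addl.
Qed.

Lemma prim_up n y : 0 < wall y -> prim n.+1 y = c y + prim n (neg1 y).
Proof.
move=> w /=; have [w1 w2] := wall_pos w.
by rewrite w !ifN ?addr0// -leNgt ltW.
Qed.

(* The dual graph of the Farey tessellation is a tree: [c y] is the increment
   across the edge from the triangle of [neg1 y] to that of [y]. *)
Lemma primitive_exists : exists2 P : basis -> A, vfun P &
  forall y, P y - P (neg1 y) = c y.
Proof.
pose P y := prim `|height y|.+1 y.
have PE n y : (`|height y| < n)%N -> P y = prim n y.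
  by move=> hy; rewrite -[LHS](@prim_stableD _ (n - `|height y|.+1)) // subnK.
exists P.
  (* A common amount of fuel, so that the symmetries of [prim n] pass to [P]. *)
  have hs y : exists n, [/\ P (swap y) = prim n (swap y), P (neg y) = prim n (neg y),
      P (rot y) = prim n (rot y) & P y = prim n y].
    exists (`|height (swap y)| + `|height (neg y)| + `|height (rot y)| + `|height y|).+1%N.
    by split; apply: PE; lia.
  by split=> y; have [n [e1 e2 e3 e4]] := hs y; have [s r g] := prim_vfun n;
    rewrite ?e1 ?e2 ?e3 ?e4 ?s ?r ?g.
have up y : 0 < wall y -> P y - P (neg1 y) = c y.
  move=> w; rewrite {1}/P prim_up// [P (neg1 y)](PE `|height y|%N) ?addrK//.
  exact: height_lt.
move=> y; case: (ltgtP 0 (wall y)) (wall_neq0 y) => // [w|w] _; first exact: up.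
have [_ c1 _] := ec.
have := up (neg1 y); rewrite neg1K wall_neg1 oppr_gt0 => /(_ w).
by rewrite c1 => /(congr1 -%R); rewrite opprB opprK.
Qed.

End Primitive.
End Tree.

(** * Tensor products with the rationals *)

Lemma subgroupD (G : zmodType) (X : set G) x y :
  subgroup X -> X x -> X y -> X (x + y).
Proof.
by move=> [X0 XB] Xx Xy; rewrite -[y]opprK -[- y]sub0r; apply: (XB _ _ Xx); exact: XB.
Qed.

Lemma subgroupN (G : zmodType) (X : set G) x : subgroup X -> X x -> X (- x).
Proof. by move=> [X0 XB] Xx; rewrite -sub0r; exact: XB. Qed.

Lemma subgroup_sum (G : zmodType) (X : set G) (J : Type) (s : seq J) (P : pred J)
  (F : J -> G) : subgroup X -> (forall i, P i -> X (F i)) ->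
  X (\sum_(i <- s | P i) F i).
Proof.
move=> sX XF; elim/big_rec: _ => [|i x Pi Xx]; first exact: sX.1.
by apply: subgroupD => //; exact: XF.
Qed.

Lemma subgroupMz (G : zmodType) (X : set G) x (n : int) :
  subgroup X -> X x -> X (x *~ n).
Proof.
move=> sX Xx.
have Xn k : X (x *+ k) by elim: k => [|k IH]; [exact: sX.1|rewrite mulrS; exact: subgroupD].
by case: n => n; [exact: Xn|exact: subgroupN].
Qed.

Section ZmodMorphism.
Variables (G H : zmodType) (f : G -> H).
Hypothesis fB : {morph f : x y / x - y}.

Lemma zmorph0 : f 0 = 0.
Proof. by rewrite -{1}(subrr 0) fB subrr. Qed.

Lemma zmorphN x : f (- x) = - f x.
Proof. by rewrite -sub0r fB zmorph0 sub0r. Qed.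

Lemma zmorphD x y : f (x + y) = f x + f y.
Proof. by rewrite -{1}[y]opprK fB zmorphN opprK. Qed.

Lemma zmorphMn x n : f (x *+ n) = f x *+ n.
Proof. by elim: n => [|n IH]; rewrite ?zmorph0// !mulrS zmorphD IH. Qed.

Lemma zmorphMz x (n : int) : f (x *~ n) = f x *~ n.
Proof. by case: n => n; rewrite ?NegzE ?mulrNz ?zmorphN -!pmulrn zmorphMn. Qed.

Lemma zmorph_sum (J : Type) (s : seq J) (P : pred J) (F : J -> G) :
  f (\sum_(i <- s | P i) F i) = \sum_(i <- s | P i) f (F i).
Proof. exact: (big_morph f zmorphD zmorph0). Qed.

End ZmodMorphism.

Section FiniteSupport.
Variable S : choiceType.

Definition supported (A : zmodType) (f : S -> A) (s : seq S) : Prop :=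
  uniq s /\ forall x, f x <> 0 -> x \in s.

Lemma fin_supported (A : zmodType) (f : S -> A) :
  finite_set (f @^-1` [set~ 0]) -> exists s, supported f s.
Proof.
move=> /finite_seqP [s sE]; exists (undup s); split; first exact: undup_uniq.
by move=> x fx; rewrite mem_undup; have : [set` s] x by rewrite -sE.
Qed.

Lemma push_supported (T : choiceType) (A : zmodType) (h : S -> T) (f : S -> A) s y :
  uniq s -> (forall x, f x <> 0 -> h x = y -> x \in s) ->
  push h f y = \sum_(x <- s | h x == y) f x.
Proof.
move=> us fs; rewrite -big_filter fsbig_seq ?filter_uniq// /push.
apply/esym/fsbig_widen => x /=; first by rewrite mem_filter => /andP[/eqP].
move=> [hx nx]; apply: contrapT => fx; apply: nx => /=.
by rewrite mem_filter (fs _ fx hx) hx eqxx.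
Qed.

Lemma fsum_supported (A : zmodType) (f : S -> A) s :
  uniq s -> (forall x, f x <> 0 -> x \in s) ->
  \sum_(x \in [set: S]) f x = \sum_(x <- s) f x.
Proof.
move=> us fs; rewrite [RHS]fsbig_seq// -(@fsbig_widen _ _ _ _ [set` s] [set: S])// => x /= [_ xs].
by apply: contrapT => fx; apply: xs; exact: fs.
Qed.

Definition dirac (x : S) : S -> int := fun y => (y == x)%:Z.

Lemma fin_ind (X : set (S -> int)) : subgroup X -> (forall x, X (dirac x)) ->
  forall f, locfin (fun=> tt) f -> X f.
Proof.
move=> sX Xd f lf.
have [|s [us fs]] := @fin_supported _ f.
  by apply: sub_finite_set (lf tt) => x /= ?; split.
have -> : f = \sum_(x <- s) dirac x *~ f x.
  apply/funext => y; rewrite (big_morph (fun g : S -> int => g y) (id1 := 0)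
    (op1 := +%R))//.
  have E x : (dirac x *~ f x) y = if x == y then f x else 0.
    have -> : (dirac x *~ f x) y = dirac x y *~ f x.
      have nE (g : S -> int) n : (g *+ n) y = g y *+ n.
        by elim: n => // n IH; rewrite !mulrSr fctE IH.
      by case: (f x) => n /=; rewrite -?pmulrn ?NegzE ?mulrNz -?pmulrn ?fctE nE.
    by rewrite /dirac eq_sym; case: eqP => [->|]; rewrite ?mul0rz// intz.
  rewrite (eq_bigr _ (fun x _ => E x)).
  case: (boolP (y \in s)) => [ys|ys].
    by rewrite (bigD1_seq y)//= eqxx big1 ?addr0// => x /negbTE ->.
  rewrite big1_seq => [|x /andP[_ xs]].
    by apply: contrapT => fy; move: ys; rewrite fs.
  by case: eqP => // xy; move: ys; rewrite -xy xs.
by apply: subgroup_sum => // x _; exact: subgroupMz.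
Qed.

End FiniteSupport.

Lemma push_dirac (S T : choiceType) (h : S -> T) x : push h (dirac x) = dirac (h x).
Proof.
apply/funext => y; rewrite (@push_supported _ _ _ _ _ [:: x])//; last first.
  by move=> z; rewrite /dirac inE; case: eqP.
by rewrite big_cons big_nil /dirac eqxx eq_sym; case: eqP.
Qed.

Lemma dirac_fin (S : choiceType) (x : S) : locfin (fun=> tt) (dirac x).
Proof.
move=> i; apply: sub_finite_set (finite_set1 x) => y /= [_].
by rewrite /dirac; case: eqP.
Qed.

Lemma fin_pushable (S T : choiceType) (A : zmodType) (h : S -> T) (f : S -> A) :
  locfin (fun=> tt) f -> pushable h f.
Proof. exact: locfin_pushable. Qed.

Lemma push0 (S T : choiceType) (A : zmodType) (h : S -> T) : push h (0 : S -> A) = 0.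
Proof.
have l0 := (@locfin_subgroup S _ A (fun=> tt)).1.
by rewrite -[X in push h X](subrr 0) (pushB (fin_pushable _ l0) (fin_pushable _ l0)) subrr.
Qed.

Lemma push_fin (S T : choiceType) (h : S -> T) (f : S -> int) :
  locfin (fun=> tt) f -> locfin (fun=> tt) (push h f).
Proof.
move=> lf; pose X := [set f : S -> int | locfin (fun=> tt) f /\
  locfin (fun=> tt) (push h f)].
suff /(_ _ lf) [] : forall f, locfin (fun=> tt) f -> X f by [].
apply: fin_ind => [|x]; last by split; [|rewrite push_dirac]; exact: dirac_fin.
split=> [|f1 f2 [l1 p1] [l2 p2]]; last first.
  by split; [|rewrite (pushB (fin_pushable _ l1) (fin_pushable _ l2))];
    exact: (locfin_subgroup _ _).2.
have l0 := (@locfin_subgroup S _ int (fun=> tt)).1; split=> //.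
rewrite push0; exact: (locfin_subgroup _ _).1.
Qed.

Lemma push_comp (S T U : choiceType) (h : S -> T) (k : T -> U) (f : S -> int) :
  locfin (fun=> tt) f -> push k (push h f) = push (k \o h) f.
Proof.
move=> lf; pose X := [set f : S -> int | locfin (fun=> tt) f /\
  push k (push h f) = push (k \o h) f].
suff /(_ _ lf) [] : forall f, locfin (fun=> tt) f -> X f by [].
apply: fin_ind => [|x]; last by split; [exact: dirac_fin|rewrite !push_dirac].
have B (f1 f2 : S -> int) : locfin (fun=> tt) f1 -> locfin (fun=> tt) f2 ->
    push k (push h f1) = push (k \o h) f1 -> push k (push h f2) = push (k \o h) f2 ->
    push k (push h (f1 - f2)) = push (k \o h) (f1 - f2).
  move=> l1 l2 e1 e2; rewrite !(pushB (fin_pushable _ l1) (fin_pushable _ l2)).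
  by rewrite (pushB (fin_pushable _ (push_fin _ l1)) (fin_pushable _ (push_fin _ l2))) e1 e2.
have l0 := (@locfin_subgroup S _ int (fun=> tt)).1.
split=> [|f1 f2 [l1 p1] [l2 p2]]; last first.
  by split; [exact: (locfin_subgroup _ _).2 | exact: B].
split=> //.
by rewrite !push0.
Qed.

(** * Functoriality and generation of tensor products *)

Section TensMap.
Variables (A A' B B' : zmodType) (f : A -> A') (g : B -> B').
Hypothesis fB : {morph f : x y / x - y}.
Hypothesis gB : {morph g : x y / x - y}.

Definition tmap : tens A B -> tens A' B' :=
  qmap (push (fun x : A * B => (f x.1, g x.2))).

Let fD := zmorphD fB.
Let gD := zmorphD gB.

Let F := push (fun x : A * B => (f x.1, g x.2)) : (A * B -> int) -> _.

Lemma tmap_rels r : @tens_rels A B r -> @tens_rels A' B' (F r).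
Proof.
move=> [c [d [lc ld ->]]].
exists (push (fun t : A * A * B => (f t.1.1, f t.1.2, g t.2)) c).
exists (push (fun t : A * B * B => (f t.1.1, g t.1.2, g t.2)) d).
have pP := fin_pushable; have pF := push_fin.
split; [exact: pF | exact: pF |].
have lB (S : choiceType) (a b : S -> int) : locfin (fun=> tt) a ->
    locfin (fun=> tt) b -> locfin (fun=> tt) (a - b).
  exact: (locfin_subgroup _ _).2.
have pB (S T : choiceType) (h : S -> T) (a b : S -> int) : locfin (fun=> tt) a ->
    locfin (fun=> tt) b -> push h (a - b) = push h a - push h b.
  by move=> la lb; apply: pushB; exact: pP.
have FD a b : locfin (fun=> tt) a -> locfin (fun=> tt) b -> F (a + b) = F a + F b.
  have l0 := (@locfin_subgroup (A * B) _ int (fun=> tt)).1.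
  move=> la lb; rewrite -{1}[b]opprK /F pB//; last by rewrite -sub0r; exact: lB.
  by rewrite -[- b]sub0r pB// push0 sub0r opprK.
have l3 (S T : choiceType) (h1 h2 h3 : S -> T) a : locfin (fun=> tt) a ->
    locfin (fun=> tt) (push h1 a - push h2 a - push h3 a :> (T -> int)).
  by move=> la; apply: (lB); [apply: (lB)|]; exact: pF.
rewrite FD; [|exact: l3|exact: l3].
have p3 (S T U : choiceType) (k : T -> U) (h1 h2 h3 : S -> T) (a : S -> int) :
    locfin (fun=> tt) a -> push k (push h1 a - push h2 a - push h3 a) =
    push (k \o h1) a - push (k \o h2) a - push (k \o h3) a.
  move=> la; rewrite pB; [|by apply: (lB); exact: pF|exact: pF].
  by rewrite pB; [|exact: pF|exact: pF]; rewrite !push_comp.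
rewrite /F !p3// !push_comp//.
congr (push _ c - push _ c - push _ c + (push _ d - push _ d - push _ d));
  by apply/funext => t /=; rewrite ?fD ?gD.
Qed.

Lemma tmap_cls a : locfin (fun=> tt) a -> tmap (cls _ _ a) = cls _ _ (F a).
Proof.
move=> la; apply: qmapE => [x /zclosedP lx|x _ /zclosedP rx|x y /zclosedP lx /zclosedP ly|].
- exact/zclosedP/push_fin.
- exact/zclosedP/tmap_rels.
- by rewrite pushB//; exact: fin_pushable.
- exact/zclosedP.
Qed.

Lemma tmap_additive : zmod_morphism tmap.
Proof.
apply: qmap_additive => [x /zclosedP lx|x _ /zclosedP rx|x y /zclosedP lx /zclosedP ly].
- exact/zclosedP/push_fin.
- exact/zclosedP/tmap_rels.
- by rewrite pushB//; exact: fin_pushable.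
Qed.

End TensMap.

Definition ten (A B : zmodType) (a : A) (b : B) : tens A B := cls _ _ (dirac (a, b)).

Lemma tmap_ten (A A' B B' : zmodType) (f : A -> A') (g : B -> B') :
  {morph f : x y / x - y} -> {morph g : x y / x - y} ->
  forall a b, tmap f g (ten a b) = ten (f a) (g b).
Proof. by move=> fB gB a b; rewrite tmap_cls ?push_dirac//; exact: dirac_fin. Qed.

Section TenTheory.
Variables A B : zmodType.

Lemma ten_ind (X : set (tens A B)) : subgroup X -> (forall a b, X (ten a b)) ->
  forall t, X t.
Proof.
move=> [X0 XB] Xt t; have [f /zclosedP lf ->] := cls_surj t.
pose Y := [set f : A * B -> int | locfin (fun=> tt) f /\ X (cls _ _ f)].
suff /(_ _ lf) [] : forall f, locfin (fun=> tt) f -> Y f by [].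
have [l0 lB] := @locfin_subgroup (A * B) _ int (fun=> tt).
apply: fin_ind => [|[a b]]; last by split; [exact: dirac_fin|exact: Xt].
have CB f1 f2 : locfin (fun=> tt) f1 -> locfin (fun=> tt) f2 ->
    cls _ _ (f1 - f2) = cls _ _ f1 - cls _ _ f2 :> tens A B.
  by move=> l1 l2; apply: clsB; exact/zclosedP.
split=> [|f1 f2 [l1 p1] [l2 p2]]; last by split; [exact: lB|rewrite CB//; exact: XB].
by split=> //; rewrite -[X in cls _ _ X](subrr 0) CB// subrr.
Qed.

Let tcls_eq (f1 f2 f3 : A * B -> int) : locfin (fun=> tt) f1 ->
  locfin (fun=> tt) f2 -> locfin (fun=> tt) f3 ->
  @tens_rels A B (f1 - f2 - f3) ->
  cls _ _ f1 = cls _ _ f2 + cls _ _ f3 :> tens A B.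
Proof.
move=> l1 l2 l3 r; have [_ lB] := @locfin_subgroup (A * B) _ int (fun=> tt).
apply/eqP; rewrite -subr_eq0 opprD addrA; apply/eqP.
have /zclosedP Z1 := l1; have /zclosedP Z2 := l2; have /zclosedP Z3 := l3.
rewrite -!clsB//; last exact/zclosedP/lB.
have Z0 : (0 : A * B -> int) \in zclosed (@locfin_subgroup (A * B) _ int (fun=> tt)).
  exact: rpred0.
transitivity (cls (zclosed (@locfin_subgroup (A * B) unit int (fun=> tt)))
          (zclosed (tens_rels_subgroup A B)) 0).
  apply/clsP => //; first exact/zclosedP/lB/l3/lB.
  by rewrite subr0; exact/zclosedP.
by rewrite -[X in cls _ _ X](subrr 0) clsB// subrr.
Qed.

Lemma tenDl (a a' : A) (b : B) : ten (a + a') b = ten a b + ten a' b.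
Proof.
apply: tcls_eq; try exact: dirac_fin.
exists (dirac (a, a', b)), 0; split; [exact: dirac_fin|exact: (locfin_subgroup _ _).1|].
by rewrite !push0 !push_dirac /= !subr0 ?addr0.
Qed.

Lemma tenDr (a : A) (b b' : B) : ten a (b + b') = ten a b + ten a b'.
Proof.
apply: tcls_eq; try exact: dirac_fin.
exists 0, (dirac (a, b, b')); split; [exact: (locfin_subgroup _ _).1|exact: dirac_fin|].
by rewrite !push0 !push_dirac /= !subr0 ?add0r.
Qed.

Lemma ten0l (b : B) : ten (0 : A) b = 0.
Proof. by apply: (addrI (ten (0 : A) b)); rewrite -tenDl !addr0. Qed.
Lemma ten0r (a : A) : ten a (0 : B) = 0.
Proof. by apply: (addrI (ten a (0 : B))); rewrite -tenDr !addr0. Qed.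
Lemma tenMl (a : A) (b : B) n : ten (a *+ n) b = ten a b *+ n.
Proof. by elim: n => [|n IH]; rewrite ?ten0l// !mulrS tenDl IH. Qed.
Lemma tenMr (a : A) (b : B) n : ten a (b *+ n) = ten a b *+ n.
Proof. by elim: n => [|n IH]; rewrite ?ten0r// !mulrS tenDr IH. Qed.

End TenTheory.

(** * Maps that become isomorphisms over the rationals *)

Section RationalIso.
Variables (A B : zmodType) (phi : A -> B) (N : nat).
Hypothesis phiB : {morph phi : x y / x - y}.
Hypothesis N0 : (0 < N)%N.
Hypothesis phi_ker : forall a, phi a = 0 -> a *+ N = 0.
Hypothesis phi_coker : forall b, exists a, phi a = b *+ N.

(* [phi \o psi] and [psi \o phi] are multiplication by N ^ 2 *)
Let psi0 b : A := projT1 (cid (phi_coker b)).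
Let psi b : A := psi0 b *+ N.

Let psi0P b : phi (psi0 b) = b *+ N.
Proof. exact: projT2 (cid (phi_coker b)). Qed.

(** Two preimages of [b *+ N] differ by an element of the kernel, which [N] kills. The second factor
    [N] in [psi] therefore removes the dependence on the choice made in [psi0], and makes [psi]
    additive. *)
Let psiE a b : phi a = b *+ N -> psi b = a *+ N.
Proof.
move=> e; apply/eqP; rewrite -subr_eq0 -mulrnBl; apply/eqP/phi_ker.
by rewrite phiB psi0P e subrr.
Qed.

Let psiB : {morph psi : x y / x - y}.
Proof.
move=> x y; rewrite (@psiE (psi0 x - psi0 y) (x - y)).
  by rewrite /psi mulrnBl.
by rewrite phiB !psi0P mulrnBl.
Qed.

Let psiK a : psi (phi a) = a *+ (N * N).
Proof. by rewrite (@psiE (a *+ N)) ?mulrnA//; exact: zmorphMn. Qed.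

Let phiK b : phi (psi b) = b *+ (N * N).
Proof. by rewrite /psi (zmorphMn phiB) psi0P mulrnA. Qed.

Lemma tens_map_bij : bijective (tens_map (B := rat) phi).
Proof.
(* The factor [N * N] moves across the tensor sign to the rationals, where it is inverted. *)
pose dv (q : rat) : rat := q / (N * N)%:R.
have dvB : {morph dv : x y / x - y} by move=> x y; rewrite /dv mulrBl.
have dvK q : dv q *+ (N * N) = q.
  by rewrite /dv -[LHS]mulr_natr mulfVK// pnatr_eq0 muln_eq0 negb_or -lt0n N0.
have idB (C : zmodType) : {morph (@idfun C) : x y / x - y} by [].
have F : tens_map phi =1 tmap phi (@idfun rat) by [].
have a1 := @tmap_additive _ _ _ _ phi idfun phiB (@idB rat).
have a2 := @tmap_additive _ _ _ _ psi dv psiB dvB.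
exists (tmap psi dv) => t; rewrite F.
  suff : [set t | tmap psi dv (tmap phi idfun t) = t] t by [].
  apply: ten_ind => [|a b] /=; last by rewrite !tmap_ten// psiK tenMl -tenMr dvK.
  by split=> [|x y /= ex ey]; rewrite /= ?(zmorph0 a1) ?(zmorph0 a2)// a1 a2 ex ey.
suff : [set t | tmap phi idfun (tmap psi dv t) = t] t by [].
apply: ten_ind => [|a b] /=; last by rewrite !tmap_ten// phiK tenMl -tenMr dvK.
by split=> [|x y /= ex ey]; rewrite /= ?(zmorph0 a2) ?(zmorph0 a1)// a2 a1 ex ey.
Qed.

End RationalIso.

Lemma tens_map_additive (A A' B : zmodType) (f : A -> A') :
  {morph f : x y / x - y} -> zmod_morphism (tens_map (B := B) f).
Proof. by move=> fB; apply: (@tmap_additive _ _ _ _ f idfun). Qed.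

Lemma tens_map_comp (A A' A'' B : zmodType) (f : A -> A') (g : A' -> A'') t :
  {morph f : x y / x - y} -> {morph g : x y / x - y} ->
  tens_map (B := B) g (tens_map f t) = tens_map (g \o f) t.
Proof.
move=> fB gB; have gfB : {morph g \o f : x y / x - y}.
  by move=> x y; rewrite /= fB gB.
have E (C C' : zmodType) (h : C -> C') : tens_map (B := B) h = tmap h idfun by [].
suff : [set t | tmap g idfun (tmap f idfun t) = tmap (g \o f) (@idfun B) t] t.
  by [].
have a1 := @tmap_additive _ _ B B f idfun fB (fun _ _ => erefl).
have a2 := @tmap_additive _ _ B B g idfun gB (fun _ _ => erefl).
have a3 := @tmap_additive _ _ B B _ idfun gfB (fun _ _ => erefl).
apply: ten_ind => [|a b] /=; last by rewrite !tmap_ten.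
split=> [|x y /= ex ey]; rewrite /= ?a1 ?a2 ?a3 ?ex ?ey//.
by rewrite (zmorph0 a1) (zmorph0 a2) (zmorph0 a3).
Qed.

(** * Orbit sums and coinvariants *)

Lemma bact_free (g h : GL2Z) y : bact g y = bact h y -> g = h.
Proof.
move=> /(congr1 val) [e1 e2]; apply: val_inj.
have E : val g *m row_mx (val y).1 (val y).2 = val h *m row_mx (val y).1 (val y).2.
  by rewrite !mul_mx_row e1 e2.
exact: (can_inj (mulmxK (basP y : row_mx (val y).1 (val y).2 \in unitmx)) E).
Qed.

Section Norm.
Variables (Gam : groupClosed GL2Z).
Implicit Types (g h : subG Gam) (y z : basis).

Definition sact g y : basis := bact (val g) y.

Lemma sact1 y : sact 1%g y = y. Proof. exact: bact1. Qed.
Lemma sactM g h y : sact (g * h)%g y = sact g (sact h y).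
Proof. exact: bactM. Qed.
Lemma sactK g y : sact g^-1%g (sact g y) = y.
Proof. by rewrite -sactM mulVg sact1. Qed.
Lemma sactKV g y : sact g (sact g^-1%g y) = y.
Proof. by rewrite -sactM mulgV sact1. Qed.
Lemma sact_free g h y : sact g y = sact h y -> g = h.
Proof. by move=> /bact_free /val_inj. Qed.

Lemma orb_sact g y : orb Gam (sact g y) = orb Gam y.
Proof. by apply/esym/orb_eqP; exists (val g) => //; exact: subG_valP. Qed.

Lemma orb_ex y z : orb Gam y = orb Gam z -> exists g, z = sact g y.
Proof. by move=> /orb_eqP [g Gg ->]; exists (SubG Gg). Qed.

Definition repb y : basis := xget ybase (orb Gam y).

Lemma repb_ex y : exists g, sact g y = repb y.
Proof.
have : orb Gam y (repb y) by apply: xgetPex; exists y; exact: orb_refl.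
by move=> /orb_eqP /orb_ex [g ->]; exists g.
Qed.

(** An equivariant map from bases to the group, by [gam_sact]. It exists because the action on bases
    is free, and it is what allows cochains with values in functions of a basis to be contracted
    equivariantly. *)
Definition gam y : subG Gam := projT1 (cid (repb_ex y)).

Lemma gamP y : sact (gam y) y = repb y.
Proof. exact: projT2 (cid (repb_ex y)). Qed.

Lemma repb_sact g y : repb (sact g y) = repb y.
Proof. by rewrite /repb orb_sact. Qed.

Lemma repb_id y : repb (repb y) = repb y.
Proof. by rewrite -{1}(gamP y) repb_sact. Qed.

Lemma gam_sact g y : gam (sact g y) = (gam y * g^-1)%g.
Proof.
by apply: (@sact_free _ _ (sact g y)); rewrite gamP sactM sactK repb_sact gamP.
Qed.

Lemma gam_repb y : gam (repb y) = 1%g.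
Proof. by apply: (@sact_free _ _ (repb y)); rewrite gamP repb_id sact1. Qed.

Variable V : rmod GL2Z.
Implicit Types (f r u : basis -> V).

Definition racts (v : V) g : V := ract v (val g).
Lemma ractsB g : {morph racts^~ g : v w / v - w}. Proof. exact: ractB. Qed.
Lemma racts1 v : racts v 1%g = v. Proof. exact: ract1. Qed.
Lemma ractsM v g h : racts (racts v g) h = racts v (g * h)%g.
Proof. exact: ractM. Qed.
Lemma ractsKV v g : racts (racts v g^-1%g) g = v.
Proof. by rewrite ractsM mulVg racts1. Qed.

(** The sum is finite on chains: by freeness the terms correspond to points of one orbit, where [f]
    has finite support. By [nrm_eqv], [nrm_surj], [nrm_ker] and [coinv_nrm] it induces an
    isomorphism from coinvariants onto equivariant functions, integrally. *)
Definition nrm f y : V := \sum_(g \in [set: subG Gam]) racts (f (sact g y)) g.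

Definition eqv u : Prop := forall g y, racts (u (sact g y)) g = u y.

Lemma locfin_orb f y : locfin (orb Gam) f ->
  exists s : seq (subG Gam), uniq s /\ forall g, f (sact g y) <> 0 -> g \in s.
Proof.
move=> lf; have := lf (orb Gam y) => fin.
have : finite_set [set g | f (sact g y) <> 0].
  pose k z := xget (1%g : subG Gam) [set g | z = sact g y].
  apply: (sub_finite_set _ (finite_image k fin)) => g /= fg.
  exists (sact g y); first by split => //=; exact: orb_sact.
  rewrite /k; case: xgetP => [h _ /= /sact_free //|/(_ g) /=]; by [].
move=> /finite_seqP [s sE]; exists (undup s); split; first exact: undup_uniq.
by move=> g fg; rewrite mem_undup; have : [set` s] g by rewrite -sE.
Qed.

Lemma nrmE f y s : uniq s -> (forall g, f (sact g y) <> 0 -> g \in s) ->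
  nrm f y = \sum_(g <- s) racts (f (sact g y)) g.
Proof.
move=> us fs; apply: fsum_supported => // g fg; apply: fs => f0.
by apply: fg; rewrite f0 (zmorph0 (ractsB g)).
Qed.

Lemma nrmB f r : locfin (orb Gam) f -> locfin (orb Gam) r -> nrm (f - r) = nrm f - nrm r.
Proof.
move=> lf lr; apply/funext => y; have [s [us fs]] := locfin_orb y lf.
have [t [ut rt]] := locfin_orb y lr.
pose w := undup (s ++ t); have uw : uniq w by exact: undup_uniq.
have fw g : f (sact g y) <> 0 -> g \in w by move=> /fs; rewrite mem_undup mem_cat => ->.
have rw g : r (sact g y) <> 0 -> g \in w.
  by move=> /rt; rewrite mem_undup mem_cat orbC => ->.
rewrite [RHS](_ : _ = nrm f y - nrm r y)// (nrmE uw fw) (nrmE uw rw) (nrmE uw).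
  by rewrite -sumrB; apply: eq_bigr => g _; rewrite fctE ractsB.
move=> g; rewrite [X in X <> 0](_ : _ = f (sact g y) - r (sact g y))// => e.
case: (pselect (f (sact g y) = 0)) => [f0|]; last exact: fw.
by apply: rw => r0; apply: e; rewrite f0 r0 subr0.
Qed.

Lemma nrm0 : nrm 0 = 0.
Proof.
have l0 : locfin (orb Gam) (0 : basis -> V) by exact: (locfin_subgroup _ _).1.
by rewrite -{1}(subrr 0) nrmB// subrr.
Qed.

Lemma nrmN f : locfin (orb Gam) f -> nrm (- f) = - nrm f.
Proof.
have l0 : locfin (orb Gam) (0 : basis -> V) by exact: (locfin_subgroup _ _).1.
by move=> lf; rewrite -sub0r nrmB// nrm0 sub0r.
Qed.

Lemma nrmD f r : locfin (orb Gam) f -> locfin (orb Gam) r -> nrm (f + r) = nrm f + nrm r.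
Proof.
move=> lf lr; rewrite -{1}[r]opprK nrmB ?nrmN ?opprK//.
exact: subgroupN (locfin_subgroup _ _) lr.
Qed.

Lemma nrm_comp f p k : beq p k -> nrm (f \o k) = nrm f \o k.
Proof.
move=> [_ _ _ kg]; apply/funext => y; rewrite /nrm /=.
by apply: eq_fsbigr => g _; rewrite /sact kg.
Qed.

Lemma nrm_eqv f : locfin (orb Gam) f -> eqv (nrm f).
Proof.
move=> lf g y; have [s [us fs]] := locfin_orb (sact g y) lf.
rewrite (nrmE us fs) (zmorph_sum (ractsB g)).
have ig : injective (fun h : subG Gam => (h * g)%g) by exact: mulIg.
rewrite (@nrmE _ _ [seq (h * g)%g | h <- s]); last first.
  move=> h fh; apply/mapP; exists (h * g^-1)%g; last by rewrite mulgVK.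
  by apply: fs; rewrite -sactM mulgVK.
  by rewrite map_inj_uniq.
by rewrite big_map; apply: eq_bigr => h _; rewrite ractsM sactM.
Qed.

Lemma nrm_surj u : eqv u -> exists2 f, locfin (orb Gam) f & nrm f = u.
Proof.
(* Restricting [u] to one representative of each orbit leaves a single term in the norm, that of
   [gam y]. *)
move=> eu; exists (fun y => if y == repb y then u y else 0).
  move=> i; case: (pselect (exists y, orb Gam y = i)) => [[y0 <-]|ny]; last first.
    by apply: (sub_finite_set _ (finite_set0 _)) => y /= [yi _]; case: ny; exists y.
  apply: (sub_finite_set _ (finite_set1 (repb y0))) => y /= [yi].
  by case: eqP => // -> _; rewrite /repb yi.
apply/funext => y; rewrite (@nrmE _ _ [:: gam y])//.
  by rewrite big_cons big_nil addr0 gamP repb_id eqxx -gamP eu.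
move=> g; case: eqP => // e _; rewrite inE; apply/eqP.
by apply: (@sact_free _ _ y); rewrite gamP e repb_sact.
Qed.

Lemma nrm_ker f : locfin (orb Gam) f -> nrm f = 0 -> coinv_rels Gam f.
Proof.
move=> lf nf.
(* The relation for [gam y] moves the term of [f] at [y] to the representative of its orbit. What
   accumulates there is the norm of [f], which vanishes. *)
pose c (t : subG Gam * basis) : V :=
  if t.1 == gam t.2 then racts (f t.2) (t.1)^-1%g else 0.
exists c.
  move=> i; apply: (sub_finite_set _ (finite_image (fun y => (gam y, y)) (lf i))).
  move=> [g y] /= [yi]; rewrite /c /=; case: eqP => // -> cy; exists y => //; split=> // fy.
  by apply: cy; rewrite fy (zmorph0 (ractsB _)).
apply/funext => y; rewrite [RHS](_ : _ =
  push snd (ractf c) y - push (fun t : subG Gam * basis => bact (val t.1) t.2) c y)//.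
rewrite (@push_supported _ _ _ _ _ [:: (gam y, y)])//; last first.
  move=> [g z]; rewrite /ractf /c /=; case: eqP => [->|_] e zy; first by rewrite zy inE.
  by case: e; rewrite ract0.
rewrite big_cons big_nil /= eqxx addr0 {1}/ractf {1}/c /= eqxx.
rewrite -/(racts _ _) ractsKV.
have [s [us fs]] := locfin_orb y lf.
rewrite (@push_supported _ _ _ _ _ [seq (gam (sact g y), sact g y) | g <- s]).
- rewrite big_map big_mkcond /=.
  case: (pselect (y = repb y)) => [yr|yr].
    rewrite [X in _ - X](_ : _ = nrm f y); first by rewrite nf subr0.
    rewrite (nrmE us fs); apply: eq_bigr => g _.
    by rewrite /c -/(sact _ _) gamP repb_sact -yr eqxx /= eqxx gam_sact yr gam_repb mul1g invgK.
  rewrite big1 ?subr0// => g _; rewrite -/(sact _ _) gamP repb_sact.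
  by case: eqP => // e; case: yr.
- by rewrite map_inj_uniq// => g h /(congr1 snd); exact: sact_free.
- move=> [g z]; rewrite /c /=; case: eqP => // -> cz zy.
  have zE : z = sact (gam z)^-1%g y by rewrite -zy -/(sact _ _) sactK.
  apply/mapP; exists (gam z)^-1%g; last by rewrite -zE.
  apply: fs; rewrite -zE => f0; apply: cz; by rewrite f0 (zmorph0 (ractsB _)).
Qed.

(** A term of a relation contributes to the norm at [y] twice: as [v g] at the point x and as [v] at
    [g x]. The sum over the group gives both the same value, so they cancel once the finite sums are
    exchanged. *)
Lemma coinv_nrm r : coinv_rels Gam r -> nrm r = 0.
Proof.
move=> [c lc ->]; apply/funext => y; rewrite [RHS]/(0 : V).
have [s [us sP]] : exists s : seq (subG Gam * basis), uniq s /\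
    forall t, c t <> 0 -> orb Gam t.2 = orb Gam y -> t \in s.
  have := lc (orb Gam y) => /finite_seqP [s sE]; exists (undup s).
  split; first exact: undup_uniq.
  by move=> t ct ty; rewrite mem_undup; have : [set` s] t by rewrite -sE.
(* [a z] is the element carrying [y] to [z]. Off the orbit it takes the default 1, and there [c']
   below vanishes. *)
pose a z := xget (1%g : subG Gam) [set g | z = sact g y].
have aP z : orb Gam z = orb Gam y -> z = sact (a z) y.
  move=> zy; have [g gE] := orb_ex (esym zy).
  by rewrite /a; case: xgetP => [h _ //|/(_ g)].
pose c' t := if orb Gam t.2 == orb Gam y then c t else 0.
have E1 g : push snd (ractf c) (sact g y) =
    \sum_(t <- s | t.2 == sact g y) racts (c' t) t.1.
  rewrite (@push_supported _ _ _ _ _ s)//.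
    by apply: eq_bigr => t /eqP tg; rewrite /c' tg orb_sact eqxx.
  move=> t e ty; apply: sP; last by rewrite ty orb_sact.
  by move=> c0; apply: e; rewrite /ractf c0 ract0.
have E2 g : push (fun t : subG Gam * basis => bact (val t.1) t.2) c (sact g y) =
    \sum_(t <- s | sact t.1 t.2 == sact g y) c' t.
  have tO (t : subG Gam * basis) : bact (val t.1) t.2 = sact g y -> orb Gam t.2 = orb Gam y.
    by move=> /(congr1 (orb Gam)); rewrite -/(sact _ _) !orb_sact.
  rewrite (@push_supported _ _ _ _ _ s)//.
    by apply: eq_bigr => t /eqP /tO tg; rewrite /c' tg eqxx.
  by move=> t e ty; apply: sP => //; exact: tO ty.
have E g : (push snd (ractf c) - push (fun t : subG Gam * basis => bact (val t.1) t.2) c)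
    (sact g y) = \sum_(t <- s | t.2 == sact g y) racts (c' t) t.1 -
      \sum_(t <- s | sact t.1 t.2 == sact g y) c' t.
  by rewrite -E1 -E2.
pose L := undup ([seq a t.2 | t <- s] ++ [seq (t.1 * a t.2)%g | t <- s]).
have uL : uniq L by exact: undup_uniq.
have L1 t : t \in s -> a t.2 \in L.
  by move=> ts; rewrite mem_undup mem_cat; apply/orP; left; apply/mapP; exists t.
have L2 t : t \in s -> (t.1 * a t.2)%g \in L.
  by move=> ts; rewrite mem_undup mem_cat; apply/orP; right; apply/mapP; exists t.
have oP (t : subG Gam * basis) : c' t <> 0 -> t.2 = sact (a t.2) y.
  by rewrite /c'; case: eqP => // /aP.
rewrite (nrmE uL) => [|g]; last first.
  rewrite E => e; apply: contrapT => gL; apply: e.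
  rewrite big_seq_cond big1 => [|t /andP[ts /eqP tg]]; last first.
    apply: contrapT => ct; apply: gL.
    suff -> : g = a t.2 by exact: L1.
    apply: (@sact_free _ _ y); rewrite -tg; apply: oP => c0.
    by apply: ct; rewrite c0 (zmorph0 (ractsB _)).
  rewrite big_seq_cond big1 ?subr0// => t /andP[ts /eqP tg].
  apply: contrapT => /oP ct; apply: gL.
  suff -> : g = (t.1 * a t.2)%g by exact: L2.
  by apply: (@sact_free _ _ y); rewrite -tg sactM -ct.
transitivity (\sum_(g <- L) \sum_(t <- s)
   (racts (if t.2 == sact g y then racts (c' t) t.1 else 0) g -
    racts (if sact t.1 t.2 == sact g y then c' t else 0) g)).
  apply: eq_bigr => g _; rewrite E ractsB !(zmorph_sum (ractsB g)).
  rewrite [RHS]sumrB; congr (_ - _); rewrite [LHS]big_mkcond; apply: eq_bigr => t _;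
    by case: eqP => // _; rewrite (zmorph0 (ractsB _)).
rewrite exchange_big /= big_seq big1// => t ts.
case: (pselect (c' t = 0)) => [c0|ct].
  rewrite big1// => g _; rewrite c0 (zmorph0 (ractsB _)) !if_same.
  by rewrite (zmorph0 (ractsB _)) subr0.
have te := oP _ ct.
rewrite sumrB (bigD1_seq (a t.2)) ?L1//= -te eqxx.
rewrite [X in _ + X - _]big1 => [|g ga]; last first.
  case: eqP => [tg|_]; last by rewrite (zmorph0 (ractsB _)).
  by case/eqP: ga; apply: (@sact_free _ _ y); rewrite -tg.
rewrite (bigD1_seq (t.1 * a t.2)%g) ?L2//= sactM -te eqxx.
rewrite [X in _ - (_ + X)]big1 => [|g ga]; last first.
  case: eqP => [tg|_]; last by rewrite (zmorph0 (ractsB _)).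
  by case/eqP: ga; apply: (@sact_free _ _ y); rewrite -tg sactM -te.
by rewrite !addr0 ractsM subrr.
Qed.

End Norm.

(** * Maps out of and between subquotients *)

Section SubquotientMaps.
Variables (G H : zmodType) (Z B : zmodClosed G).

Lemma cls0 : cls Z B 0 = 0.
Proof. by rewrite -[X in cls _ _ X](subrr 0) clsB ?rpred0// subrr. Qed.

Lemma clsD x y : x \in Z -> y \in Z -> cls Z B (x + y) = cls Z B x + cls Z B y.
Proof.
move=> Zx Zy; rewrite -{1}[y]opprK clsB ?rpredN//; congr (_ + _).
by rewrite -[- y]sub0r clsB ?rpred0// cls0 sub0r opprK.
Qed.

Lemma clsMn x n : x \in Z -> cls Z B (x *+ n) = cls Z B x *+ n.
Proof.
move=> Zx; elim: n => [|n IH]; first exact: cls0.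
by rewrite !mulrS clsD ?rpredMn// IH.
Qed.

Lemma cls_eq0 x : x \in Z -> cls Z B x = 0 <-> x \in B.
Proof. by move=> Zx; rewrite -cls0 clsP ?rpred0// subr0. Qed.

Definition qlift (F : G -> H) (q : subquot Z B) : H := F (val (repr q)).

Variable F : G -> H.
Hypothesis FB : forall x, x \in Z -> x \in B -> F x = 0.
Hypothesis FD : {in Z &, {morph F : x y / x - y}}.

Lemma qliftE x : x \in Z -> qlift F (cls Z B x) = F x.
Proof.
move=> Zx; rewrite /qlift; set u := repr _.
have Zu : val u \in Z by exact: subz_valP.
apply/eqP; rewrite -subr_eq0 -FD//; apply/eqP/FB; first exact: rpredB.
apply/(clsP B Zu Zx); rewrite (clsE B Zu) -[RHS](reprK (cls Z B x)) -/u.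
by rewrite /qcls; congr (\pi_ _)%qT; exact: val_inj.
Qed.

Lemma qliftB : {morph qlift F : p q / p - q}.
Proof.
move=> p q; have [x Zx ->] := cls_surj p; have [y Zy ->] := cls_surj q.
by rewrite -clsB// !qliftE ?rpredB// FD.
Qed.

End SubquotientMaps.

Section QmapKernel.
Variables (G G' : zmodType) (Z B : zmodClosed G) (Z' B' : zmodClosed G').
Variables (F : G -> G') (N : nat).
Hypothesis FZ : forall x, x \in Z -> F x \in Z'.
Hypothesis FB : forall x, x \in Z -> x \in B -> F x \in B'.
Hypothesis FD : {in Z &, {morph F : x y / x - y}}.

Lemma qmap_ker : (forall x, x \in Z -> F x \in B' -> x *+ N \in B) ->
  forall q : subquot Z B, qmap F q = 0 :> subquot Z' B' -> q *+ N = 0.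
Proof.
move=> ker q; have [x Zx ->] := cls_surj q.
rewrite (qmapE FZ FB FD)// => /(cls_eq0 _ (FZ Zx)) Fx.
by rewrite -clsMn//; apply/(cls_eq0 _ (rpredMn N Zx)); exact: ker.
Qed.

Lemma qmap_coker :
  (forall z, z \in Z' -> exists2 x, x \in Z & F x - z *+ N \in B') ->
  forall p : subquot Z' B', exists q : subquot Z B, qmap F q = p *+ N.
Proof.
move=> coker p; have [z Zz ->] := cls_surj p; have [x Zx Fx] := coker z Zz.
exists (cls Z B x); rewrite (qmapE FZ FB FD)// -clsMn//.
by apply/(clsP _ (FZ Zx) (rpredMn N Zz)).
Qed.

End QmapKernel.

Lemma fmulrn (T : Type) (A : zmodType) (f : T -> A) n y : (f *+ n) y = f y *+ n.
Proof. by elim: n => // n IH; rewrite !mulrS -IH. Qed.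

(** * The averages as operations on chains *)

Section SignedAverages.
Variable A : zmodType.
Implicit Types f : basis -> A.

(** The averages [vavg] and [eavg] conjugated by [sgn], written through translates of [f] by
    symmetries. In this form they visibly preserve local finiteness, commute with the norm and agree
    with a multiple of [f] modulo the relations. *)
Definition S1 f : basis -> A :=
  let a := f + (f \o rot) + (f \o rot2) in
  let b := a - (a \o swap) in b + (b \o neg).

Definition S2 f : basis -> A :=
  let a := f - (f \o swap) in
  let b := a + (a \o neg) in b + (b \o neg1).

Lemma S1E f : S1 f = sgn (vavg (sgn f)).
Proof.
apply/funext => y; rewrite /S1 /sgn /vavg /ssum /rsum !fctE /= !wE.
rewrite !(bdet_swap, bdet_neg, bdet_rot, bdet_rot2) !mulrNz !mulrzDl !mulNrz -!mulrzA.
by rewrite bdet2 !mulr1z; zmod.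
Qed.

Lemma S2E f : S2 f = sgn (eavg (sgn f)).
Proof.
apply/funext => y; rewrite /S2 /sgn /eavg /ssum !fctE /= !wE.
rewrite !(bdet_swap, bdet_neg1, bdet_neg2, bdet_neg) !mulrNz !(mulrzDl, mulNrz) -!mulrzA.
by rewrite bdet2 !mulr1z; zmod.
Qed.

Lemma eavgN (u : basis -> A) y : eavg (- u) y = - eavg u y.
Proof. by rewrite /eavg /ssum !fctE; zmod. Qed.
Lemma vavgB (u v : basis -> A) y : vavg (u - v) y = vavg u y - vavg v y.
Proof. by rewrite /vavg /ssum /rsum !fctE; zmod. Qed.
Lemma eavgB (u v : basis -> A) y : eavg (u - v) y = eavg u y - eavg v y.
Proof. by rewrite /eavg /ssum !fctE; zmod. Qed.
Lemma vavg0 y : vavg (0 : basis -> A) y = 0.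
Proof. by rewrite -[X in vavg X](subrr 0) vavgB subrr. Qed.
Lemma eavg0 y : eavg (0 : basis -> A) y = 0.
Proof. by rewrite -[X in eavg X](subrr 0) eavgB subrr. Qed.
Lemma sgnB f g : sgn (f - g) = sgn f - sgn g.
Proof. by apply/funext => y; rewrite /sgn !fctE mulrzBl. Qed.
Lemma sgn0 : sgn (0 : basis -> A) = 0.
Proof. by apply/funext => y; rewrite /sgn mul0rz. Qed.

Variables (I : Type) (p : basis -> I).
Hypothesis bp : blabel p.

Lemma S1_locfin f : locfin p f -> locfin p (S1 f).
Proof.
move=> lf; rewrite /S1; set a := f + _ + _.
have la : locfin p a.
  by rewrite /a; apply: locfinD; [apply: locfinD|];
    [| exact: locfin_rot | exact: locfin_rot2].
have lb : locfin p (a - (a \o swap)) by apply: locfinB => //; exact: locfin_swap.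
by apply: locfinD => //; exact: locfin_neg.
Qed.

Lemma S2_locfin f : locfin p f -> locfin p (S2 f).
Proof.
move=> lf; rewrite /S2; set a := f - _.
have la : locfin p a by apply: locfinB => //; exact: locfin_swap.
have lb : locfin p (a + (a \o neg)) by apply: locfinD => //; exact: locfin_neg.
by apply: locfinD => //; exact: locfin_neg1.
Qed.

Lemma DS_S1 f : locfin p f -> double_shuffles p (f *+ 12 - S1 f).
Proof.
move=> lf; rewrite /S1; set a := f + _ + _.
have la : locfin p a.
  by rewrite /a; apply: locfinD; [apply: locfinD|];
    [| exact: locfin_rot | exact: locfin_rot2].
set b := a - (a \o swap).
have lb : locfin p b by apply: locfinB => //; exact: locfin_swap.
have h1 : double_shuffles p (f *+ 3 - a).
  have := DSD (DSD (DS_rot bp lf) (DS_rot bp lf)) (DS_rot bp (locfin_rot bp lf)).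
  by congr double_shuffles; apply/funext => y; rewrite /a !fctE /= ?fmulrn ?wE; zmod.
have h2 : double_shuffles p (a *+ 2 - b).
  have := DS_swap la; congr double_shuffles.
  by apply/funext => y; rewrite /b !fctE /= ?fmulrn ?wE; zmod.
(* 12 f - S1 f = 4 (3 f - a) + 2 (2 a - b) + (b - b \o neg): one summand for each stage of the
   average, weighted by the index of what remains. *)
have := DSD (DSD (DSD (DSD h1 h1) (DSD h1 h1)) (DSD h2 h2)) (DS_neg bp lb).
rewrite (_ : _ + _ + _ = f *+ 12 - (b + (b \o neg)))//.
by apply/funext => y; rewrite !fctE /= ?fmulrn; zmod.
Qed.

Lemma WR_S2 f : locfin p f -> wedge_rels p (f *+ 8 - S2 f).
Proof.
move=> lf; rewrite /S2; set a := f - _.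
have la : locfin p a by apply: locfinB => //; exact: locfin_swap.
set b := a + _.
have lb : locfin p b by apply: locfinD => //; exact: locfin_neg.
have WD := @wedge_relsD _ p A.
have h1 : wedge_rels p (f *+ 2 - a).
  have := wedge_swap lf; congr wedge_rels.
  by apply/funext => y; rewrite /a !fctE /= ?fmulrn ?wE; zmod.
have h2 : wedge_rels p (a *+ 2 - b).
  have := WD _ _ (wedge_neg1 la) (wedge_neg2 (locfin_neg1 bp la)).
  congr wedge_rels; apply/funext => y; rewrite /b !fctE /= ?fmulrn ?wE; zmod.
have := WD _ _ (WD _ _ (WD _ _ (WD _ _ h1 h1) (WD _ _ h1 h1)) (WD _ _ h2 h2)) (wedge_neg1 lb).
rewrite (_ : _ + _ + _ = f *+ 8 - (b + (b \o neg1)))//.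
by apply/funext => y; rewrite !fctE /= ?fmulrn; zmod.
Qed.

End SignedAverages.

Lemma locfin_all (A : zmodType) (f : basis -> A) : locfin idfun f.
Proof. by move=> y; apply: (sub_finite_set _ (finite_set1 y)) => z /= []. Qed.

(** * Modular chains as equivariant functions on the tree *)

Section Chains.
Variables (Gam : groupClosed GL2Z) (V : rmod GL2Z).
Local Notation lf := (locfin (orb Gam)).
Local Notation bo := (@blabel_orb Gam).
Local Notation DS := (@double_shuffles _ (orb Gam) V).
Local Notation WR := (@wedge_rels _ (orb Gam) V).
Local Notation CI := (@coinv_rels Gam V).
Local Notation nrm := (@nrm Gam V).
Implicit Types (f r u : basis -> V).

Definition vnrm f : basis -> V := vavg (sgn (nrm f)).
Definition enrm f : basis -> V := eavg (sgn (nrm f)).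

Lemma nrm_S1 f : lf f -> nrm (S1 f) = S1 (nrm f).
Proof.
move=> lff; rewrite /S1; set a := f + _ + _.
have la : lf a.
  by rewrite /a; apply: locfinD; [apply: locfinD|];
    [| exact: (locfin_rot bo) | exact: (locfin_rot2 bo)].
have aE : nrm a = nrm f + (nrm f \o rot) + (nrm f \o rot2).
  rewrite /a nrmD; [|apply: locfinD => //; exact: (locfin_rot bo)|exact: (locfin_rot2 bo)].
  rewrite nrmD //; last exact: (locfin_rot bo).
  by rewrite (nrm_comp Gam f beq_rot) (nrm_comp Gam f beq_rot2).
have lb : lf (a - (a \o swap)) by apply: locfinB => //; exact: (locfin_swap bo).
have bE : nrm (a - (a \o swap)) = nrm a - (nrm a \o swap).
  by rewrite nrmB ?(nrm_comp Gam _ beq_swap)//; exact: (locfin_swap bo).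
rewrite nrmD//; last exact: (locfin_neg bo).
by rewrite (nrm_comp Gam _ beq_negneg) bE aE.
Qed.

Lemma nrm_S2 f : lf f -> nrm (S2 f) = S2 (nrm f).
Proof.
move=> lff; rewrite /S2; set a := f - _.
have la : lf a by apply: locfinB => //; exact: (locfin_swap bo).
have aE : nrm a = nrm f - (nrm f \o swap).
  by rewrite /a nrmB ?(nrm_comp Gam _ beq_swap)//; exact: (locfin_swap bo).
have lb : lf (a + (a \o neg)) by apply: locfinD => //; exact: (locfin_neg bo).
have bE : nrm (a + (a \o neg)) = nrm a + (nrm a \o neg).
  by rewrite nrmD ?(nrm_comp Gam _ beq_negneg)//; exact: (locfin_neg bo).
rewrite nrmD//; last exact: (locfin_neg1 bo).
by rewrite (nrm_comp Gam _ beq_neg1) bE aE.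
Qed.

Lemma DS_locfin r : DS r -> lf r.
Proof.
move=> [a [b [la lb ->]]].
rewrite (push_beq _ beq_swap) (push_beq _ beq_shl) (push_beq _ beq_shr).
apply: locfinD; apply: locfinD => //.
- exact: (locfin_swap bo).
- exact: (locfin_comp bo beq_shl).
- exact: (locfin_comp bo beq_shr).
Qed.

Lemma WR_locfin r : WR r -> lf r.
Proof.
move=> [a [b [c [la lb lc ->]]]].
rewrite (push_beq _ beq_swap) (push_beq _ beq_neg1) (push_beq _ beq_neg2).
apply: locfinD; [apply: locfinD; apply: locfinB|apply: locfinD] => //.
- exact: (locfin_neg1 bo).
- exact: (locfin_comp bo beq_neg2).
- exact: (locfin_swap bo).
Qed.

Lemma DS_nrm r : DS r -> double_shuffles idfun (nrm r).
Proof.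
move=> [a [b [la lb ->]]].
rewrite (push_beq _ beq_swap) (push_beq _ beq_shl) (push_beq _ beq_shr).
exists (nrm a), (nrm b); split; try exact: locfin_all.
rewrite (push_beq _ beq_swap) (push_beq _ beq_shl) (push_beq _ beq_shr).
have l1 := locfin_swap bo la.
have l2 : lf (b \o shlV) by exact: (locfin_comp bo beq_shl).
have l3 : lf (b \o shrV) by exact: (locfin_comp bo beq_shr).
rewrite nrmD; [|exact: locfinD|exact: locfinD].
rewrite !nrmD// (nrm_comp Gam _ beq_swap) (nrm_comp Gam _ beq_shl).
by rewrite (nrm_comp Gam _ beq_shr).
Qed.

Lemma WR_nrm r : WR r -> wedge_rels idfun (nrm r).
Proof.
move=> [a [b [c [la lb lc ->]]]].
rewrite (push_beq _ beq_swap) (push_beq _ beq_neg1) (push_beq _ beq_neg2).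
exists (nrm a), (nrm b), (nrm c); split; try exact: locfin_all.
rewrite (push_beq _ beq_swap) (push_beq _ beq_neg1) (push_beq _ beq_neg2).
have l1 := locfin_neg1 bo la.
have l2 : lf (b \o neg2) by exact: (locfin_comp bo beq_neg2).
have l3 := locfin_swap bo lc.
rewrite nrmD; [|apply: locfinD; exact: locfinB|exact: locfinD].
rewrite nrmD; [|exact: locfinB|exact: locfinB].
rewrite !nrmB// nrmD// (nrm_comp Gam _ beq_swap) (nrm_comp Gam _ beq_neg1).
by rewrite (nrm_comp Gam _ beq_neg2).
Qed.

Lemma vnrmB f r : lf f -> lf r -> vnrm (f - r) = vnrm f - vnrm r.
Proof.
move=> l1 l2; apply/funext => y.
by rewrite [RHS](_ : _ = vnrm f y - vnrm r y)// /vnrm nrmB// sgnB vavgB.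
Qed.

Lemma enrmB f r : lf f -> lf r -> enrm (f - r) = enrm f - enrm r.
Proof.
move=> l1 l2; apply/funext => y.
by rewrite [RHS](_ : _ = enrm f y - enrm r y)// /enrm nrmB// sgnB eavgB.
Qed.

Lemma vnrm_rels f : lf f -> setadd DS CI f -> vnrm f = 0.
Proof.
move=> lff [a da [b cb e]]; have la := DS_locfin da.
have eb : b = f - a by rewrite -e addrC addKr.
have lb : lf b by rewrite eb; exact: locfinB.
rewrite -e -[b]opprK vnrmB//; last exact: locfinN.
apply/funext => y; rewrite [LHS](_ : _ = vnrm a y - vnrm (- b) y)//.
rewrite {2}/vnrm nrmN// (coinv_nrm cb) oppr0 sgn0 /vnrm (sgn_DS _ (DS_nrm da)).
by rewrite vavg0 subrr.
Qed.

Lemma enrm_rels f : lf f -> setadd WR CI f -> enrm f = 0.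
Proof.
move=> lff [a da [b cb e]]; have la := WR_locfin da.
have eb : b = f - a by rewrite -e addrC addKr.
have lb : lf b by rewrite eb; exact: locfinB.
rewrite -e -[b]opprK enrmB//; last exact: locfinN.
apply/funext => y; rewrite [LHS](_ : _ = enrm a y - enrm (- b) y)//.
rewrite {2}/enrm nrmN// (coinv_nrm cb) oppr0 sgn0 /enrm (sgn_WR _ (WR_nrm da)).
by rewrite eavg0 subrr.
Qed.

Lemma vnrm_ker f : lf f -> vnrm f = 0 -> setadd DS CI (f *+ 12).
Proof.
move=> lff v0; exists (f *+ 12 - S1 f); first exact: (DS_S1 bo lff).
exists (S1 f); last by rewrite subrK.
apply: nrm_ker; first exact: (S1_locfin bo lff).
by rewrite nrm_S1// S1E -/(vnrm f) v0 sgn0.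
Qed.

Lemma enrm_ker f : lf f -> enrm f = 0 -> setadd WR CI (f *+ 8).
Proof.
move=> lff v0; exists (f *+ 8 - S2 f); first exact: (WR_S2 bo lff).
exists (S2 f); last by rewrite subrK.
apply: nrm_ker; first exact: (S2_locfin bo lff).
by rewrite nrm_S2// S2E -/(enrm f) v0 sgn0.
Qed.

Lemma vnrm_surj u : vfun u -> eqv Gam (sgn u) ->
  exists2 f, lf f & forall y, vnrm f y = u y *+ 12.
Proof.
move=> vu eu; have [f lff fE] := nrm_surj eu; exists f => // y.
by rewrite /vnrm fE sgnK vavg_id.
Qed.

Lemma enrm_surj u : efun u -> eqv Gam (sgn u) ->
  exists2 f, lf f & forall y, enrm f y = u y *+ 8.
Proof.
move=> vu eu; have [f lff fE] := nrm_surj eu; exists f => // y.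
by rewrite /enrm fE sgnK eavg_id.
Qed.

Lemma enrm_mdiff f y : lf f -> enrm (mdiff f) y = - (vnrm f y - vnrm f (neg1 y)).
Proof.
move=> lff; rewrite /enrm.
have -> : nrm (mdiff f) = mdiff (nrm f).
  have l1 := locfin_rot bo lff; have l2 := locfin_rot2 bo lff.
  rewrite !mdiffE nrmN; last by do 2 apply: locfinD => //.
  rewrite nrmD//; last exact: locfinD.
  by rewrite nrmD// (nrm_comp Gam _ beq_rot) (nrm_comp Gam _ beq_rot2).
have -> : sgn (mdiff (nrm f)) = - rsum (sgn (nrm f)).
  by apply/funext => z; rewrite mdiff_sgn.
by rewrite eavgN eavg_rsum.
Qed.

End Chains.

(** * Equivariant cochains *)

Section Actions.
Variable Gam : groupClosed GL2Z.
Implicit Types (g : subG Gam) (y : basis).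

Lemma sact_swap g y : swap (sact g y) = sact g (swap y).
Proof. by have [_ _ h _] := beq_swap; exact: h. Qed.
Lemma sact_rot g y : rot (sact g y) = sact g (rot y).
Proof. by have [_ _ h _] := beq_rot; exact: h. Qed.
Lemma sact_rot2 g y : rot2 (sact g y) = sact g (rot2 y).
Proof. by have [_ _ h _] := beq_rot2; exact: h. Qed.
Lemma sact_neg g y : neg (sact g y) = sact g (neg y).
Proof. by have [_ _ h _] := beq_negneg; exact: h. Qed.
Lemma sact_neg1 g y : neg1 (sact g y) = sact g (neg1 y).
Proof. by have [_ _ h _] := beq_neg1; exact: h. Qed.

Definition sactE := (sact_swap, sact_rot, sact_rot2, sact_neg, sact_neg1).

Variable A : zmodType.
Implicit Types u : basis -> A.

Lemma vavg_sact u g y : vavg (fun z => u (sact g z)) y = vavg u (sact g y).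
Proof. by rewrite /vavg /ssum /rsum !sactE. Qed.

Lemma eavg_sact u g y : eavg (fun z => u (sact g z)) y = eavg u (sact g y).
Proof. by rewrite /eavg /ssum !sactE. Qed.

Variable B : zmodType.
Variable f : A -> B.
Hypothesis fB : {morph f : x y / x - y}.

Lemma vavg_morph u y : vavg (fun z => f (u z)) y = f (vavg u y).
Proof. by rewrite /vavg /ssum /rsum !(zmorphD fB). Qed.

Lemma eavg_morph u y : eavg (fun z => f (u z)) y = f (eavg u y).
Proof. by rewrite /eavg /ssum fB !(zmorphD fB). Qed.

Lemma vfun_morph u g : vfun u -> vfun (fun z => f (u (sact g z))).
Proof. by move=> [s r n]; split=> y; rewrite -sactE ?s ?r ?n. Qed.

End Actions.

Lemma fsubE (T : Type) (A : zmodType) (u v : T -> A) y : (u - v) y = u y - v y.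
Proof. by []. Qed.

Lemma vfunB (A : zmodType) (u v : basis -> A) : vfun u -> vfun v -> vfun (u - v).
Proof. by move=> [s r n] [s' r' n']; split=> y; rewrite !fsubE; [rewrite s s'|rewrite r r'|rewrite n n']. Qed.

Lemma primitive_unique (A : zmodType) (P P' : basis -> A) : vfun P -> vfun P' ->
  (forall y, P y - P (neg1 y) = P' y - P' (neg1 y)) ->
  forall y z, P y - P z = P' y - P' z.
Proof.
move=> vP vP' e y z.
have c := vfun_const (vfunB vP vP').
have {}c w : P w - P' w = P ybase - P' ybase.
  apply: c => x; rewrite !fsubE; apply/eqP; rewrite -subr_eq0.
  have := e x => /eqP; rewrite -subr_eq0 => /eqP {}e.
  by apply/eqP; rewrite -[RHS]oppr0 -e; zmod.
apply/eqP; rewrite -subr_eq0; apply/eqP.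
have /eqP := etrans (c y) (esym (c z)); rewrite -subr_eq0 => /eqP {}c.
by rewrite -[RHS]c; zmod.
Qed.

(** * The cone homotopy on homogeneous cochains *)

Section Cobd.
Variables (G : groupType) (W : rmod G).

Definition consx n (g : G) (x : 'I_n -> G) : 'I_n.+1 -> G :=
  fun i => oapp x g (unlift ord0 i).

Lemma consx0 n g (x : 'I_n -> G) : consx g x ord0 = g.
Proof. by rewrite /consx unlift_none. Qed.

Lemma consx_lift n g (x : 'I_n -> G) i : consx g x (lift ord0 i) = x i.
Proof. by rewrite /consx liftK. Qed.

Lemma consx_mul n g h (x : 'I_n -> G) :
  (fun i => (consx g x i * h)%g) = consx (g * h)%g (fun i => (x i * h)%g).
Proof. by apply/funext => i; rewrite /consx; case: unliftP. Qed.

(** Inserting a fixed first argument is a contracting homotopy, but not an equivariant one. Taking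
    [gam z] for that argument restores equivariance, at the price of a dependence on the basis
    [z]. *)
Lemma cobd_consx n (f : ('I_n.+2 -> G) -> W) g (x : 'I_n.+2 -> G) :
  cobd f (consx g x) = f x - cobd (fun x' : 'I_n.+1 -> G => f (consx g x')) x.
Proof.
rewrite /cobd big_ord_recl /= mulr1z; congr (f _ + _).
  by apply/funext => i /=; rewrite consx_lift.
rewrite -[RHS]sumrN; apply: eq_bigr => i _.
rewrite [bump 0 i]/bump leq0n add1n exprS mulN1r mulrNz; congr (- (f _ *~ _)).
apply/funext => j /=; case: (unliftP ord0 j) => [k|] -> /=.
  rewrite (_ : lift (lift ord0 i) (lift ord0 k) = lift ord0 (lift i k)).
    by rewrite !consx_lift.
  by apply: val_inj; rewrite /= /bump /=; lia.
rewrite (_ : lift (lift ord0 i) ord0 = ord0) ?consx0//.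
exact: val_inj.
Qed.

Lemma cobdD n (a b : ('I_n.+1 -> G) -> W) x :
  cobd (fun x' => a x' + b x') x = cobd a x + cobd b x.
Proof. by rewrite /cobd -big_split; apply: eq_bigr => i _; rewrite mulrzDl. Qed.

Lemma cobdN n (a : ('I_n.+1 -> G) -> W) x : cobd (fun x' => - a x') x = - cobd a x.
Proof. by rewrite /cobd -sumrN; apply: eq_bigr => i _; rewrite mulNrz. Qed.

Lemma cobdMn n (a : ('I_n.+1 -> G) -> W) k x :
  cobd (fun x' => a x' *+ k) x = cobd a x *+ k.
Proof.
rewrite /cobd -sumrMnl; apply: eq_bigr => i _.
by rewrite [RHS]pmulrn mulrzAC -pmulrn.
Qed.

Lemma cobd_eavg n (a : ('I_n.+1 -> G) -> basis -> W) x y :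
  cobd (fun x' => eavg (a x') y) x = eavg (fun z => cobd (fun x' => a x' z) x) y.
Proof. by rewrite /eavg /ssum !(cobdD, cobdN). Qed.

End Cobd.

(** * Contraction of equivariant cochains, for an action [tw] *)

Section Twist.
Variables (Gam : groupClosed GL2Z) (V : rmod GL2Z).
Variable tw : V -> subG Gam -> V.
Hypothesis twB : forall g, {morph tw^~ g : v w / v - w}.
Hypothesis tw1 : forall v, tw v 1%g = v.
Hypothesis twM : forall v g h, tw (tw v g) h = tw v (g * h)%g.
Let W : rmod (subG Gam) := RMod twB tw1 twM.
Local Notation G := (subG Gam).
Implicit Types (g h : G) (u : basis -> V).

Definition eqvT u : Prop := forall g y, tw (u (sact g y)) g = u y.

Definition equivariant n (f : ('I_n -> G) -> V) : Prop :=
  forall g x, f (fun i => (x i * g)%g) = tw (f x) g.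

Section Averaging.
Variables (m : nat) (f : ('I_m.+2 -> G) -> W).
Hypothesis fE : equivariant f.
Hypothesis fZ : forall x, cobd f x = 0.

(* a contraction, made of the homotopies of [cobd_consx] averaged over the
   twelve bases of a triangle *)
Definition vhom (x : 'I_m.+1 -> G) : basis -> V :=
  vavg (fun z => f (consx (gam Gam z) x) : V).

Lemma vhom_vfun x : vfun (vhom x).
Proof. exact: vavg_vfun. Qed.

(** Translating the basis multiplies [gam] by [g^-1] on the right; translating all the arguments by
    [g] undoes it. *)
Lemma cons_gam_eqv n (e : ('I_n.+1 -> G) -> basis -> V) x g z :
  (forall x g z, tw (e x (sact g z)) g = e (fun i => (x i * g)%g) z) ->
  tw (e (consx (gam Gam (sact g z)) x) (sact g z)) g =
  e (consx (gam Gam z) (fun i => (x i * g)%g)) z.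
Proof. by move=> ->; rewrite consx_mul gam_sact mulgVK. Qed.

Lemma vhom_eqv x g y : tw (vhom x (sact g y)) g = vhom (fun i => (x i * g)%g) y.
Proof.
rewrite /vhom -vavg_sact -(vavg_morph (twB g)); congr (vavg _ y).
apply/funext => z.
exact: (@cons_gam_eqv _ (fun x _ => f x) x g z (fun x g z => esym (fE g x))).
Qed.

Lemma cobd_vhom x y : cobd (fun x' => vhom x' y : W) x = f x *+ 12.
Proof.
rewrite /vhom /vavg /ssum /rsum !cobdD.
have E z : cobd (fun x' => f (consx (gam Gam z) x')) x = f x.
  by apply/eqP; rewrite eq_sym -subr_eq0 -cobd_consx fZ.
by rewrite !E; zmod.
Qed.

End Averaging.

Lemma cobd_edges m (h : ('I_m.+1 -> G) -> basis -> V) (F : ('I_m.+2 -> G) -> V) :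
  (forall x y, cobd (fun x' => h x' y : W) x = F x) ->
  forall x y, cobd (fun x' => h x' y - h x' (neg1 y) : W) x = 0.
Proof. by move=> hF x y; rewrite cobdD cobdN !hF subrr. Qed.

Section Vanishing.
Variables (m : nat) (f : ('I_m.+3 -> G) -> W).
Hypothesis fE : equivariant f.
Hypothesis fZ : forall x, cobd f x = 0.

(** [vhom f] has coboundary 12 [f] at every triangle, so its increments across edges are cocycles
    ([cobd_edges]). Below, [e] contracts them in turn, over the eight bases of an edge. *)
Let e0 (x : 'I_m.+2 -> G) (y : basis) : V := vhom f x y - vhom f x (neg1 y).

Let e (x : 'I_m.+1 -> G) : basis -> V :=
  eavg (fun z => e0 (consx (gam Gam z) x) z).

Let e0_efun x : efun (e0 x).
Proof.
have [s r n] := vhom_vfun f x; split=> y; rewrite /e0.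
- rewrite s neg1_swap s; congr (_ - _).
  by rewrite -neg_neg1 n.
- by rewrite neg1K opprB.
- by rewrite n neg1_neg -neg_neg1 n.
Qed.

Let e0_eqv x g y : tw (e0 x (sact g y)) g = e0 (fun i => (x i * g)%g) y.
Proof. by rewrite /e0 twB sact_neg1 !vhom_eqv. Qed.

Let e_eqv x g y : tw (e x (sact g y)) g = e (fun i => (x i * g)%g) y.
Proof.
rewrite /e -eavg_sact -(eavg_morph (twB g)); congr (eavg _ y).
by apply/funext => z; exact: cons_gam_eqv.
Qed.

Let cobd_e x y : cobd (fun x' => e x' y : W) x = e0 x y *+ 8.
Proof.
have E z : cobd (fun x' => e0 (consx (gam Gam z) x') z : W) x = e0 x z.
  have := cobd_consx (fun x' => e0 x' z : W) (gam Gam z) x.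
  rewrite (@cobd_edges _ (vhom f) (fun x => f x *+ 12))//; last exact: cobd_vhom.
  by move/eqP; rewrite eq_sym subr_eq0 => /eqP.
rewrite -(eavg_id y (e0_efun x)) cobd_eavg; congr (eavg _ y).
by apply/funext => z; exact: E.
Qed.

(* an equivariant choice of primitives, made for the tuples starting with 1 *)
Let P0 (x : 'I_m.+1 -> G) : basis -> V :=
  projT1 (cid2 (primitive_exists (eavg_efun (fun z => e0 (consx (gam Gam z) x) z)))).

Let P (x : 'I_m.+1 -> G) (y : basis) : V :=
  tw (P0 (fun i => (x i * (x ord0)^-1)%g) (sact (x ord0) y)) (x ord0).

Let P_vfun x : vfun (P x).
Proof.
apply: (@vfun_morph Gam _ _ (fun v => tw v (x ord0))).
by rewrite /P0; case: cid2.
Qed.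

Let P_prim x y : P x y - P x (neg1 y) = e x y.
Proof.
rewrite /P -twB -sact_neg1 {1 2}/P0; case: cid2 => /= Q _ ->.
rewrite -/(e _ _) e_eqv; congr (e _ y); apply/funext => i.
by rewrite mulgVK.
Qed.

Let P_eqv x g y : tw (P x (sact g y)) g = P (fun i => (x i * g)%g) y.
Proof.
rewrite /P twM -sactM; congr (tw (P0 _ _) _); apply/funext => i.
by rewrite invgM mulgA mulgK.
Qed.

(** Crossing an edge changes [vhom f x *+ 8] by 8 [e0] and the coboundary of [P] by that of [e],
    which is also 8 [e0]. So the difference does not depend on the triangle: it is an honest
    cochain, with coboundary 8 * 12 [f]. *)
Let k (x : 'I_m.+2 -> G) : W :=
  vhom f x ybase *+ 8 - cobd (fun x' => P x' ybase : W) x.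

Let kE x y : k x = vhom f x y *+ 8 - cobd (fun x' => P x' y : W) x.
Proof.
pose u y := vhom f x y *+ 8 - cobd (fun x' => P x' y : W) x.
apply/esym; rewrite /k -!/(u _); apply: (@vfun_const _ u) => [|{}y].
  have [s r n] := vhom_vfun f x.
  split=> {}y; rewrite /u; [rewrite s|rewrite r|rewrite n];
    congr (_ - _); apply: (congr1 (fun F => @cobd _ W _ F x));
    by apply/funext => x'; have [s' r' n'] := P_vfun x'.
apply/eqP; rewrite -subr_eq0; apply/eqP.
have H : cobd (fun x' => P x' y - P x' (neg1 y) : W) x = e0 x y *+ 8.
  by rewrite -cobd_e; apply: (congr1 (fun F => @cobd _ W _ F x)); apply/funext => x'; exact: P_prim.
move: H; rewrite cobdD cobdN /e0 mulrnBl => H; rewrite /u.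
have /eqP := H; rewrite -subr_eq0 => /eqP {}H.
by rewrite -[RHS]H; zmod.
Qed.

Lemma cocycle_torsion : exists2 c : ('I_m.+2 -> G) -> W,
  equivariant c & forall x, cobd c x = f x *+ 96.
Proof.
exists k => [g x|x].
  (* By [kE] the value may be read at any basis; reading one side at [sact g ybase] absorbs the
     translation by [g]. *)
  rewrite (kE _ ybase) (kE x (sact g ybase)) twB.
  rewrite (zmorphMn (twB g)) vhom_eqv//; congr (_ - _).
  rewrite /cobd (zmorph_sum (twB g)); apply: eq_bigr => i _.
  by rewrite (zmorphMz (twB g)) P_eqv.
rewrite /k cobdD cobdN cobdMn cobd_vhom// -mulrnA.
by rewrite (@cobdK _ W _ (fun x' => P x' ybase)) subr0.
Qed.

End Vanishing.

End Twist.

Lemma subzB (A : zmodType) (Z : zmodClosed A) (x y : subz Z) :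
  val (x - y) = val x - val y.
Proof. exact: raddfB. Qed.

Lemma subzMn (A : zmodType) (Z : zmodClosed A) (x : subz Z) n :
  val (x *+ n) = val x *+ n.
Proof. exact: raddfMn. Qed.

(** * Modular cohomology and group cohomology *)

Section LowDegrees.
Variables (G : groupType) (W : rmod G).

Definition pair2 (T : Type) (a b : T) : 'I_2 -> T := fun i => if i == ord0 then a else b.

Lemma fun_ord1 (T : Type) (x : 'I_1 -> T) : x = fun=> x ord0.
Proof. by apply/funext => i; rewrite (ord1 i). Qed.

Lemma fun_ord2 (T : Type) (x : 'I_2 -> T) : x = pair2 (x ord0) (x ord_max).
Proof.
apply/funext => i; rewrite /pair2; case: eqP => [->//|i0].
by congr x; apply: val_inj; case: i i0 => [[|[|//]] i] //= []; exact: val_inj.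
Qed.

Lemma cobd0E (f : ('I_1 -> G) -> W) (x : 'I_2 -> G) :
  cobd f x = f (fun=> x ord_max) - f (fun=> x ord0).
Proof.
rewrite /cobd !big_ord_recl big_ord0 addr0 /= mulr1z.
rewrite [(-1) ^+ _](_ : _ = -1)// mulrNz mulr1z.
by congr (f _ - f _); apply/funext => i /=; congr x; rewrite (ord1 i); exact: val_inj.
Qed.

Lemma cobd1E (f : ('I_2 -> G) -> W) (x : 'I_3 -> G) (i1 : 'I_3) : val i1 = 1%N ->
  cobd f x = f (pair2 (x i1) (x ord_max)) - f (pair2 (x ord0) (x ord_max))
    + f (pair2 (x ord0) (x i1)).
Proof.
move=> i1E; rewrite /cobd !big_ord_recl big_ord0 addr0 /= mulr1z.
rewrite [(-1) ^+ (bump 0 0)](_ : _ = -1)// [(-1) ^+ _](_ : _ = 1)// mulrNz !mulr1z.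
rewrite addrA; congr (f _ - f _ + f _);
  by rewrite [LHS]fun_ord2; congr pair2 => /=; congr x; apply: val_inj; rewrite /= ?i1E.
Qed.

End LowDegrees.

Section Comparison.
Variables (Gam : groupClosed GL2Z) (V : rmod GL2Z).
Local Notation G := (subG Gam).
Variable tw : V -> G -> V.
Hypothesis twB : forall g, {morph tw^~ g : v w / v - w}.
Hypothesis tw1 : forall v, tw v 1%g = v.
Hypothesis twM : forall v g h, tw (tw v g) h = tw v (g * h)%g.
Hypothesis twE : forall v g, tw v g = racts v g *~ \det (val (val g)).
Definition twmod : rmod G := RMod twB tw1 twM.
Local Notation W := twmod.
Implicit Types (g h : G) (u : basis -> V) (f : basis -> V).
Local Notation lf := (locfin (orb Gam)).
Local Notation eqvT := (eqvT tw).

Lemma twKV v g : tw (tw v g^-1%g) g = v. Proof. by rewrite twM mulVg tw1. Qed.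

(** Since [bdet] of a translate is multiplied by the determinant of the group element, [sgn]
    exchanges equivariance for the action of [V] with equivariance for its twist [tw]. *)
Lemma sgn_sact u g y :
  racts (sgn u (sact g y)) g = tw (u (sact g y)) g *~ bdet y.
Proof.
by rewrite /sgn (zmorphMz (ractsB g)) [bdet (sact _ _)]bdet_bact mulrzA -twE.
Qed.

Lemma eqv_sgn u : eqvT u -> eqv Gam (sgn u).
Proof. by move=> eu g y; rewrite sgn_sact eu. Qed.

Lemma eqvT_sgn f : eqv Gam f -> eqvT (sgn f).
Proof.
move=> ef g y; have := sgn_sact (sgn f) g y; rewrite sgnK ef => e.
by rewrite /(sgn f y) e -mulrzA bdet2 mulr1z.
Qed.

Lemma eqvT_vnrm f : lf f -> eqvT (vnrm Gam f).
Proof.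
move=> lff g y; have e := eqvT_sgn (nrm_eqv lff).
rewrite /vnrm -vavg_sact -(vavg_morph (twB g)); congr (vavg _ y).
by apply/funext => z; exact: e.
Qed.

Lemma eqvT_enrm f : lf f -> eqvT (enrm Gam f).
Proof.
move=> lff g y; have e := eqvT_sgn (nrm_eqv lff).
rewrite /enrm -eavg_sact -(eavg_morph (twB g)); congr (eavg _ y).
by apply/funext => z; exact: e.
Qed.

Lemma eqvT_inv u g y : eqvT u -> u (sact g^-1%g y) = tw (u y) g.
Proof. by move=> eu; rewrite -(eu g^-1%g y) twKV. Qed.

Definition vval (x : VM1 Gam V) : basis -> V := qlift (@vnrm Gam V) x.
Definition edval (x : VM2 Gam V) : basis -> V := qlift (@enrm Gam V) x.

Lemma vval_cls f : lf f -> vval (cls _ _ f) = vnrm Gam f.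
Proof.
move=> lff; apply: qliftE => [x /zclosedP lx /zclosedP rx|x y /zclosedP lx /zclosedP ly|].
- exact: vnrm_rels.
- exact: vnrmB.
- exact/zclosedP.
Qed.

Lemma edval_cls f : lf f -> edval (cls _ _ f) = enrm Gam f.
Proof.
move=> lff; apply: qliftE => [x /zclosedP lx /zclosedP rx|x y /zclosedP lx /zclosedP ly|].
- exact: enrm_rels.
- exact: enrmB.
- exact/zclosedP.
Qed.

Lemma vvalB : {morph vval : x y / x - y}.
Proof.
apply: qliftB => [x /zclosedP lx /zclosedP rx|x y /zclosedP lx /zclosedP ly].
- exact: vnrm_rels.
- exact: vnrmB.
Qed.

Lemma edvalB : {morph edval : x y / x - y}.
Proof.
apply: qliftB => [x /zclosedP lx /zclosedP rx|x y /zclosedP lx /zclosedP ly].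
- exact: enrm_rels.
- exact: enrmB.
Qed.

Lemma VM1_cls (x : VM1 Gam V) : exists2 f, lf f & x = cls _ _ f.
Proof. by have [f /zclosedP lff ->] := cls_surj x; exists f. Qed.
Lemma VM2_cls (x : VM2 Gam V) : exists2 f, lf f & x = cls _ _ f.
Proof. by have [f /zclosedP lff ->] := cls_surj x; exists f. Qed.

Lemma vval_eqv x : eqvT (vval x).
Proof. by have [f lff ->] := VM1_cls x; rewrite vval_cls//; exact: eqvT_vnrm. Qed.
Lemma edval_eqv x : eqvT (edval x).
Proof. by have [f lff ->] := VM2_cls x; rewrite edval_cls//; exact: eqvT_enrm. Qed.
Lemma vval_vfun x : vfun (vval x).
Proof. by have [f lff ->] := VM1_cls x; rewrite vval_cls//; exact: vavg_vfun. Qed.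
Lemma edval_efun x : efun (edval x).
Proof. by have [f lff ->] := VM2_cls x; rewrite edval_cls//; exact: eavg_efun. Qed.

Lemma vval_ker x : vval x = 0 -> x *+ 12 = 0.
Proof.
have [f lff ->] := VM1_cls x; rewrite vval_cls// => /(vnrm_ker lff) r.
have Zf : f \in zclosed (@locfin_subgroup basis _ V (orb Gam)) by exact/zclosedP.
by rewrite -clsMn//; apply/cls_eq0; [rewrite rpredMn|exact/zclosedP].
Qed.

Lemma edval_ker x : edval x = 0 -> x *+ 8 = 0.
Proof.
have [f lff ->] := VM2_cls x; rewrite edval_cls// => /(enrm_ker lff) r.
have Zf : f \in zclosed (@locfin_subgroup basis _ V (orb Gam)) by exact/zclosedP.
by rewrite -clsMn//; apply/cls_eq0; [rewrite rpredMn|exact/zclosedP].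
Qed.

Lemma vval_surj u : vfun u -> eqvT u -> exists x, forall y, vval x y = u y *+ 12.
Proof.
move=> vu eu; have [f lff fE] := vnrm_surj vu (eqv_sgn eu).
by exists (cls _ _ f) => y; rewrite vval_cls.
Qed.

Lemma edval_surj u : efun u -> eqvT u -> exists x, forall y, edval x y = u y *+ 8.
Proof.
move=> vu eu; have [f lff fE] := enrm_surj vu (eqv_sgn eu).
by exists (cls _ _ f) => y; rewrite edval_cls.
Qed.

Lemma edval_dVM x y : edval (dVM x) y = - (vval x y - vval x (neg1 y)).
Proof.
have [f lff ->] := VM1_cls x; rewrite dVM_cls// vval_cls// edval_cls ?enrm_mdiff//.
exact: (locfin_mdiff (@blabel_orb Gam) lff).
Qed.

Definition edge_prim (c : basis -> V) : basis -> V :=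
  if pselect (efun c) is left e then projT1 (cid2 (primitive_exists e)) else 0.

Lemma edge_primP c : efun c -> vfun (edge_prim c) /\ forall y, edge_prim c y - edge_prim c (neg1 y) = c y.
Proof. by move=> ec; rewrite /edge_prim; case: pselect => // e; case: cid2. Qed.

(** Evaluation along the orbit of [ybase]. The inverse converts right multiplication of the argument
    into the right action [tw]. In [a1] only differences occur, so the undetermined constant of the
    primitive disappears. *)
Definition a0 u (x : 'I_1 -> G) : W := u (sact (x ord0)^-1%g ybase).
Definition a1 (c : basis -> V) (x : 'I_2 -> G) : W :=
  edge_prim c (sact (x ord_max)^-1%g ybase) - edge_prim c (sact (x ord0)^-1%g ybase).

Lemma a0_cochain u : eqvT u -> a0 u \in zclosed (@cochains_subgroup G W 0).
Proof.
move=> eu; apply/zclosedP => g x; rewrite /a0 invgM sactM.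
exact: eqvT_inv.
Qed.

(** The translate of the primitive by [g] is another primitive of [c], hence differs from it by a
    constant; only differences are equivariant. *)
Lemma edge_prim_eqv c g y z : efun c -> eqvT c ->
  tw (edge_prim c (sact g y) - edge_prim c (sact g z)) g = edge_prim c y - edge_prim c z.
Proof.
move=> ec eqc; have [vP dP] := edge_primP ec; rewrite twB.
apply: (primitive_unique (P := fun y => tw (edge_prim c (sact g y)) g)) => //.
  exact: (@vfun_morph Gam _ _ (fun v => tw v g)).
by move=> w; rewrite -twB -sact_neg1 !dP eqc.
Qed.

Lemma a1_cochain c : efun c -> eqvT c -> a1 c \in zclosed (@cochains_subgroup G W 1).
Proof.
move=> ec eqc; apply/zclosedP => g x; rewrite /a1 !invgM !sactM.
by rewrite -[LHS](edge_prim_eqv g _ _ ec eqc) !sactKV.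
Qed.

Lemma a1E c P x : efun c -> vfun P -> (forall y, P y - P (neg1 y) = c y) ->
  a1 c x = P (sact (x ord_max)^-1%g ybase) - P (sact (x ord0)^-1%g ybase).
Proof.
move=> ec vP dP; have [vQ dQ] := edge_primP ec.
by apply: primitive_unique => // y; rewrite dP.
Qed.

Definition cmp0 (x : VM1 Gam V) : cochain W 0 := insubd 0 (a0 (vval x)).
Definition cmp1 (x : VM2 Gam V) : cochain W 1 := insubd 0 (a1 (edval x)).

Lemma val_cmp0 x : val (cmp0 x) = a0 (vval x).
Proof. by rewrite val_insubd a0_cochain//; exact: vval_eqv. Qed.
Lemma val_cmp1 x : val (cmp1 x) = a1 (edval x).
Proof.
by rewrite val_insubd a1_cochain//; [exact: edval_efun|exact: edval_eqv].
Qed.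

Lemma cmp0B : {morph cmp0 : x y / x - y}.
Proof.
move=> x y; apply: val_inj; rewrite subzB !val_cmp0.
by apply/funext => z; rewrite fsubE /a0 vvalB fsubE.
Qed.

Lemma cmp1B : {morph cmp1 : x y / x - y}.
Proof.
move=> x y; apply: val_inj; rewrite subzB !val_cmp1.
have [vx dx] := edge_primP (edval_efun x); have [vy dy] := edge_primP (edval_efun y).
apply/funext => z; rewrite fsubE (@a1E _ (edge_prim (edval x) - edge_prim (edval y))).
- by rewrite /a1 !fsubE; zmod.
- exact: edval_efun.
- exact: vfunB.
- by move=> w; rewrite edvalB !fsubE -dx -dy; zmod.
Qed.

Local Notation C := (VMcomplex Gam V).
Local Notation D := (cochain_complex W).

Lemma cochainP n (z : cochain W n) : equivariant tw (val z).
Proof. exact: ((zclosedP (@cochains_subgroup G W n) (val z)).1 (subz_valP z)). Qed.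

Lemma vval_const x y : dVM x = 0 -> vval x y = vval x ybase.
Proof.
move=> dx; apply: (vfun_const (vval_vfun x)) => {}y.
have := edval_dVM x y; rewrite dx (zmorph0 edvalB) => /esym/eqP.
by rewrite oppr_eq0 subr_eq0 => /eqP.
Qed.

Lemma cmp0_cocycle x : dVM x = 0 -> @cocycles D 0 (cmp0 x).
Proof.
move=> dx; apply: val_inj; apply/funext => z /=; rewrite cobd0E val_cmp0 /a0.
by rewrite !(vval_const _ dx) subrr.
Qed.

Lemma cmp0_coker (z : cochain W 0) : cochain_diff z = 0 ->
  exists2 x, dVM x = 0 & cmp0 x = z *+ 96.
Proof.
move=> /(congr1 val) zc; pose v : V := val z (fun=> 1%g).
have zv x : val z x = v.
  have := congr1 (fun F => F (pair2 1%g (x ord0))) zc.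
  rewrite /= cobd0E /pair2 /= => /eqP; rewrite subr_eq0 => /eqP e.
  by rewrite (fun_ord1 x).
have ev : eqvT (fun=> v) by move=> g y; rewrite -{1}(zv (fun=> 1%g)) -cochainP zv.
have [x xE] := @vval_surj (fun=> v) (And3 (fun=> erefl) (fun=> erefl) (fun=> erefl)) ev.
(* [vval x] is the constant 12 v. The further factor 8 makes [dVM] vanish: [dVM x] has zero value on
   the edges, and [edval_ker] then gives only that 8 kills it. *)
exists (x *+ 8).
  rewrite raddfMn; apply: edval_ker; apply/funext => y.
  by rewrite edval_dVM !xE subrr oppr0.
apply: val_inj; rewrite val_cmp0 subzMn; apply/funext => w.
by rewrite /a0 (zmorphMn vvalB) !fmulrn xE zv -mulrnA.
Qed.

Lemma cmp0_ker x : dVM x = 0 -> cmp0 x = 0 -> x *+ 96 = 0.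
Proof.
move=> dx /(congr1 val); rewrite val_cmp0 => e.
rewrite (mulrnA _ 12 8) vval_ker ?mul0rn//; apply/funext => y.
rewrite (vval_const _ dx).
by have := congr1 (fun F => F (fun=> 1%g)) e; rewrite /a0 invg1 sact1.
Qed.

Lemma cmp1_cocycle x : @cocycles D 1 (cmp1 x).
Proof.
have i1 : val (inord 1 : 'I_3) = 1%N by rewrite /= inordK.
apply: val_inj; apply/funext => z.
rewrite [LHS](_ : _ = cobd (val (cmp1 x)) z)// val_cmp1 (cobd1E _ _ i1) /a1 /pair2 /=.
by rewrite [RHS](_ : _ = 0 :> V)//; zmod.
Qed.

Lemma cmp1_dVM (x : VM1 Gam V) : exists w : cochain W 0, cmp1 (dVM x) = cochain_diff w.
Proof.
have nE t : val (- cmp0 x) t = - vval x (sact (t ord0)^-1%g ybase).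
  by rewrite -[- cmp0 x]sub0r subzB fsubE val_cmp0 sub0r.
(* The sign is that of [edval_dVM]. *)
exists (- cmp0 x); apply: val_inj; rewrite val_cmp1; apply/funext => z.
rewrite [RHS](_ : _ = cobd (val (- cmp0 x)) z)// cobd0E !nE.
rewrite (@a1E _ (fun y => - vval x y)) //.
- exact: edval_efun.
- by have [s r n] := vval_vfun x; split=> y; rewrite ?s ?r ?n.
- by move=> y; rewrite edval_dVM; zmod.
Qed.

Lemma cmp1_ker (x : VM2 Gam V) (k : cochain W 0) : cmp1 x = cochain_diff k ->
  exists w : VM1 Gam V, dVM w = x *+ 96.
Proof.
move=> /(congr1 val); rewrite val_cmp1 => e.
set c := edval x in e; pose P := edge_prim c; have [vP dP] := edge_primP (edval_efun x).
have eqc := edval_eqv x.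
pose kv (g : G) : V := val k (fun=> g).
have ke (a b : G) : P (sact b^-1%g ybase) - P (sact a^-1%g ybase) = kv b - kv a.
  by have := congr1 (fun F => F (pair2 a b)) e; rewrite /= cobd0E.
(* The constant of the primitive is fixed so that [u] takes the values of [k] along the orbit of
   [ybase], which makes it equivariant. *)
pose u y := kv 1%g + P y - P ybase.
have vu : vfun u.
  by have [s r n] := vP; split=> y; rewrite /u /P; [rewrite s|rewrite r|rewrite n].
have eu : eqvT u.
  move=> g y; rewrite /u -addrA (zmorphD (twB g)).
  rewrite -{1}[ybase](sactKV g) (edge_prim_eqv g _ _ (edval_efun x) eqc).
  have -> : tw (kv 1%g) g = kv g.
    rewrite /kv -cochainP; congr (\val k _); apply/funext => _; exact: mul1g.
  have := ke 1%g g; rewrite invg1 sact1 => {}ke.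
  have -> : kv g = kv 1%g + (P (sact g^-1%g ybase) - P ybase) by rewrite ke addrC subrK.
  by rewrite -/P; zmod.
have [w wE] := vval_surj vu eu.
(* [dVM w] has value -12 [c] on the edges, so [dVM w + x *+ 12] has value zero and is killed by
   8. *)
exists (- w *+ 8); rewrite raddfMn raddfN /=.
apply/eqP; rewrite -subr_eq0 (_ : _ - _ = - (dVM w + x *+ 12) *+ 8); last first.
  by zmod.
rewrite mulNrn oppr_eq0; apply/eqP/edval_ker; apply/funext => y.
rewrite (zmorphD edvalB) (zmorphMn edvalB).
rewrite [LHS](_ : _ = edval (dVM w) y + (c *+ 12) y)// fmulrn edval_dVM !wE.
rewrite -[c y](dP y) /u -/P [RHS](_ : _ = 0 :> V)//; zmod.
Qed.

Lemma cmp1_coker (z : cochain W 1) : cochain_diff z = 0 ->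
  exists x : VM2 Gam V, exists w : cochain W 0, cmp1 x - z *+ 96 = cochain_diff w.
Proof.
pose o : G := 1%g.
move=> /(congr1 val) zc; pose f := val z.
have fZ t : cobd f t = 0 by have := congr1 (fun F => F t) zc.
have fE : equivariant tw f := cochainP z.
pose h (g : G) := vhom (V := V) f (fun _ : 'I_1 => g).
have hv g : vfun (h g) by exact: vhom_vfun.
have he g a y : tw (h a (sact g y)) g = h (a * g)%g y by exact: vhom_eqv.
have hd a b y : h b y - h a y = f (pair2 a b) *+ 12.
  by rewrite -(cobd_vhom fZ (pair2 a b) y) cobd0E.
(* [h o] is not equivariant, but by [hd] a change of [o] adds a constant, so its increments are. The
   minus sign yields 96 times the class of [z] rather than its opposite. *)
pose c y := - (h o y - h o (neg1 y)).
have cE a y : c y = - (h a y - h a (neg1 y)).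
  have := hd o a y; rewrite -(hd o a (neg1 y)) => /eqP; rewrite -subr_eq0 => /eqP e.
  by apply/eqP; rewrite -subr_eq0 -e /c; apply/eqP; zmod.
have ec : efun c.
  have [s r n] := hv o; split=> y; rewrite /c.
  - by rewrite s neg1_swap s -neg_neg1 n.
  - by rewrite neg1K; zmod.
  - by rewrite n neg1_neg -neg_neg1 n.
have eqc : eqvT c.
  move=> g y; rewrite {1}/c (zmorphN (twB g)) twB sact_neg1 !he.
  by rewrite (mul1g g) -cE.
have [x xE] := edval_surj ec eqc.
(* Replacing [h o] by [h (t ord0)] at the point of [t] accounts for the term 96 [z], by [hd]. In [H]
   the index and the point move together, whence its equivariance. *)
pose H (t : 'I_1 -> G) : W := - (h (t ord0) (sact (t ord0)^-1%g ybase) *+ 8).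
have HC : H \in zclosed (@cochains_subgroup G W 0).
  apply/zclosedP => g t; rewrite /H [RHS](zmorphN (twB g)) (zmorphMn (twB g)).
  by rewrite -he invgM sactM sactKV.
exists x, (Subz HC); apply: val_inj; rewrite subzB subzMn val_cmp1.
apply/funext => t; rewrite fsubE fmulrn /= cobd0E /H /=.
rewrite (@a1E _ (fun y => - (h o y *+ 8))).
- rewrite [t in \val z t]fun_ord2 -/f.
  set a := t ord0; set b := t ord_max.
  have e3 : f (pair2 a b) = f (pair2 o b) - f (pair2 o a).
    pose q : 'I_3 -> G := fun i => if i == ord0 then o else if i == ord_max then b else a.
    have i1 : val (inord 1 : 'I_3) = 1%N by rewrite /= inordK.
    have := fZ q; rewrite (cobd1E _ _ i1) /q -!val_eqE i1 /= => e.
     apply/eqP; rewrite -subr_eq0 -e; apply/eqP; zmod.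
  have key y y' : - (h o y' *+ 8) - - (h o y *+ 8) - f (pair2 a b) *+ 96 =
      - (h b y' *+ 8) - - (h a y *+ 8).
    rewrite e3 mulrnBl (mulrnA _ 12 8) -(hd _ _ y') (mulrnA _ 12 8) -(hd _ _ y).
    by zmod.
  exact: key.
- exact: edval_efun.
- by have [s r n] := hv o; split=> y; rewrite ?s ?r ?n.
- by move=> y; rewrite xE /c; zmod.
Qed.

(* in degrees at least two both sides vanish rationally *)
Definition HM_to_H (n : nat) : HM Gam V n.+1 -> Hgrp G W n :=
  match n with
  | 0 => qmap cmp0
  | 1 => qmap cmp1
  | _ => fun=> 0
  end.

Definition chain_hyps (A A' : zmodType) (Z B : zmodClosed A) (Z' B' : zmodClosed A')
    (F : A -> A') :=
  [/\ forall x, x \in Z -> F x \in Z', forall x, x \in Z -> x \in B -> F x \in B' &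
      {in Z &, {morph F : x y / x - y}}].

Lemma cmp0_hyps : chain_hyps (zclosed (cocycles_subgroup C 1))
  (zclosed (coboundaries_subgroup C 1)) (zclosed (cocycles_subgroup D 0))
  (zclosed (coboundaries_subgroup D 0)) cmp0.
Proof.
split=> [x /zclosedP zx|x _ /zclosedP [w _ <-]|x y _ _].
- by apply/zclosedP; exact: cmp0_cocycle.
- apply/zclosedP; rewrite /coboundaries /=.
  exact: (zmorph0 cmp0B).
- exact: cmp0B.
Qed.

Lemma cmp1_hyps : chain_hyps (zclosed (cocycles_subgroup C 2))
  (zclosed (coboundaries_subgroup C 2)) (zclosed (cocycles_subgroup D 1))
  (zclosed (coboundaries_subgroup D 1)) cmp1.
Proof.
split=> [x _|x _ /zclosedP [w _ <-]|x y _ _].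
- by apply/zclosedP; exact: cmp1_cocycle.
- apply/zclosedP; have [v vE] := cmp1_dVM w.
  by exists v.
- exact: cmp1B.
Qed.

Lemma HM_to_H_additive n : {morph @HM_to_H n : p q / p - q}.
Proof.
case: n => [|[|n]] p q.
- by have [h1 h2 h3] := cmp0_hyps; exact: qmap_additive.
- by have [h1 h2 h3] := cmp1_hyps; exact: qmap_additive.
- by rewrite /= subr0.
Qed.

Lemma HM_to_H_ker n q : HM_to_H q = 0 :> Hgrp G W n -> q *+ 96 = 0.
Proof.
case: n q => [|[|n]] q.
- have [h1 h2 h3] := cmp0_hyps; apply: (qmap_ker h1 h2 h3).
  move=> x /zclosedP zx /zclosedP fx; apply/zclosedP; exists 0 => //=.
  by rewrite (@cmp0_ker x).
- have [h1 h2 h3] := cmp1_hyps; apply: (qmap_ker h1 h2 h3).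
  move=> x _ /zclosedP [k _ kE]; apply/zclosedP.
  have [w wE] := cmp1_ker (esym kE).
  by exists w.
(* In these degrees the modular complex is the group of empty row vectors. *)
- move=> _; have [x Zx ->] := cls_surj q.
  rewrite (_ : x = 0); first by rewrite cls0 mul0rn.
  by apply/matrixP => i [].
Qed.

Lemma HM_to_H_coker n p : exists q, @HM_to_H n q = p *+ 96.
Proof.
case: n p => [|[|n]] p.
- have [h1 h2 h3] := cmp0_hyps; apply: (qmap_coker h1 h2 h3) => z /zclosedP zz.
  have [x dx xE] := cmp0_coker zz; exists x; first exact/zclosedP.
  by rewrite xE subrr rpred0.
- have [h1 h2 h3] := cmp1_hyps; apply: (qmap_coker h1 h2 h3) => z /zclosedP zz.
  have [x [w xE]] := cmp1_coker zz; exists x; first exact/zclosedP.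
  by apply/zclosedP; exists w; rewrite // xE.
- exists 0; have [z /zclosedP zz ->] := cls_surj p.
  rewrite -clsMn; last exact/zclosedP.
  apply/esym/cls_eq0; first by rewrite rpredMn//; exact/zclosedP.
  have fZ x : cobd (val (z : cochain W n.+2)) x = 0.
    by have := congr1 (fun F => val F x) zz.
  have [c cE cf] := @cocycle_torsion _ _ _ twB tw1 twM _ _ (cochainP z) fZ.
  have cC : c \in zclosed (@cochains_subgroup G W n.+1) by exact/zclosedP.
  apply/zclosedP; exists (Subz cC) => //=; apply: val_inj; rewrite subzMn.
  by apply/funext => x; rewrite fmulrn -cf.
Qed.

End Comparison.

(** * Naturality in the coefficients *)

Section Naturality.
Variables (Gam : groupClosed GL2Z) (V V' : rmod GL2Z) (f : V -> V').
Local Notation G := (subG Gam).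
Local Notation lf := (locfin (orb Gam)).
Hypothesis fhom : rmod_hom f.
Variables (tw : V -> G -> V) (tw' : V' -> G -> V').
Hypothesis twB : forall g, {morph tw^~ g : v w / v - w}.
Hypothesis tw1 : forall v, tw v 1%g = v.
Hypothesis twM : forall v g h, tw (tw v g) h = tw v (g * h)%g.
Hypothesis twE : forall v g, tw v g = racts v g *~ \det (val (val g)).
Hypothesis twB' : forall g, {morph tw'^~ g : v w / v - w}.
Hypothesis tw1' : forall v, tw' v 1%g = v.
Hypothesis twM' : forall v g h, tw' (tw' v g) h = tw' v (g * h)%g.
Hypothesis twE' : forall v g, tw' v g = racts v g *~ \det (val (val g)).
Local Notation W := (twmod twB tw1 twM).
Local Notation W' := (twmod twB' tw1' twM').

Let fB : {morph f : v w / v - w} := fhom.1.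

Lemma f_tw v g : f (tw v g) = tw' (f v) g.
Proof. by rewrite twE twE' (zmorphMz fB); congr (_ *~ _); exact: fhom.2. Qed.

Lemma locfin_hom c : lf c -> lf (f \o c).
Proof.
move=> lc i; apply: sub_finite_set (lc i) => y /= [yi fy]; split=> // c0.
by apply: fy; rewrite c0 (zmorph0 fB).
Qed.

Lemma nrm_hom c : lf c -> nrm Gam (f \o c) = f \o nrm Gam c.
Proof.
move=> lc; apply/funext => y /=; have [s [us cs]] := locfin_orb y lc.
rewrite (nrmE us cs) (nrmE us) => [|g /= fg]; last first.
  by apply: cs => c0; apply: fg; rewrite c0 (zmorph0 fB).
rewrite (zmorph_sum fB); apply: eq_bigr => g _; apply/esym; exact: fhom.2.
Qed.

Lemma sgn_hom u : sgn (f \o u) = f \o sgn u.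
Proof. by apply/funext => y; rewrite /sgn /= (zmorphMz fB). Qed.

Lemma vnrm_hom c : lf c -> vnrm Gam (f \o c) = f \o vnrm Gam c.
Proof.
by move=> lc; rewrite /vnrm nrm_hom// sgn_hom; apply/funext => y; exact: vavg_morph.
Qed.

Lemma enrm_hom c : lf c -> enrm Gam (f \o c) = f \o enrm Gam c.
Proof.
by move=> lc; rewrite /enrm nrm_hom// sgn_hom; apply/funext => y; exact: eavg_morph.
Qed.

(** The relations of a coinvariant are the kernel of the norm, with which [f] commutes. *)
Lemma coinv_hom c : lf c -> coinv_rels Gam c -> coinv_rels Gam (f \o c).
Proof.
move=> lc cc; apply: nrm_ker; first exact: locfin_hom.
by rewrite nrm_hom// coinv_nrm//; apply/funext => y; exact: (zmorph0 fB).
Qed.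

Lemma comp_homD (u v : basis -> V) : f \o (u + v) = (f \o u) + (f \o v).
Proof. by apply/funext => y; exact: (zmorphD fB). Qed.
Lemma comp_homB (u v : basis -> V) : f \o (u - v) = (f \o u) - (f \o v).
Proof. by apply/funext => y; exact: fB. Qed.

Lemma DS_hom r : double_shuffles (orb Gam) r -> double_shuffles (orb Gam) (f \o r).
Proof.
move=> [a [b [la lb ->]]]; exists (f \o a), (f \o b).
split; [exact: locfin_hom|exact: locfin_hom|].
by rewrite !(push_beq _ beq_swap) !(push_beq _ beq_shl) !(push_beq _ beq_shr) !comp_homD.
Qed.

Lemma WR_hom r : wedge_rels (orb Gam) r -> wedge_rels (orb Gam) (f \o r).
Proof.
move=> [a [b [c [la lb lc ->]]]]; exists (f \o a), (f \o b), (f \o c).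
split; [exact: locfin_hom|exact: locfin_hom|exact: locfin_hom|].
rewrite !(push_beq _ beq_swap) !(push_beq _ beq_neg1) !(push_beq _ beq_neg2).
by rewrite comp_homD (comp_homD (a - _)) (comp_homB a) (comp_homB b) (comp_homD c).
Qed.

Let map_hyps (D : set (basis -> V)) (D' : set (basis -> V'))
    (sD : subgroup D) (sD' : subgroup D') :
  (forall r, D r -> lf r) -> (forall r, D r -> D' (f \o r)) ->
  chain_hyps (zclosed (@locfin_subgroup basis _ V (orb Gam)))
    (zclosed (setadd_subgroup sD (@coinv_rels_subgroup Gam V)))
    (zclosed (@locfin_subgroup basis _ V' (orb Gam)))
    (zclosed (setadd_subgroup sD' (@coinv_rels_subgroup Gam V')))
    (fun c : basis -> V => f \o c).
Proof.
move=> Dl Df; split=> [c /zclosedP lc|c /zclosedP lc /zclosedP [a da [b cb e]]|c d _ _].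
- by apply/zclosedP; exact: locfin_hom.
- apply/zclosedP; exists (f \o a); first exact: Df.
  have lb : lf b by rewrite (_ : b = c - a); [exact: locfinB lc (Dl _ da)|
    rewrite -e addrC addKr].
  by exists (f \o b); [exact: coinv_hom|rewrite -comp_homD e].
- exact: comp_homB.
Qed.

Let map1_hyps := map_hyps (double_shuffles_subgroup (orb Gam) V)
  (double_shuffles_subgroup (orb Gam) V') (@DS_locfin Gam V) DS_hom.
Let map2_hyps := map_hyps (wedge_rels_subgroup (orb Gam) V)
  (wedge_rels_subgroup (orb Gam) V') (@WR_locfin Gam V) WR_hom.

Local Notation m1 := (@VM_map Gam V V' f 1).
Local Notation m2 := (@VM_map Gam V V' f 2).

Lemma map1_cls c : lf c -> m1 (cls _ _ c) = cls _ _ (f \o c).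
Proof.
by move=> lc; have [h1 h2 h3] := map1_hyps; apply: (qmapE h1 h2 h3); exact/zclosedP.
Qed.
Lemma map2_cls c : lf c -> m2 (cls _ _ c) = cls _ _ (f \o c).
Proof.
by move=> lc; have [h1 h2 h3] := map2_hyps; apply: (qmapE h1 h2 h3); exact/zclosedP.
Qed.

Lemma VM_mapB i : {morph @VM_map Gam V V' f i : x y / x - y}.
Proof.
case: i => [|[|[|i]]] //.
- by have [h1 h2 h3] := map1_hyps; exact: qmap_additive.
- by have [h1 h2 h3] := map2_hyps; exact: qmap_additive.
Qed.

Lemma mdiff_hom c : mdiff (f \o c) = f \o mdiff c.
Proof.
apply/funext => y; rewrite !mdiffE !fctE /=.
by rewrite (zmorphN fB) !(zmorphD fB).
Qed.

Lemma VM_map_diff i x :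
  VMdiff Gam V' i (@VM_map Gam V V' f i x) = @VM_map Gam V V' f i.+1 (VMdiff Gam V i x).
Proof.
case: i x => [|[|i]] x /=.
- by rewrite -[RHS]/(m1 0) (zmorph0 (@VM_mapB 1)).
- rewrite -[LHS]/(dVM (m1 x)) -[RHS]/(m2 (dVM x)); have [c lc ->] := VM1_cls x; rewrite map1_cls// !dVM_cls ?map2_cls ?mdiff_hom//.
    exact: (locfin_mdiff (@blabel_orb Gam) lc).
  exact: locfin_hom.
- by case: i x => [|i] x //=; rewrite (zmorph0 (@VM_mapB _)).
Qed.

Lemma vval_map x : vval (m1 x) = f \o vval x.
Proof.
have [c lc ->] := VM1_cls x; rewrite map1_cls// !vval_cls ?vnrm_hom//.
exact: locfin_hom.
Qed.
Lemma edval_map x : edval (m2 x) = f \o edval x.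
Proof.
have [c lc ->] := VM2_cls x; rewrite map2_cls// !edval_cls ?enrm_hom//.
exact: locfin_hom.
Qed.

Lemma val_cochain_map n (c : cochain W n) x :
  val (@cochain_map G W W' f n c) x = f (val c x).
Proof.
rewrite /cochain_map val_insubd ifT//; apply/zclosedP => g y.
by rewrite cochainP; exact: f_tw.
Qed.

Lemma cmp0_map x : cmp0 twB' tw1' twM' (m1 x) = @cochain_map G W W' f 0 (cmp0 twB tw1 twM x).
Proof.
apply: val_inj; apply/funext => y.
by rewrite val_cochain_map !val_cmp0// /a0 vval_map.
Qed.

Lemma cmp1_map x : cmp1 twB' tw1' twM' (m2 x) = @cochain_map G W W' f 1 (cmp1 twB tw1 twM x).
Proof.
apply: val_inj; apply/funext => y.
rewrite val_cochain_map !val_cmp1//.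
have [[s r n] dP] := edge_primP (edval_efun x).
rewrite (@a1E Gam V' tw' twB' tw1' twM' _ (f \o edge_prim (edval x))) /=.
- by rewrite /a1 fB.
- exact: edval_efun.
- by split=> z /=; [rewrite s|rewrite r|rewrite n].
- by move=> z; rewrite -fB dP edval_map.
Qed.

Lemma cochain_mapB n : {morph @cochain_map G W W' f n : c d / c - d}.
Proof.
move=> c d; apply: val_inj; apply/funext => x.
by rewrite subzB fsubE !val_cochain_map -fB subzB.
Qed.

Lemma cochain_map_diff n (c : cochain W n) :
  cochain_diff (@cochain_map G W W' f n c) = @cochain_map G W W' f n.+1 (cochain_diff c).
Proof.
apply: val_inj; apply/funext => x; rewrite val_cochain_map /= /cobd.
rewrite (zmorph_sum fB); apply: eq_bigr => i _.
by rewrite (zmorphMz fB) -val_cochain_map.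
Qed.

Lemma cohom_hyps (K K' : complex) (F : forall n, K n -> K' n) :
  (forall n, {morph F n : x y / x - y}) ->
  (forall n x, cdiff K' n (F n x) = F n.+1 (cdiff K n x)) ->
  forall n, chain_hyps (zclosed (cocycles_subgroup K n))
    (zclosed (coboundaries_subgroup K n)) (zclosed (cocycles_subgroup K' n))
    (zclosed (coboundaries_subgroup K' n)) (F n).
Proof.
move=> FB Fd n; split=> [x /zclosedP zx|x _ /zclosedP bx|x y _ _]; last exact: FB.
  by apply/zclosedP; rewrite /cocycles /= Fd zx (zmorph0 (FB _)).
apply/zclosedP; case: n x bx => [|n] x /=; first by move=> ->; exact: (zmorph0 (FB _)).
by move=> [y _ <-]; exists (F n y); rewrite ?Fd.
Qed.

Let HM_hyps := @cohom_hyps (VMcomplex Gam V) (VMcomplex Gam V') (@VM_map Gam V V' f)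
  VM_mapB VM_map_diff.
Let Hgrp_hyps := @cohom_hyps (cochain_complex W) (cochain_complex W')
  (@cochain_map G W W' f) cochain_mapB cochain_map_diff.

Lemma HM_mapB n : {morph @HM_map Gam V V' f n : p q / p - q}.
Proof. by have [h1 h2 h3] := HM_hyps n; exact: qmap_additive. Qed.

Lemma Hgrp_mapB n : {morph @Hgrp_map G W W' f n : p q / p - q}.
Proof. by have [h1 h2 h3] := Hgrp_hyps n; exact: qmap_additive. Qed.

Lemma HM_to_H_natural n q : HM_to_H twB' tw1' twM' (HM_map Gam f n.+1 q) =
  @Hgrp_map G W W' f n (HM_to_H twB tw1 twM q).
Proof.
case: n q => [|[|n]] q.
- have [x Zx ->] := cls_surj q.
  have [h1 h2 h3] := HM_hyps 1; have [k1 k2 k3] := Hgrp_hyps 0.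
  have [p1 p2 p3] := cmp0_hyps twB tw1 twM twE.
  have [q1 q2 q3] := cmp0_hyps twB' tw1' twM' twE'.
  rewrite /HM_to_H /HM_map /cohom_map (qmapE h1 h2 h3)// (qmapE q1 q2 q3) ?h1//.
  by rewrite (qmapE p1 p2 p3)// /Hgrp_map /cohom_map (qmapE k1 k2 k3) ?p1// cmp0_map.
- have [x Zx ->] := cls_surj q.
  have [h1 h2 h3] := HM_hyps 2; have [k1 k2 k3] := Hgrp_hyps 1.
  have [p1 p2 p3] := cmp1_hyps twB tw1 twM twE.
  have [q1 q2 q3] := cmp1_hyps twB' tw1' twM' twE'.
  rewrite /HM_to_H /HM_map /cohom_map (qmapE h1 h2 h3)// (qmapE q1 q2 q3) ?h1//.
  by rewrite (qmapE p1 p2 p3)// /Hgrp_map /cohom_map (qmapE k1 k2 k3) ?p1// cmp1_map.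
- by rewrite /= (zmorph0 (@Hgrp_mapB _)).
Qed.

End Naturality.

(** The action [tw] is only required to agree pointwise with the twist by the determinant. This
    covers the twisted module, and also the untwisted one when the determinant is 1 on [Gam]. *)
Lemma modular_cohomology (Gam : groupClosed GL2Z) (n : nat)
  (tw : forall V : rmod GL2Z, V -> subG Gam -> V)
  (twB : forall V g, {morph (tw V)^~ g : v w / v - w})
  (tw1 : forall V v, tw V v 1%g = v)
  (twM : forall V v g h, tw V (tw V v g) h = tw V v (g * h)%g) :
  (forall V v g, tw V v g = racts v g *~ \det (val (val g))) ->
  exists theta : forall V : rmod GL2Z,
    {additive tens (HM Gam V n.+1) rat ->
       tens (Hgrp (subG Gam) (RMod (twB V) (tw1 V) (twM V)) n) rat},
    (forall V, bijective (theta V)) /\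
    (forall (V W : rmod GL2Z) (f : V -> W), rmod_hom f -> forall x,
       theta W (tens_map (HM_map Gam f n.+1) x) =
       tens_map (Hgrp_map (RMod (twB V) (tw1 V) (twM V))
                          (RMod (twB W) (tw1 W) (twM W)) f n) (theta V x)).
Proof.
move=> twE.
pose ph V := @HM_to_H Gam V (tw V) (twB V) (tw1 V) (twM V) n.
have phB V : {morph ph V : p q / p - q} by exact: HM_to_H_additive.
pose th V : {additive _ -> _} := HB.pack (tens_map (B := rat) (ph V))
  (GRing.isZmodMorphism.Build _ _ (tens_map (B := rat) (ph V))
    (tens_map_additive (B := rat) (phB V))).
exists th; split=> [V|V W f fh x].
  apply: (@tens_map_bij _ _ _ 96) => //; [exact: HM_to_H_ker|exact: HM_to_H_coker].
have h1 := @HM_mapB Gam V W f fh n.+1.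
have h2 := @Hgrp_mapB Gam V W f fh _ _ (twB V) (tw1 V) (twM V) (twE V)
  (twB W) (tw1 W) (twM W) (twE W) n.
rewrite /= !tens_map_comp//.
congr (tens_map _ x); apply/funext => q /=; exact: HM_to_H_natural.
Qed.

(** * Voronoi cells *)

Lemma lformZ (R : realType) (u : {linear 'M[R]_2 -> R^o}) (t : R) q :
  u (t *: q) = t * u q.
Proof. exact: linearZ. Qed.

(** * Convex hulls and their faces *)

Section ConvexHull.
Variable R : realType.
Implicit Types (X : set 'M[R]_2) (q : 'M[R]_2) (u : {linear 'M[R]_2 -> R^o}).

Lemma hull_incl X q : X q -> convex_hull X q.
Proof.
move=> Xq; exists 1%N, (fun=> 1), (fun=> q).
by rewrite !big_ord1 scale1r; split.
Qed.

Lemma hull_ge X u (c : R) : (forall q, X q -> c <= u q) ->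
  forall q, convex_hull X q -> c <= u q.
Proof.
move=> Xc _ [n [t [x [t0 t1 Xx ->]]]]; rewrite linear_sum.
rewrite -[c]mul1r -t1 mulr_suml; apply: ler_sum => i _.
by rewrite linearZ; apply: ler_wpM2l => //; exact: Xc.
Qed.

Lemma hull_le X u (c : R) : (forall q, X q -> u q <= c) ->
  forall q, convex_hull X q -> u q <= c.
Proof.
move=> Xc _ [n [t [x [t0 t1 Xx ->]]]]; rewrite linear_sum.
rewrite -[c]mul1r -t1 mulr_suml; apply: ler_sum => i _.
by rewrite linearZ; apply: ler_wpM2l => //; exact: Xc.
Qed.

Lemma hull_sub X Y : X `<=` Y -> convex_hull X `<=` convex_hull Y.
Proof.
move=> XY _ [n [t [x [t0 t1 Xx ->]]]]; exists n, t, x; split=> // i.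
exact: XY.
Qed.

Lemma hull_face X u (c : R) : (forall q, X q -> c <= u q) ->
  [set q | convex_hull X q /\ u q = c] = convex_hull [set q | X q /\ u q = c].
Proof.
move=> Xc; apply/seteqP; split=> q /=; last first.
  move=> h; split; first by apply: hull_sub h => x [].
  have h1 : c <= u q by apply: hull_ge h => x [_ ->].
  have h2 : u q <= c by apply: hull_le h => x [_ ->].
  by apply/eqP; rewrite eq_le h1 h2.
move=> [[n [t [x [t0 t1 Xx ->]]]] uq].
have tu i : t i * (u (x i) - c) = 0.
  have S0 : \sum_i t i * (u (x i) - c) = 0.
    rewrite -[RHS](subrr c) -{2}uq linear_sum -[c in RHS]mul1r -t1 mulr_suml -sumrB.
    by apply: eq_bigr => j _; rewrite linearZ mulrBr.
  have p j : true -> 0 <= t j * (u (x j) - c).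
    by move=> _; rewrite mulr_ge0// subr_ge0 Xc.
  by apply: (psumr_eq0P p S0).
have [i0 ti0] : exists i, 0 < t i.
  apply: contrapT => nt; suff : \sum_i t i = 0 by rewrite t1 => /eqP; rewrite oner_eq0.
  apply: big1 => i _; apply/eqP; rewrite eq_le t0 andbT leNgt; apply/negP => ti.
  by apply: nt; exists i.
have good i : 0 < t i -> u (x i) = c.
  move=> ti; have /eqP := tu i; rewrite mulf_eq0 gt_eqF//= subr_eq0.
  by move/eqP.
(* In a combination that attains the minimum, the points of positive weight attain it. Those of
   weight zero may lie off the hyperplane and are replaced by [x i0]. *)
exists n, t, (fun i => if 0 < t i then x i else x i0); split=> //.
  by move=> i; case: ifP => ti; split=> //; exact: good.
apply: eq_bigr => i _; case: ifP => // ti.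
have -> : t i = 0 by apply/eqP; rewrite eq_le t0 andbT leNgt ti.
by rewrite !scale0r.
Qed.

End ConvexHull.

Section FiniteHull.
Variables (R : realType) (m : nat) (p : 'I_m -> 'M[R]_2).

Lemma finite_hullP q : convex_hull [set p i | i in [set: 'I_m]] q <->
  exists s : 'I_m -> R, [/\ forall i, 0 <= s i, \sum_i s i = 1 & q = \sum_i s i *: p i].
Proof.
split=> [[n [t [x [t0 t1 Xx ->]]]]|[s [s0 s1 ->]]]; last first.
  by exists m, s, p; split=> // i; exists i.
have [k kE] : exists k : 'I_n -> 'I_m, forall j, p (k j) = x j.
  have H j : exists i, p i = x j by have [i _ <-] := Xx j; exists i.
  by exists (fun j => projT1 (cid (H j))) => j; exact: projT2 (cid (H j)).
exists (fun i => \sum_(j | k j == i) t j); split.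
- by move=> i; apply: sumr_ge0.
- by rewrite -t1 (partition_big k xpredT)//.
- rewrite (partition_big k xpredT)//=; apply: eq_bigr => i _.
  by rewrite scaler_suml; apply: eq_bigr => j /eqP <-; rewrite kE.
Qed.

Lemma finite_coneP q : cone (convex_hull [set p i | i in [set: 'I_m]]) q <->
  exists s : 'I_m -> R, [/\ forall i, 0 <= s i, 0 < \sum_i s i & q = \sum_i s i *: p i].
Proof.
split=> [[t t0 [x /finite_hullP [s [s0 s1 ->]] ->]]|[s [s0 s1 ->]]].
  exists (fun i => t * s i); split=> [i||].
  - by rewrite mulr_ge0// ltW.
  - by rewrite -mulr_sumr s1 mulr1.
  - by rewrite scaler_sumr; apply: eq_bigr => i _; rewrite scalerA.
set t := \sum_i s i in s1; exists t => //.
exists (\sum_i (s i / t) *: p i).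
  apply/finite_hullP; exists (fun i => s i / t); split=> [i||//].
    by rewrite divr_ge0// ltW.
  by rewrite -mulr_suml divff// gt_eqF.
rewrite scaler_sumr; apply: eq_bigr => i _.
by rewrite scalerA mulrC divfK// gt_eqF.
Qed.

Variable d : 'I_m -> {linear 'M[R]_2 -> R^o}.
Hypothesis dp : forall i j, d i (p j) = (i == j)%:R.

Lemma dual_sum (s : 'I_m -> R) i : d i (\sum_j s j *: p j) = s i.
Proof.
rewrite linear_sum (bigD1 i)//= lformZ dp eqxx mulr1 big1 ?addr0// => j ji.
by rewrite lformZ dp eq_sym (negbTE ji) mulr0.
Qed.

(** A point of which some coefficient lies strictly between 0 and 1 is interior to a segment issued
    from that [p i]. Conversely, on a segment through [p i] the other dual forms are nonnegative
    with weighted sum 0, so both ends are [p i]. *)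
Lemma dual_vertex : vertex (convex_hull [set p i | i in [set: 'I_m]]) =
  [set p i | i in [set: 'I_m]].
Proof.
apply/seteqP; split=> q /=.
  move=> [/finite_hullP [s [s0 s1 qE]] ext].
  have [i si] : exists i, 0 < s i.
    apply: contrapT => nt; suff : \sum_i s i = 0 by rewrite s1 => /eqP; rewrite oner_eq0.
    apply: big1 => i _; apply/eqP; rewrite eq_le s0 andbT leNgt; apply/negP => si.
    by apply: nt; exists i.
  exists i => //; have sle : s i <= 1.
    by rewrite -s1 (bigD1 i)//= lerDl sumr_ge0.
  have [si1|si1] := eqVneq (s i) 1.
    have z j : j != i -> s j = 0.
      have : \sum_(j | j != i) s j = 0.
        by apply: (addrI (s i)); rewrite addr0 [RHS]si1 -[RHS]s1 [RHS](bigD1 i).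
      by move=> /psumr_eq0P H ji; exact: H.
    rewrite qE (bigD1 i)//= si1 scale1r big1 ?addr0// => j ji.
    by rewrite z// scale0r.
  have silt : s i < 1 by rewrite lt_neqAle si1.
  (* The point where the line from [p i] through [q] meets the opposite face. *)
  pose y := \sum_j (if j == i then 0 else s j / (1 - s i)) *: p j.
  have s1' : 1 - s i != 0 by rewrite subr_eq0 eq_sym.
  have [] // := ext (p i) y (s i).
  - by apply: hull_incl; exists i.
  - apply/finite_hullP; exists (fun j => if j == i then 0 else s j / (1 - s i)); split=> //.
      by move=> j; case: ifP => // _; rewrite divr_ge0// subr_ge0.
    rewrite (bigD1 i)//= eqxx add0r (eq_bigr (fun j => s j / (1 - s i))); last first.
      by move=> j /negbTE ->.
    rewrite -mulr_suml; apply: (mulIf s1'); rewrite mul1r divfK//.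
    by rewrite -[1 in RHS]s1 [X in X - _](bigD1 i)//= [RHS]addrC addKr.
  - by rewrite si silt.
  - rewrite qE (bigD1 i)//= /y scaler_sumr (bigD1 i (P := xpredT))//= eqxx scale0r scaler0 add0r.
    congr (_ + _); apply: eq_bigr => j /negbTE ->.
    by rewrite scalerA mulrC divfK.
move=> [i _ <-]; split; first by apply: hull_incl; exists i.
move=> _ _ t /finite_hullP [a [a0 a1 ->]] /finite_hullP [b [b0 b1 ->]] /andP[t0 t1] e.
have z j : j != i -> a j = 0 /\ b j = 0.
  move=> ji; have := congr1 (d j) e; rewrite dp (negbTE ji) linearD !lformZ !dual_sum.
  move=> /esym/eqP; rewrite paddr_eq0; first last.
  - by rewrite mulr_ge0// subr_ge0 ltW.
  - by rewrite mulr_ge0// ltW.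
  rewrite !mulf_eq0 gt_eqF//= [1 - t == 0]gt_eqF ?subr_gt0//=.
  by move=> /andP[/eqP -> /eqP ->].
have S (c : 'I_m -> R) : (forall j, j != i -> c j = 0) -> \sum_j c j = 1 ->
    \sum_j c j *: p j = p i.
  move=> cz c1; rewrite (bigD1 i)//= big1 => [|j ji]; last by rewrite cz// scale0r.
  rewrite addr0 (_ : c i = 1) ?scale1r// -c1 (bigD1 i)//= big1 ?addr0//.
by split; apply: S => // j ji; have [] := z j ji.
Qed.

End FiniteHull.

(** * Lattice vectors in the coordinates of a basis *)

Definition vec (y : basis) (a b : int) : lat2 := a *: (val y).1 + b *: (val y).2.

Lemma vec_ex y w : exists a b, w = vec y a b.
Proof.
have d2 := bdet2 y; move: d2; rewrite /bdet /cor /=.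
set v1 := (val y).1; set v2 := (val y).2.
set D := (X in X * X) => d2.
(* Cramer's rule; the determinant [D] is its own inverse. *)
exists ((w ord0 ord0 * v2 ord_max ord0 - v2 ord0 ord0 * w ord_max ord0) * D).
exists ((v1 ord0 ord0 * w ord_max ord0 - w ord0 ord0 * v1 ord_max ord0) * D).
apply: lat2P; rewrite /cor /vec -/v1 -/v2 !mxE; congr (_, _).
  by rewrite -[LHS]mulr1 -d2 /D; ring.
by rewrite -[LHS]mulr1 -d2 /D; ring.
Qed.

Lemma vecN y a b : - vec y a b = vec y (- a) (- b).
Proof. by rewrite /vec opprD !scaleNr. Qed.
Lemma vec10 y : vec y 1 0 = (val y).1. Proof. by rewrite /vec scale1r scale0r addr0. Qed.
Lemma vec01 y : vec y 0 1 = (val y).2. Proof. by rewrite /vec scale1r scale0r add0r. Qed.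
Lemma vec11 y : vec y (-1) (-1) = - (val y).1 - (val y).2.
Proof. by rewrite /vec !scaleN1r. Qed.

Lemma basis_primitive (y : basis) : primitive (val y).1.
Proof.
have : bdet y \is a GRing.unit by case: (bdet_unit y) => ->.
rewrite /bdet /cor => D; split.
  by apply/eqP => v0; move: D; rewrite v0 !mxE /= mul0r mulr0 subr0 unitr0.
move=> k m vE; move: D; rewrite vE !mxE /=.
rewrite -mulrA [X in _ - X]mulrCA -mulrBr unitrM => /andP[//].
Qed.

Lemma primitive2 (y : basis) : primitive (val y).2.
Proof. exact: (basis_primitive (swap y)). Qed.

Lemma primitive3 (y : basis) : primitive (- (val y).1 - (val y).2).
Proof. exact: (basis_primitive (rot2 y)). Qed.

(** Primitivity makes the gcd of the coordinates a unit, and the Bezout coefficients provide the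
    second vector. *)
Lemma primitive_basis l : primitive l -> exists y : basis, (val y).1 = l.
Proof.
move=> [l0 lu]; pose p := l ord0 ord0; pose q := l ord_max ord0.
have [u [v uv]] := Bezoutz p q.
have gu : gcdz p q \is a GRing.unit.
  apply: (lu _ (\col_i (if i == ord0 then (p %/ gcdz p q)%Z else (q %/ gcdz p q)%Z))).
  apply: lat2P; rewrite /cor !mxE /= -/p -/q; congr (_, _).
    by rewrite mulrC divzK// dvdz_gcdl.
  by rewrite mulrC divzK// dvdz_gcdr.
have B : isbasis l (\col_i (if i == ord0 then - v else u)).
  rewrite isbasisE !mxE /= -/p -/q (_ : _ - _ = gcdz p q)//.
  by rewrite -uv; ring.
by exists (@Basis (_, _) B).
Qed.

Lemma shear_basis y (k : int) (e : bool) : exists z : basis,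
  (val z).1 = (val y).1 /\ (val z).2 = vec y ((-1) ^+ e * k) ((-1) ^+ e).
Proof.
have B : isbasis (val y).1 (vec y ((-1) ^+ e * k) ((-1) ^+ e)).
  have := @isbasis_lin 1 0 ((-1) ^+ e * k) ((-1) ^+ e) _ _ (basP y).
  rewrite scale1r scale0r addr0; apply.
  by rewrite mul1r mul0r subr0; case: e.
by exists (@Basis (_, _) B).
Qed.

Lemma vec_primitive y (n : int) : primitive (vec y n 1).
Proof.
have [z [_ e]] := shear_basis y n false.
by rewrite -[n]mul1r -[vec _ _ _]e; exact: primitive2.
Qed.

(** The cross term is taken with its worse sign, so that one bound serves for triangles, for edges
    and for the reduction of an arbitrary face. *)
Lemma hex_ge1 (a b : int) : (a, b) != (0, 0) -> 1 <= a ^+ 2 + b ^+ 2 - `|a * b|.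
Proof.
move=> ab; have {}ab : a != 0 \/ b != 0.
  by move: ab; rewrite xpair_eqE negb_and => /orP.
have nn (c : int) : c * c = `|c| * `|c|.
  by rewrite -normrM ger0_norm// -expr2 sqr_ge0.
rewrite normrM !expr2 (nn a) (nn b); set x := `|a|; set y := `|b|.
have x0 : 0 <= x by exact: normr_ge0.
have y0 : 0 <= y by exact: normr_ge0.
have : x != 0 \/ y != 0 by rewrite !normr_eq0.
by move=> {ab} ab; nia.
Qed.

Lemma hex_eq1 (a b : int) : a ^+ 2 + b ^+ 2 - a * b = 1 -> (a, b) \in hexagon.
Proof.
move=> e; pose v : lat2 := \col_i (if i == ord0 then a else b).
have := @hexb2 v; rewrite /hexb /cor !mxE /=; apply; lia.
Qed.

(** * The points phi(l) and the cells they span *)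

Section Points.
Variables (R : realType) (E : 'M[R]_2).
Hypothesis Eu : E \in unitmx.

Definition phil (l : lat2) : 'M[R]_2 := phi (lvec E l).
Local Notation pt := phil.

Lemma lvec_lin (a b : int) v w :
  lvec E (a *: v + b *: w) = a%:~R *: lvec E v + b%:~R *: lvec E w.
Proof.
rewrite /lvec map_mxD mulmxDr; congr (_ + _); rewrite scalemxAr; congr (_ *m _);
  by apply/matrixP => i j; rewrite !mxE /= intrM.
Qed.

Lemma phiE (f : 'cV[R]_2) i j : phi f i j = f i ord0 * f j ord0.
Proof. by rewrite /phi mxE big_ord1 mxE. Qed.

Lemma ptN l : pt (- l) = pt l.
Proof.
rewrite /phil; have := lvec_lin (-1) 0 l l; rewrite scaleN1r scale0r addr0 => ->.
by apply/matrixP => i j; rewrite !phiE !mxE; ring.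
Qed.

Lemma pt_vec y a b : pt (vec y a b) =
  (a ^+ 2)%:~R *: pt (val y).1 + (b ^+ 2)%:~R *: pt (val y).2 +
  (a * b)%:~R *: (pt (- (val y).1 - (val y).2) - pt (val y).1 - pt (val y).2).
Proof.
rewrite -[in - _ - _]vec11 /phil /vec !lvec_lin.
by apply/matrixP => i j; rewrite !mxE !big_ord1 !mxE; ring.
Qed.

(** Every binary quadratic form in the coordinates of [y] comes from a linear form on matrices, a
    trace against [M] transported by the basis matrix. The matrix [M] is triangular, with the whole
    cross term [ga] in one entry. All explicit supporting and dual forms below are of this kind. *)
Lemma form_ex y (al be ga : R) : exists u : {linear 'M[R]_2 -> R^o},
  forall a b : int, u (pt (vec y a b)) =
    al * a%:~R ^+ 2 + be * b%:~R ^+ 2 + ga * a%:~R * b%:~R.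
Proof.
pose B0 : 'M[int]_2 := row_mx (val y).1 (val y).2.
have B0u : B0 \in unitmx by exact: (basP y).
pose B := E *m map_mx intr B0.
have Bu : B \in unitmx by rewrite unitmx_mul Eu; rewrite unitmxE det_map_mx rmorph_unit// -unitmxE.
pose M : 'M[R]_2 := \matrix_(i, j) (if (i == ord0) && (j == ord0) then al else
  if (i == ord0) then ga else if j == ord0 then 0 else be).
exists (mxtrace \o mulmx ((invmx B)^T *m M *m invmx B)) => a b.
pose x : 'cV[R]_2 := \col_i (if i == ord0 then a%:~R else b%:~R).
have -> : pt (vec y a b) = B *m (x *m x^T) *m B^T.
  rewrite /phil /phi; have -> : lvec E (vec y a b) = B *m x.
    rewrite /lvec /B -mulmxA; congr (_ *m _).
    pose x0 : 'cV[int]_2 := \col_i (if i == ord0 then a else b).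
    have -> : x = map_mx intr x0 by apply/matrixP => i j; rewrite !mxE; case: ifP.
    rewrite -map_mxM; congr map_mx; apply/matrixP => i j; rewrite (ord1 j).
    have [rl rr] := row_mx_cols (val y).1 (val y).2 i.
    rewrite [RHS]mxE big_ord_recr big_ord1 /= [widen_ord _ _](_ : _ = ord0); last exact: val_inj.
    by rewrite rl rr !mxE /=; ring.
  by rewrite trmx_mul !mulmxA.
clearbody B; rewrite /= -!mulmxA (mulKmx Bu) mxtrace_mulC -!mulmxA -trmx_mul mulVmx// trmx1 mulmx1.
rewrite /mxtrace !(big_ord_recl, big_ord0) !mxE !(big_ord_recl, big_ord0) !mxE /=.
rewrite !(big_ord_recl, big_ord0) !mxE /=. ring.
Qed.

Lemma primitive_ab y a b : primitive (vec y a b) -> (a, b) != (0, 0).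
Proof.
by move=> [+ _]; apply: contraNneq => -[-> ->]; rewrite /vec !scale0r addr0.
Qed.

Definition simp (k : nat) (l : 'I_k -> lat2) : set 'M[R]_2 :=
  convex_hull [set pt (l i) | i in [set: 'I_k]].

Definition pts : set 'M[R]_2 := [set pt l | l in primitive].

(** [u] cuts the face out of the hull, and the dual forms [d] show that all its spanning points are
    vertices. *)
Lemma simplex_cell k (l : 'I_k.+1 -> lat2) (u : {linear 'M[R]_2 -> R^o})
    (d : 'I_k.+1 -> {linear 'M[R]_2 -> R^o}) :
  (forall i, primitive (l i)) -> (forall w, primitive w -> 1 <= u (pt w)) ->
  (forall w, primitive w -> u (pt w) = 1 -> exists i, pt w = pt (l i)) ->
  (forall i, u (pt (l i)) = 1) -> (forall i j, d i (pt (l j)) = (i == j)%:R) ->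
  \rank (\matrix_(i < k.+1, j < 2) ((l i) j ord0)%:~R : 'M[rat]_(k.+1, 2)) = 2%N ->
  cell E (simplex E l).
Proof.
move=> lp u1 ul lu dl rk; exists (simp l), k.+1, l; split=> //.
- exists u, 1; split.
    by apply: hull_ge => _ [w wp <-]; exact: u1.
  rewrite /voronoi_hull hull_face => [|_ [w wp <-]]; last exact: u1.
  congr convex_hull; apply/seteqP; split=> [_ [i _ <-]|_ [[w wp <-] uw]].
    by split; [exists (l i)|exact: lu].
  by have [i iE] := ul w wp uw; exists i => //; exact: (esym iE).
- exact: dual_vertex dl.
Qed.

Definition tri (y : basis) : 'I_3 -> lat2 :=
  tnth [tuple (val y).1; (val y).2; - (val y).1 - (val y).2].
Definition edg (y : basis) : 'I_2 -> lat2 := tnth [tuple (val y).1; (val y).2].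

Lemma ord3P (i : 'I_3) : [\/ i = ord0, i = inord 1 | i = ord_max].
Proof.
case: i => [[|[|[|//]]] i]; [apply: Or31|apply: Or32|apply: Or33]; apply: val_inj => //=.
by rewrite inordK.
Qed.

Lemma ord2P (i : 'I_2) : i = ord0 \/ i = ord_max.
Proof. by case: i => [[|[|//]] i]; [left|right]; exact: val_inj. Qed.

Lemma triE y : [/\ tri y ord0 = (val y).1, tri y (inord 1) = (val y).2 &
  tri y ord_max = - (val y).1 - (val y).2].
Proof. by rewrite /tri !(tnth_nth 0) /= inordK. Qed.

Lemma edgE y : edg y ord0 = (val y).1 /\ edg y ord_max = (val y).2.
Proof. by rewrite /edg !(tnth_nth 0). Qed.

Lemma tri_primitive y i : primitive (tri y i).
Proof.
have [e1 e2 e3] := triE y; case: (ord3P i) => ->; rewrite ?e1 ?e2 ?e3.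
- exact: basis_primitive.
- exact: primitive2.
- exact: primitive3.
Qed.

Lemma edg_primitive y i : primitive (edg y i).
Proof.
have [e1 e2] := edgE y; case: (ord2P i) => ->; rewrite ?e1 ?e2.
- exact: basis_primitive.
- exact: primitive2.
Qed.

Lemma rank_two n (l : 'I_n -> lat2) (y : basis) (i j : 'I_n) :
  l i = (val y).1 -> l j = (val y).2 ->
  \rank (\matrix_(i < n, j < 2) ((l i) j ord0)%:~R : 'M[rat]_(n, 2)) = 2%N.
Proof.
move=> li lj; set A := (X in \rank X); apply/eqP; rewrite eqn_leq rank_leq_col /=.
pose S : 'M[rat]_(2, n) := \matrix_(a < 2, b < n) (b == (if a == ord0 then i else j))%:R.
apply: leq_trans (mxrankM_maxr S A).
have SA : S *m A = map_mx intr (row_mx (val y).1 (val y).2 : 'M[int]_(2, 1 + 1))^T.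
  apply/matrixP => a b; rewrite mxE (bigD1 (if a == ord0 then i else j))//= big1.
    rewrite addr0 /S /A !mxE eqxx mul1r.
    have [rl rr] := row_mx_cols (val y).1 (val y).2 b.
    case: (ord2P a) => ->; rewrite ?eqxx /=.
      by rewrite li -rl; congr (_%:~R); rewrite mxE.
    by rewrite lj -rr; congr (_%:~R); rewrite mxE.
  by move=> c /negbTE ci; rewrite /S !mxE ci mul0r.
rewrite SA mxrank_unit// unitmxE det_map_mx rmorph_unit//.
by rewrite det_tr -unitmxE; exact: (basP y).
Qed.

Lemma int_ge1 (z : int) : 1 <= z -> (1 : R) <= z%:~R.
Proof. by move=> h; rewrite -[1]/(1%:~R) ler_int. Qed.

Lemma tri_vec y : [/\ tri y ord0 = vec y 1 0, tri y (inord 1) = vec y 0 1 &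
  tri y ord_max = vec y (-1) (-1)].
Proof. by have [-> -> ->] := triE y; rewrite vec10 vec01 vec11. Qed.

Lemma edg_vec y : edg y ord0 = vec y 1 0 /\ edg y ord_max = vec y 0 1.
Proof. by have [-> ->] := edgE y; rewrite vec10 vec01. Qed.

Lemma tri_dual y : exists d : 'I_3 -> {linear 'M[R]_2 -> R^o},
  forall i j, d i (pt (tri y j)) = (i == j)%:R.
Proof.
(* The forms a^2 - a b, b^2 - a b and a b are dual to the coordinates (1, 0), (0, 1) and (-1, -1) of
   the three vertices. *)
have [d1 d1E] := form_ex y 1 0 (-1).
have [d2 d2E] := form_ex y 0 1 (-1).
have [d3 d3E] := form_ex y 0 0 1.
exists (fun i => if i == ord0 then d1 else if i == ord_max then d3 else d2).
have [e1 e2 e3] := tri_vec y.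
have n1 : (inord 1 == ord0 :> 'I_3) = false by rewrite -val_eqE /= inordK.
have n2 : (inord 1 == ord_max :> 'I_3) = false by rewrite -val_eqE /= inordK.
have n3 : (ord0 == inord 1 :> 'I_3) = false by rewrite eq_sym.
have n4 : (ord_max == inord 1 :> 'I_3) = false by rewrite eq_sym.
move=> i j; case: (ord3P j) => ->; [rewrite e1|rewrite e2|rewrite e3];
  case: (ord3P i) => ->; rewrite ?(n1, n2, n3, n4, eqxx) /= ?(d1E, d2E, d3E);
  by rewrite ?(expr0n, expr1n, sqrrN, rmorphN, mulr0z, mulr1z) /=; ring.
Qed.

Lemma edg_dual y : exists d : 'I_2 -> {linear 'M[R]_2 -> R^o},
  forall i j, d i (pt (edg y j)) = (i == j)%:R.
Proof.
have [d1 d1E] := form_ex y 1 0 0.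
have [d2 d2E] := form_ex y 0 1 0.
exists (fun i => if i == ord0 then d1 else d2).
have [e1 e2] := edg_vec y.
move=> i j; case: (ord2P j) => ->; [rewrite e1|rewrite e2];
  by case: (ord2P i) => -> /=; rewrite ?d1E ?d2E; ring.
Qed.

Lemma hex_pt y a b : (a, b) \in hexagon ->
  exists i, pt (vec y a b) = pt (tri y i).
Proof.
have [e1 e2 e3] := tri_vec y.
have h1 : pt (vec y 1 0) = pt (tri y ord0) by rewrite e1.
have h2 : pt (vec y 0 1) = pt (tri y (inord 1)) by rewrite e2.
have h3 : pt (vec y (-1) (-1)) = pt (tri y ord_max) by rewrite e3.
have N c d : pt (vec y c d) = pt (vec y (- c) (- d)) by rewrite -vecN ptN.
rewrite /hexagon !inE => /or4P[/eqP[-> ->]|/eqP[-> ->]|/eqP[-> ->]|/or3P[]/eqP[-> ->]].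
- by exists ord0.
- by exists (inord 1).
- by exists ord_max; rewrite N.
- by exists ord0; rewrite N opprK.
- by exists (inord 1); rewrite N opprK.
- by exists ord_max.
Qed.

Lemma square_eq1 (a b : int) : a ^+ 2 + b ^+ 2 = 1 -> (a, b) \in square.
Proof.
move=> e; have a1 : a \in [:: -1; 0; 1] by rewrite !inE; nia.
have b1 : b \in [:: -1; 0; 1] by rewrite !inE; nia.
move: e; move: a1 b1; rewrite /square !inE => H H'; move: H H'.
by move=> /or3P[] /eqP -> /or3P[] /eqP ->; vm_compute.
Qed.

Lemma square_pt y a b : (a, b) \in square ->
  exists i, pt (vec y a b) = pt (edg y i).
Proof.
have [e1 e2] := edgE y.
have h1 : pt (vec y 1 0) = pt (edg y ord0) by rewrite e1 vec10.
have h2 : pt (vec y 0 1) = pt (edg y ord_max) by rewrite e2 vec01.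
have N c d : pt (vec y c d) = pt (vec y (- c) (- d)) by rewrite -vecN ptN.
rewrite /square !inE => /or4P[] /eqP[-> ->].
- by exists ord0.
- by exists ord_max.
- by exists ord0; rewrite N opprK.
- by exists ord_max; rewrite N opprK.
Qed.

Lemma tri_cell y : cell E (simplex E (tri y)).
Proof.
have [u uE] := form_ex y 1 1 (-1); have [d dE] := tri_dual y.
have uZ a b : u (pt (vec y a b)) = (a ^+ 2 + b ^+ 2 - a * b)%:~R.
  by rewrite uE !expr2 rmorphB /= !rmorphD /= !rmorphM /=; ring.
have [e1 e2 e3] := triE y.
apply: (simplex_cell (u := u) (d := d)) => //.
- exact: tri_primitive.
- move=> w; have [a [b ->]] := vec_ex y w => /primitive_ab /hex_ge1 h.
  rewrite uZ; apply: int_ge1; apply: le_trans h _.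
  by rewrite lerD2l lerN2 ler_norm.
- move=> w; have [a [b ->]] := vec_ex y w => _.
  by rewrite uZ -[1]/(1%:~R) => /intr_inj /hex_eq1; exact: hex_pt.
- by have [f1 f2 f3] := tri_vec y; move=> i; case: (ord3P i) => ->;
    rewrite ?f1 ?f2 ?f3 uZ.
- exact: (rank_two e1 e2).
Qed.

Lemma edg_cell y : cell E (simplex E (edg y)).
Proof.
have [u uE] := form_ex y 1 1 0; have [d dE] := edg_dual y.
have uZ a b : u (pt (vec y a b)) = (a ^+ 2 + b ^+ 2)%:~R.
  by rewrite uE !expr2 !rmorphD /= !rmorphM /=; ring.
have [e1 e2] := edgE y.
apply: (simplex_cell (u := u) (d := d)) => //.
- exact: edg_primitive.
- move=> w; have [a [b ->]] := vec_ex y w => /primitive_ab /hex_ge1 h.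
  rewrite uZ; apply: int_ge1; apply: le_trans h _.
  by rewrite lerBlDr lerDl.
- move=> w; have [a [b ->]] := vec_ex y w => _.
  by rewrite uZ -[1]/(1%:~R) => /intr_inj /square_eq1; exact: square_pt.
- by have [f1 f2] := edg_vec y; move=> i; case: (ord2P i) => ->; rewrite ?f1 ?f2 uZ.
- exact: (rank_two e1 e2).
Qed.

Lemma archi_bound (x : R) : exists n : nat, x < n%:R.
Proof.
exists (Num.bound `|x|); apply: le_lt_trans (ler_norm x) _.
by apply: archi_boundP; exact: normr_ge0.
Qed.

(** * Faces of the hull cut out by a supporting linear form *)

Section Face.
Variables (u : {linear 'M[R]_2 -> R^o}) (c : R).
Hypothesis uc : forall w, primitive w -> c <= u (pt w).

Definition cross (y : basis) : R :=
  u (pt (- (val y).1 - (val y).2)) - u (pt (val y).1) - u (pt (val y).2).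

Lemma u_vec (y : basis) a b : u (pt (vec y a b)) = a%:~R ^+ 2 * u (pt (val y).1) +
  b%:~R ^+ 2 * u (pt (val y).2) + a%:~R * b%:~R * cross y.
Proof.
have uB q q' : u (q - q') = u q - u q' by exact: linearB.
have uD q q' : u (q + q') = u q + u q' by exact: linearD.
rewrite /cross pt_vec uD uD !lformZ uB uB.
move: (u _) (u _) (u _) => u1 u2 u3.
by rewrite !expr2 !rmorphM /=; ring.
Qed.

(** Adding the bounds at n v1 + v2 and -n v1 + v2 removes the cross term and leaves n^2 c + u(v2) >=
    c for all n, which fails for large n if c < 0. *)
Lemma face_ge0 (y : basis) : u (pt (val y).1) = c -> 0 <= c.
Proof.
move=> u1; rewrite leNgt; apply/negP => c0.
have [n nb] := archi_bound (u (pt (val y).2) / - c + 1).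
have h1 := uc (vec_primitive y n%:Z); have h2 := uc (vec_primitive y (- n%:Z)).
rewrite !u_vec u1 in h1 h2.
have {}nb : u (pt (val y).2) < (n%:R - 1) * - c.
  by rewrite -ltr_pdivrMr ?oppr_gt0// ltrBrDr.
rewrite rmorphN /= -pmulrn in h1 h2.
have n1 : 1 <= (n%:R : R) ^+ 2 - n%:R + 1.
  rewrite lerDr subr_ge0 expr2; case: n {nb h1 h2} => [|n]; first by rewrite mulr0.
  by rewrite ler_peMl ?ler0n// ler1n.
nra.
Qed.

(** At n v1 + v2 and -n v1 + v2 the values are u(v2) plus and minus n [cross y]; both stay
    nonnegative for all n only if the cross term vanishes. *)
Lemma face_cross0 (y : basis) : u (pt (val y).1) = c -> c = 0 -> cross y = 0.
Proof.
move=> u1 c0; apply/eqP; apply: contraT => T0.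
have T1 : 0 < `|cross y| by rewrite normr_gt0.
have [n nb] := archi_bound (u (pt (val y).2) / `|cross y|).
have h1 := uc (vec_primitive y n%:Z); have h2 := uc (vec_primitive y (- n%:Z)).
rewrite !u_vec u1 c0 in h1 h2; rewrite rmorphN /= -pmulrn in h1 h2.
move: nb; rewrite ltr_pdivrMr// => nb.
rewrite ?(mulr0, add0r, mulr1z, expr1n, mul1r, mulr1, mulNr) in h1 h2.
case: (lerP 0 (cross y)) => t; move: nb.
  by rewrite ger0_norm//; lra.
by rewrite ltr0_norm// mulrN; lra.
Qed.

(* Reduction: translate the second vector by a multiple of the minimal one. *)
Lemma shear_cross (y : basis) : 0 < c -> u (pt (val y).1) = c -> exists z : basis,
  [/\ (val z).1 = (val y).1, - c <= cross z & cross z <= 0].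
Proof.
(* [k] is - [cross y] / 2c rounded to the nearest integer, which puts the new cross term [T'] in
   [-c, c]. Reversing the second vector when [T'] is positive (the sign [e]) brings it into
   [-c, 0]. *)
move=> c0 u1; pose th := - cross y / (c *+ 2) + 2^-1.
pose k := Num.floor th.
have c2 : 0 < c *+ 2 by rewrite mulrn_wgt0.
have k1 : k%:~R * (c *+ 2) <= - cross y + c.
  have := floor_le th; rewrite -/k => /(ler_wpM2r (ltW c2)) h.
  apply: le_trans h _; rewrite /th mulrDl divfK ?gt_eqF// lerD2l.
  by rewrite -[c *+ 2]mulr_natl mulrA mulVf ?mul1r// pnatr_eq0.
have k2 : - cross y - c <= k%:~R * (c *+ 2).
  have /andP[_] := floor_itv th; rewrite -/k intrD => /ltW /(ler_wpM2r (ltW c2)).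
  rewrite /th !mulrDl divfK ?gt_eqF// mul1r -lerBlDr => h; apply: le_trans h.
  have -> : 2^-1 * (c *+ 2) = c.
    by rewrite -[c *+ 2]mulr_natl mulrA mulVf ?mul1r// pnatr_eq0.
  by rewrite mulr2n; lra.
pose T' := cross y + k%:~R * (c *+ 2).
pose e := 0 < T'.
have [z [z1 z2]] := shear_basis y k e; exists z.
have vz a b : vec z a b = vec y (a + b * ((-1) ^+ e * k)) (b * (-1) ^+ e).
  by rewrite {1}/vec z1 z2 /vec scalerDr scalerDl !scalerA addrA.
have cz : cross z = (-1) ^+ e * T'.
  rewrite {1}/cross -(vec11 z) -(vec01 z) z1 !vz !u_vec u1 /T'.
  by case: (e); rewrite ?expr1 ?expr0 ?mulN1r ?mul1r !(rmorphD, rmorphN) /=; ring.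
have T1 : T' <= c by rewrite /T' -lerBrDl addrC.
have T2 : - c <= T' by rewrite /T' -lerBlDl addrC.
split=> //; rewrite cz /e; case: (ltrP 0 T') => hT; rewrite ?expr1 ?expr0 ?mulN1r ?mul1r//.
  by rewrite lerN2.
by rewrite oppr_le0 ltW.
Qed.

(* On a basis reduced with respect to a minimal vector, a second minimal vector
   forces the form a^2 + b^2 + (t/c) a b with t in [-c, 0]. *)
Lemma face_reduced (y : basis) (w : lat2) (b0 : int) a0 : 0 < c -> u (pt (val y).1) = c ->
  - c <= cross y -> cross y <= 0 -> w = vec y a0 b0 -> b0 != 0 -> u (pt w) = c ->
  u (pt (val y).2) = c.
Proof.
move=> c0 u1 t1 t2 -> b0n; rewrite u_vec u1 => uw.
have u2 := uc (primitive2 y).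
have h : 1 <= a0 ^+ 2 + b0 ^+ 2 - `|a0 * b0|.
  by apply: hex_ge1; rewrite xpair_eqE (negbTE b0n) andbF.
have {h} h := int_ge1 h.
rewrite rmorphB rmorphD /= !rmorphXn intr_norm rmorphM /= in h.
have b1 : 1 <= (b0%:~R : R) ^+ 2.
  by rewrite -rmorphXn; apply: int_ge1; rewrite -gtz0_ge1 lt0r sqrf_eq0 b0n sqr_ge0.
move: h b1 uw; set a := a0%:~R; set b := b0%:~R => h b1 uw.
have tab : - (c * `|a * b|) <= a * b * cross y.
  have := ler_norm (- (a * b)); have := ler_norm (a * b); rewrite normrN.
  case: (lerP 0 (a * b)) => ab; nra.
(* The left side equals c - c a^2 - c b^2 - a b [cross y], at most c (1 - (a^2 + b^2 - |a b|)). *)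
have : b ^+ 2 * (u (pt (val y).2) - c) <= 0 by nra.
rewrite pmulr_rle0; last by apply: lt_le_trans b1.
rewrite subr_le0 => h2; apply/eqP; rewrite eq_le h2; exact: u2.
Qed.

Lemma face_hull : [set q | voronoi_hull E q /\ u q = c] =
  convex_hull [set q | pts q /\ u q = c].
Proof. by apply: hull_face => _ [w wp <-]; exact: uc. Qed.

Lemma face_simplex k (l : 'I_k -> lat2) : (forall i, primitive (l i)) ->
  (forall i, u (pt (l i)) = c) ->
  (forall w, primitive w -> u (pt w) = c -> exists i, pt w = pt (l i)) ->
  [set q | voronoi_hull E q /\ u q = c] = simp l.
Proof.
move=> lp lu ul; rewrite face_hull; congr convex_hull.
apply/seteqP; split=> [_ [[w wp <-] uw]|_ [i _ <-]].
  by have [i iE] := ul w wp uw; exists i => //; exact: (esym iE).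
by split; [exists (l i)|exact: lu].
Qed.

(** The value -c of the cross term is the hexagonal form. If the cross term is larger, every vector
    with a b nonzero takes a value above c, and only the four vectors of the square remain. *)
Lemma face_cell (y : basis) (w : lat2) (b0 : int) a0 : 0 < c -> u (pt (val y).1) = c ->
  - c <= cross y -> cross y <= 0 -> w = vec y a0 b0 -> b0 != 0 -> u (pt w) = c ->
  [set q | voronoi_hull E q /\ u q = c] = simp (tri y) \/
  [set q | voronoi_hull E q /\ u q = c] = simp (edg y).
Proof.
move=> c0 u1 t1 t2 we bn uw.
have u2 := face_reduced c0 u1 t1 t2 we bn uw.
have [tc|tc] := eqVneq (cross y) (- c); [left|right]; apply: face_simplex.
- exact: tri_primitive.
- have [e1 e2 e3] := triE y; move=> i; case: (ord3P i) => ->.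
  + by rewrite e1.
  + by rewrite e2.
  + by rewrite e3 -vec11 u_vec u1 u2 tc; ring.
- move=> v; have [a [b ->]] := vec_ex y v => _; rewrite u_vec u1 u2 tc => uv.
  apply: hex_pt; apply: hex_eq1; apply: (@intr_inj R).
  apply: (mulfI (lt0r_neq0 c0)); rewrite mulr1 -[RHS]uv.
  by rewrite !expr2 rmorphB /= !rmorphD /= !rmorphM /=; ring.
- exact: edg_primitive.
- by have [e1 e2] := edgE y; move=> i; case: (ord2P i) => ->; rewrite ?e1 ?e2.
- move=> v; have [a [b ->]] := vec_ex y v => /primitive_ab ab; rewrite u_vec u1 u2 => uv.
  have tc' : - c < cross y by rewrite lt_neqAle eq_sym tc.
  have h := hex_ge1 ab.
  apply: square_pt; apply: square_eq1.
  have ab0 : a * b = 0.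
    apply/eqP; apply: contraT => abn.
    have {h} h := int_ge1 h.
    rewrite rmorphB rmorphD /= !rmorphXn intr_norm rmorphM /= in h.
    have H : (1 : R) <= `|a%:~R * b%:~R|.
      by rewrite -rmorphM /= -intr_norm; apply: int_ge1; rewrite -gtz0_ge1 normr_gt0.
    have t3 : 0 < cross y + c by rewrite -ltrBlDr sub0r.
    move: t2 t3 h H uv; move: (a%:~R : R) (b%:~R : R) (cross y) => x z t.
    move=> {u1 u2 t1 tc tc' ab abn uw we} t2 t3 h H uv; exfalso.
    move: h H; case: (lerP 0 (x * z)) => xz.
      rewrite ger0_norm// => h H.
      have h1 : 0 < (x * z) * (t + c) by apply: mulr_gt0 => //; lra.
      have h2 : 0 <= c * (x ^+ 2 + z ^+ 2 - x * z - 1) by apply: mulr_ge0; lra.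
      by clear -h1 h2 uv; lra.
    rewrite ltr0_norm// => h H.
    have h1 : 0 <= (- (x * z)) * (- t) by apply: mulr_ge0; lra.
    have h2 : 0 <= c * (x ^+ 2 + z ^+ 2 - 2) by apply: mulr_ge0; lra.
    by clear -h1 h2 uv c0; lra.
  have : (a ^+ 2 + b ^+ 2)%:~R * c = 1%:~R * c.
    rewrite rmorphD /= !rmorphXn mul1r -[RHS]uv -(rmorphM _ a b) ab0; ring.
  by move=> /(mulIf (lt0r_neq0 c0)) /intr_inj.
Qed.

End Face.

Definition ldet (v w : lat2) : int :=
  v ord0 ord0 * w ord_max ord0 - w ord0 ord0 * v ord_max ord0.

Lemma ldet_vec y a b : ldet (val y).1 (vec y a b) = b * bdet y.
Proof. by rewrite /ldet /vec /bdet /cor !mxE /=; ring. Qed.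

(* [pt w] is the only extreme ray of the hull in the kernel of a form that
   vanishes on [w] and is nonnegative. *)
Lemma primitive_vertex w : primitive w -> vertex (voronoi_hull E) (pt w).
Proof.
move=> wp; have [y yw] := primitive_basis wp.
split; first by apply: hull_incl; exists w.
move=> x z t hx hz /andP[t0 t1] e.
have [u uE] := form_ex y 0 1 0.
have u0 l : primitive l -> 0 <= u (pt l).
  by have [a [b ->]] := vec_ex y l => _; rewrite uE; nra.
have uw : u (pt w) = 0 by rewrite -yw -vec10 uE; ring.
have X0 x' : voronoi_hull E x' -> 0 <= u x'.
  by apply: hull_ge => _ [l lp <-]; exact: u0.
have uxz : u x = 0 /\ u z = 0.
  have := congr1 u e; rewrite uw linearD !lformZ => /esym/eqP.
  rewrite paddr_eq0; first last.
  - by rewrite mulr_ge0 ?X0// subr_ge0 ltW.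
  - by rewrite mulr_ge0 ?X0// ltW.
  rewrite !mulf_eq0 gt_eqF//= [1 - t == 0]gt_eqF ?subr_gt0//=.
  by move=> /andP[/eqP -> /eqP ->].
have key x' : voronoi_hull E x' -> u x' = 0 -> x' = pt w.
  move=> hx' ux'; have : [set q | voronoi_hull E q /\ u q = 0] x' by [].
  rewrite (face_hull u0) => -[n [s [q [s0 s1 Xq ->]]]].
  rewrite (eq_bigr (fun i => s i *: pt w)) => [|i _].
    by rewrite -scaler_suml s1 scale1r.
  congr (_ *: _); have [[l lp <-] ul] := Xq i.
  have [a [b lE]] := vec_ex y l; move: ul; rewrite -/(pt l) lE uE => ub.
  have b0 : b = 0.
    have /eqP : (b%:~R : R) ^+ 2 = 0 by rewrite -[RHS]ub; ring.
    by rewrite sqrf_eq0 intr_eq0 => /eqP.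
  have la : l = a *: w by rewrite lE b0 /vec scale0r addr0 yw.
  have /unitz [a1|a1] := lp.2 _ _ la.
    by rewrite a1 b0 vec10 yw.
  by rewrite a1 b0 -[vec _ _ _]opprK ptN vecN opprK oppr0 vec10 yw.
by have [ux uz] := uxz; split; exact: key.
Qed.

(** Every primitive point is a vertex, and the form a b takes the value m at (m, 1), so it is
    unbounded on vertices. This excludes the whole hull as the face of a cell. *)
Lemma hull_vertex_infinite n (l : 'I_n -> lat2) :
  vertex (voronoi_hull E) <> [set pt (l i) | i in [set: 'I_n]].
Proof.
move=> vE; have [u uE] := form_ex ybase 0 0 1.
have [m mb] := archi_bound (\sum_i `|u (pt (l i))|).
have : vertex (voronoi_hull E) (pt (vec ybase m 1)).
  by apply: primitive_vertex; exact: vec_primitive.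
rewrite vE => -[i _ e].
have um : u (pt (l i)) = m%:R by rewrite e uE -pmulrn; ring.
move: mb; rewrite (bigD1 i)//= um normr_nat ltNge => /negP; apply.
by rewrite lerDl sumr_ge0.
Qed.

(** The rank condition gives a minimal vector [l j] independent of [l ord0]. If c were 0, [u] would
    vanish on all the points and the face would be the whole hull, with infinitely many vertices. So
    c > 0 and the reduction applies. *)
Lemma cell_simplex C : cell E C ->
  exists y, C = simplex E (tri y) \/ C = simplex E (edg y).
Proof.
move=> [F [n [l [[u [c [uc FE]]] lp vF rk ->]]]].
have uc' w : primitive w -> c <= u (pt w).
  by move=> wp; apply: uc; apply: hull_incl; exists w.
have ul i : u (pt (l i)) = c.
  have [Fi _] : vertex F (pt (l i)) by rewrite vF; exists i.
  by move: Fi; rewrite FE => -[].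
case: n l lp vF rk ul => [|n] l lp vF rk ul.
  by have := rank_leq_row (\matrix_(i < 0, j < 2) ((l i) j ord0)%:~R : 'M[rat]_(0, 2)); rewrite rk.
have [y y1] := primitive_basis (lp ord0).
have [j dj] : exists j, ldet (val y).1 (l j) != 0.
  apply: contrapT => nj.
  have H j : exists a, l j = a *: l ord0.
    have [a [b lE]] := vec_ex y (l j); exists a; rewrite lE /vec y1.
    have /eqP : ldet (val y).1 (l j) = 0.
      by apply/eqP; apply: contraT => dj; case: nj; exists j.
    rewrite lE ldet_vec mulf_eq0; have /negbTE -> : bdet y != 0.
      by case: (bdet_unit y) => ->.
    by rewrite orbF => /eqP ->; rewrite scale0r addr0.
  pose a j := projT1 (cid (H j)).
  have aE j : l j = a j *: l ord0 by exact: projT2 (cid (H j)).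
  have : (\matrix_(i < n.+1, j < 2) ((l i) j ord0)%:~R : 'M[rat]_(n.+1, 2)) =
      (\col_i (a i)%:~R) *m (\row_j ((l ord0) j ord0)%:~R).
    apply/matrixP => i k; rewrite !mxE big_ord1 !mxE aE mxE intrM.
    by [].
  move=> AE; have := mxrankM_maxl (\col_(i < n.+1) ((a i)%:~R : rat))
    (\row_(j < 2) (((l ord0) j ord0)%:~R : rat)).
  by rewrite -AE rk => /leq_trans/(_ (rank_leq_col _)).
have uy : u (pt (val y).1) = c by rewrite y1.
have c_ge0 := face_ge0 uc' uy.
have c0 : c != 0.
  apply/eqP => c0; have T0 := face_cross0 uc' uy c0.
  have [a [b lE]] := vec_ex y (l j).
  have bn : b != 0.
    by apply: contraNneq dj => b0; rewrite lE ldet_vec b0 mul0r.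
  have u2 : u (pt (val y).2) = 0.
    have := ul j; rewrite lE u_vec uy T0 c0 !mulr0 add0r addr0 => /eqP.
    by rewrite mulf_eq0 sqrf_eq0 intr_eq0 (negbTE bn) => /eqP.
  have uw w : u (pt w) = 0.
    have [a' [b' ->]] := vec_ex y w.
    by rewrite u_vec uy T0 c0 u2 !mulr0 !addr0.
  have FK : F = voronoi_hull E.
    rewrite FE; apply/seteqP; split=> [q []//|q hq]; split=> //.
    apply/eqP; rewrite eq_le c0; apply/andP; split.
      by apply: hull_le hq => _ [w wp <-]; rewrite -/(pt w) uw.
    by apply: hull_ge hq => _ [w wp <-]; rewrite -/(pt w) uw.
  by apply: (@hull_vertex_infinite _ l); rewrite -FK.
have {c_ge0} c0' : 0 < c by rewrite lt_neqAle eq_sym c0.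
have [z [z1 zt1 zt2]] := shear_cross c0' uy.
have [a [b lE]] := vec_ex z (l j).
have bn : b != 0.
  by apply: contraNneq dj => b0; rewrite -z1 lE ldet_vec b0 mul0r.
have uz : u (pt (val z).1) = c by rewrite z1.
exists z; rewrite FE.
by have [->|->] := face_cell uc' c0' uz zt1 zt2 lE bn (ul j); [left|right].
Qed.

End Points.

(** * The symbols of a given cell *)

Definition twordV (j : 'I_3 * bool * bool) (y : basis) : basis :=
  iter j.1.1 rot2 (iter j.1.2 swap (iter j.2 neg y)).
Definition eword (j : bool * bool * bool) (y : basis) : basis :=
  iter j.2 neg1 (iter j.1.2 neg (iter j.1.1 swap y)).
Definition ewordV (j : bool * bool * bool) (y : basis) : basis :=
  iter j.1.1 swap (iter j.1.2 neg (iter j.2 neg1 y)).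

Lemma twordK j y : tword j (twordV j y) = y.
Proof.
case: j => [[i s] n]; rewrite /tword /twordV /=.
by case: (ord3_ex i) => -> /=; case: s => /=; case: n => /=; rewrite ?(negK, swapK, bas_rot2K, wE).
Qed.

Lemma ewordK j y : eword j (ewordV j y) = y.
Proof.
case: j => [[s n] a]; rewrite /eword /ewordV /=.
by case: s => /=; case: n => /=; case: a => /=; rewrite ?(negK, swapK, neg1K).
Qed.

Lemma twordVK j y : twordV j (tword j y) = y.
Proof.
case: j => [[i s] n]; rewrite /tword /twordV /=.
by case: (ord3_ex i) => -> /=; case: s => /=; case: n => /=; rewrite ?(negK, swapK, bas_rotK, wE).
Qed.

Lemma ewordVK j y : ewordV j (eword j y) = y.
Proof.
case: j => [[s n] a]; rewrite /eword /ewordV /=.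
by case: s => /=; case: n => /=; case: a => /=; rewrite ?(negK, swapK, neg1K).
Qed.

Lemma tword_sum (f : basis -> int) y :
  \sum_(j : 'I_3 * bool * bool) (-1) ^+ j.1.2 * f (tword j y) = S1 f y.
Proof.
rewrite -(pair_bigA _ (fun (p : 'I_3 * bool) n => (-1) ^+ p.2 * f (tword (p, n) y))) /=.
rewrite -(pair_bigA _ (fun (i : 'I_3) (s : bool) => \sum_n (-1) ^+ s * f (tword ((i, s), n) y))) /=.
rewrite !big_ord_recl big_ord0 !big_bool /tword /= /bump /=.
by rewrite /S1 !fctE /= !wE !expr0 !expr1; ring.
Qed.

Lemma eword_sum (f : basis -> int) y :
  \sum_(j : bool * bool * bool) (-1) ^+ j.1.1 * f (eword j y) = S2 f y.
Proof.
rewrite -(pair_bigA _ (fun (p : bool * bool) n => (-1) ^+ p.1 * f (eword (p, n) y))) /=.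
rewrite -(pair_bigA _ (fun (s : bool) (n : bool) => \sum_a (-1) ^+ s * f (eword ((s, n), a) y))) /=.
rewrite !big_bool /eword /=.
by rewrite /S2 !fctE /= !wE !expr0 !expr1; ring.
Qed.

Lemma tword_bact g j y : tword j (bact g y) = bact g (tword j y).
Proof.
have [_ _ hr _] := beq_rot; have [_ _ hs _] := beq_swap; have [_ _ hn _] := beq_negneg.
case: j => [[i s] n]; rewrite /tword /=.
have -> : iter i rot (bact g y) = bact g (iter i rot y).
  by elim: (val i) => //= k ->; rewrite hr.
by case: s => /=; case: n => /=; rewrite ?hs ?hn.
Qed.

Lemma eword_bact g j y : eword j (bact g y) = bact g (eword j y).
Proof.
have [_ _ hr _] := beq_neg1; have [_ _ hs _] := beq_swap; have [_ _ hn _] := beq_negneg.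
by case: j => [[s n] a]; rewrite /eword /=; case: s => /=; case: n => /=; case: a => /=;
  rewrite ?hs ?hn ?hr.
Qed.

Definition eindex : seq (bool * bool * bool) :=
  [seq (p, n) | p <- [seq (i, s) | i <- [:: false; true], s <- [:: false; true]],
    n <- [:: false; true]].

Lemma eindexP j : j \in eindex.
Proof. by case: j => [[[|] [|]] [|]]. Qed.

Lemma eword_base : [seq corp (eword j ybase) | j <- eindex] =
  [:: ((1, 0), (0, 1)); ((-1, 0), (0, 1)); ((-1, 0), (0, -1)); ((1, 0), (0, -1));
      ((0, 1), (1, 0)); ((0, -1), (1, 0)); ((0, -1), (-1, 0)); ((0, 1), (-1, 0))].
Proof.
rewrite /eindex /= /eword ![iter _ _ _]/= /corp.
by rewrite !(val_neg1, val_neg, val_swap) /cor /= !mxE.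
Qed.

(** Words in the symmetries commute with the action, so by transitivity their properties need only
    be computed at [ybase]. *)
Lemma basis_bact (y : basis) : exists g, y = bact g ybase.
Proof.
have yu : (row_mx (val y).1 (val y).2 : 'M[int]_2) \in unitmx by exact: (basP y).
have e (b : bool) i : ((row_mx (val y).1 (val y).2 : 'M[int]_2) *m
    (if b then (val ybase).2 else (val ybase).1)) i ord0 =
    (if b then (val y).2 else (val y).1) i ord0.
  have [rl rr] := row_mx_cols (val y).1 (val y).2 i.
  rewrite mxE big_ord_recr big_ord1 /= [widen_ord _ _](_ : _ = ord0) ?rl ?rr; last exact: val_inj.
  by case: b; rewrite /= !mxE /= ?(mulr0, mulr1, addr0, add0r).
exists (GL2 yu); apply: val_inj.
have e1 : (val y).1 = row_mx (val y).1 (val y).2 *m (val ybase).1.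
  by apply/matrixP => i j; rewrite (ord1 j) [RHS](e false i).
have e2 : (val y).2 = row_mx (val y).1 (val y).2 *m (val ybase).2.
  by apply/matrixP => i j; rewrite (ord1 j) [RHS](e true i).
by rewrite [LHS]surjective_pairing; congr (_, _); [exact: e1|exact: e2].
Qed.

Lemma map_uniq_inj (T : eqType) (U : eqType) (F : T -> U) (s : seq T) :
  (forall j, j \in s) -> uniq [seq F j | j <- s] -> injective F.
Proof.
move=> sP us i j e.
have : index i s == index j s.
  rewrite -(nth_uniq (F i) _ _ us) ?size_map ?index_mem//.
  by rewrite !(nth_map i) ?index_mem// !nth_index// e.
by move=> /eqP ij; rewrite -(nth_index i (sP i)) ij nth_index.
Qed.

Lemma tword_inj y : injective (tword^~ y).
Proof.
have [g ->] := basis_bact y => i j; rewrite !tword_bact => /(can_inj (bactK g)) e.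
have /map_uniq_inj inj : uniq [seq corp (tword j ybase) | j <- tindex].
  by rewrite tword_base.
by apply: (inj tindexP); rewrite e.
Qed.

Lemma eword_inj y : injective (eword^~ y).
Proof.
have [g ->] := basis_bact y => i j; rewrite !eword_bact => /(can_inj (bactK g)) e.
have /map_uniq_inj inj : uniq [seq corp (eword j ybase) | j <- eindex].
  by rewrite eword_base.
by apply: (inj eindexP); rewrite e.
Qed.

Definition lin (y : basis) (a : int * int) : lat2 := a.1 *: (val y).1 + a.2 *: (val y).2.

Lemma lin_bact g z a : lin (bact g z) a = val g *m lin z a.
Proof. by rewrite /lin /= mulmxDr -!scalemxAr. Qed.

Lemma cor_lin a : cor (lin ybase a) = a.
Proof. by case: a => a b; rewrite /cor /lin /= !mxE /=; congr (_, _); ring. Qed.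

Lemma gl2K (g : GL2Z) (l : lat2) : val g^-1%g *m (val g *m l) = l.
Proof. by rewrite mulmxA -[X in X *m _]/(val (g^-1 * g)%g) mulVg mul1mx. Qed.

Lemma lin_inj y : injective (lin y).
Proof.
have [g ->] := basis_bact y => a b; rewrite !lin_bact => /(congr1 (mulmx (val g^-1%g))).
by rewrite !gl2K => /(congr1 cor); rewrite !cor_lin.
Qed.

Lemma lin_cor y x a b : (val x).1 = lin y a -> (val x).2 = lin y b ->
  exists2 g, y = bact g ybase & exists2 z, x = bact g z & corp z = (a, b).
Proof.
have [g ->] := basis_bact y => e1 e2; exists g => //; exists (bact g^-1%g x).
  by rewrite -bactM mulgV bact1.
by rewrite /corp /= e1 e2 !lin_bact !gl2K !cor_lin.
Qed.

(** Of the 36 pairs of vectors of the hexagon, those whose third vertex also lies in it are the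
    twelve listed in [tword_base]. *)
Lemma tword_complete x y a b c : (val x).1 = lin y a -> (val x).2 = lin y b ->
  - (val x).1 - (val x).2 = lin y c -> a \in hexagon -> b \in hexagon ->
  c \in hexagon -> exists j, x = tword j y.
Proof.
move=> e1 e2 e3 ha hb hc.
have [g yg [z xz zab]] := lin_cor e1 e2.
have cE : c = (- a.1 - b.1, - a.2 - b.2).
  apply: (@lin_inj y); rewrite -e3 e1 e2 /lin /= !scalerDl !scaleNr !opprD.
  by rewrite addrACA.
have : corp z \in [seq corp (tword j ybase) | j <- tindex].
  rewrite tword_base zab; move: hc; rewrite cE.
  move: ha hb; rewrite /hexagon !inE.
  by case/or4P => [/eqP ->|/eqP ->|/eqP ->|/or3P[]/eqP ->];
    case/or4P => [/eqP ->|/eqP ->|/eqP ->|/or3P[]/eqP ->]; vm_compute.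
move=> /mapP [j _ /corp_inj zE]; exists j.
by rewrite xz zE yg tword_bact.
Qed.

Lemma eword_complete x y a b : (val x).1 = lin y a -> (val x).2 = lin y b ->
  a \in square -> b \in square -> exists j, x = eword j y.
Proof.
move=> e1 e2 ha hb.
have [g yg [z xz zab]] := lin_cor e1 e2.
have : corp z \in [seq corp (eword j ybase) | j <- eindex].
  have := bdet2 z; rewrite /bdet eword_base zab.
  move: zab => [-> ->] /eqP d; move: ha hb d; rewrite /square !inE.
  by case/or4P => /eqP ->; case/or4P => /eqP ->; vm_compute.
move=> /mapP [j _ /corp_inj zE]; exists j.
by rewrite xz zE yg eword_bact.
Qed.

(** * The kernel of the signed sums, integrally *)

Section IntegralKernel.
Variables (J : finType) (h k : J -> basis -> basis) (e : J -> int).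
Variables (D : set (basis -> int)) (chi : basis -> bool).
Hypothesis sD : subgroup D.
Hypothesis hk : forall j y, h j (k j y) = y.
Hypothesis Dk : forall j r, D ((r \o k j) - (fun y => e j * r y)).
Hypothesis chi1 : forall y, \sum_j (chi (k j y) : nat)%:Z = 1.

(* chi selects one representative in each class, to which the relations move
   every coefficient *)
Lemma rep_kernel f : (forall y, \sum_j e j * f (h j y) = 0) -> D f.
Proof.
move=> f0; pose r j y := f (h j y) * (chi y : nat)%:Z.
suff -> : f = \sum_j ((r j \o k j) - (fun y => e j * r j y)).
  by apply: subgroup_sum => // j _; exact: Dk.
apply/funext => y.
have sE (F : J -> basis -> int) : (\sum_j F j) y = \sum_j F j y.
  by rewrite (big_morph (fun g : basis -> int => g y) (id1 := 0) (op1 := +%R)).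
rewrite sE (eq_bigr (fun j => f y * (chi (k j y) : nat)%:Z -
    (e j * f (h j y)) * (chi y : nat)%:Z)); last first.
  by move=> j _; rewrite [LHS](_ : _ = r j (k j y) - e j * r j y)// /r hk; ring.
rewrite sumrB -mulr_sumr chi1 mulr1 -mulr_suml f0 mul0r subr0.
by [].
Qed.
End IntegralKernel.

Section ClassKernel.
Variables (J : finType) (h k : J -> basis -> basis) (e : J -> int) (T : Type).
Variables (D : set (basis -> int)) (c : basis -> T).
Hypothesis sD : subgroup D.
Hypothesis hk : forall j y, h j (k j y) = y.
Hypothesis kh : forall j y, k j (h j y) = y.
Hypothesis hi : forall y, injective (h^~ y).
Hypothesis Dk : forall j r, D ((r \o k j) - (fun y => e j * r y)).
Hypothesis cP : forall x y, c x = c y <-> exists j, x = h j y.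

Definition class_rep (y : basis) : basis := xget ybase [set z | c z = c y].

Lemma class_repP y : c (class_rep y) = c y.
Proof. by rewrite /class_rep; case: xgetP => [z _ /= -> //|/(_ y) /=]. Qed.

Lemma class_rep_eq x y : c x = c y -> class_rep x = class_rep y.
Proof. by rewrite /class_rep => ->. Qed.

(** By [cP] and [hi] the words act simply transitively on each class, so exactly one [k j y] is the
    chosen representative; this is the normalisation that [rep_kernel] asks of [chi]. *)
Lemma class_kernel f : (forall y, \sum_j e j * f (h j y) = 0) -> D f.
Proof.
apply: (rep_kernel (k := k) (chi := fun y => y == class_rep y)) => // y.
have ck j : c (k j y) = c y by apply/esym/cP; exists j; rewrite hk.
have [j0 yE] : exists j, y = h j (class_rep y) by apply/cP; rewrite class_repP.
rewrite (bigD1 j0)//= big1 => [|j jj].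
  by rewrite (class_rep_eq (ck j0)) {1}yE kh eqxx.
rewrite (class_rep_eq (ck j)); case: eqP => // e'.
by case/eqP: jj; apply: (hi (y := class_rep y)); rewrite /= -yE -e' hk.
Qed.

Lemma class_sum (F : basis -> int) y : y = class_rep y ->
  \sum_j e j * (if h j y == class_rep (h j y) then F (h j y) else 0) =
  \sum_(j | h j y == y) e j * F y.
Proof.
move=> yr; rewrite [RHS]big_mkcond; apply: eq_bigr => j _.
have -> : class_rep (h j y) = y.
  by rewrite [RHS]yr; apply: class_rep_eq; apply/cP; exists j.
by case: eqP => [->//|_]; rewrite mulr0.
Qed.

End ClassKernel.

Lemma DS_tword (j : 'I_3 * bool * bool) (r : basis -> int) :
  double_shuffles idfun ((r \o twordV j) - (fun y => (-1) ^+ j.1.2 * r y)).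
Proof.
have L := @locfin_all int; have bi := blabel_id.
case: j => [[i s] n]; rewrite /twordV /=.
pose a := r \o iter i rot2.
have ha : double_shuffles idfun (a - r).
  rewrite /a; case: (ord3_ex i) => -> /=.
  - by rewrite (_ : _ - _ = 0); [exact: DS0|apply/funext => y; exact: subrr].
  - have := DS_rot bi (L (r \o rot2)); congr double_shuffles; apply/funext => y.
    by rewrite !fsubE /= bas_rotK.
  - have := DSN (DS_rot bi (L r)); congr double_shuffles; apply/funext => y.
    rewrite [LHS](_ : _ = - (r y - r (rot y)))// fsubE /= !wE; ring.
pose b := a \o iter s swap.
have hb : double_shuffles idfun (b - (fun y => (-1) ^+ s * r y)).
  rewrite /b; case: (s) => /=.
    have := DSB (DS_swap (L a)) ha; congr double_shuffles; apply/funext => y.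
    rewrite [LHS](_ : _ = a y + a (swap y) - (a y - r y))// fsubE /= expr1; ring.
  move: ha; congr double_shuffles; apply/funext => y.
  by rewrite !fsubE /= expr0 mul1r.
case: n => /=; last first.
  by move: hb; congr double_shuffles.
have := DSB hb (DS_neg bi (L b)); congr double_shuffles; apply/funext => y.
by rewrite [LHS](_ : _ = b y - (-1) ^+ s * r y - (b y - b (neg y)))// fsubE /= /b /a /=; ring.
Qed.

Lemma WR_eword (j : bool * bool * bool) (r : basis -> int) :
  wedge_rels idfun ((r \o ewordV j) - (fun y => (-1) ^+ j.1.1 * r y)).
Proof.
have L := @locfin_all int; have bi := blabel_id.
have WD := @wedge_relsD _ (@idfun basis) int; have WN := @wedge_relsN _ (@idfun basis) int.
have W0 := @wedge_rels0 _ (@idfun basis) int.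
case: j => [[s n] a]; rewrite /ewordV /=.
pose b := r \o iter s swap.
have hb : wedge_rels idfun (b - (fun y => (-1) ^+ s * r y)).
  rewrite /b; case: (s) => /=.
    have := wedge_swap (L r); congr wedge_rels; apply/funext => y.
    by rewrite [LHS](_ : _ = r y + r (swap y))// fsubE /= expr1; ring.
  by rewrite (_ : _ - _ = 0)//; apply/funext => y; rewrite fsubE expr0 mul1r subrr.
pose d := b \o iter n neg.
have hd : wedge_rels idfun (d - (fun y => (-1) ^+ s * r y)).
  rewrite /d; case: (n) => /=; last by move: hb; congr wedge_rels.
  have := WD _ _ hb (WN _ (WD _ _ (wedge_neg1 (L b)) (wedge_neg2 (L (b \o neg1))))).
  congr wedge_rels; apply/funext => y.
  rewrite [LHS](_ : _ = b y - (-1) ^+ s * r y -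
    (b y - b (neg1 y) + (b (neg1 y) - b (neg1 (neg2 y)))))// fsubE /= neg1_neg2; ring.
case: a => /=; last by move: hd; congr wedge_rels.
have := WD _ _ hd (WN _ (wedge_neg1 (L d))).
congr wedge_rels; apply/funext => y.
by rewrite [LHS](_ : _ = d y - (-1) ^+ s * r y - (d y - d (neg1 y)))// fsubE /= /d /b /=; ring.
Qed.

(** * Orientations *)

Section Orientation.
Variable R : realType.
Implicit Types (C : set 'M[R]_2).

Lemma orient_mx n (b b' : n.-tuple 'M[R]_2) (M : 'M[R]_n) : free b ->
  (forall i, tnth b' i = \sum_j M i j *: tnth b j) -> orient b b' = sgz (\det M).
Proof.
move=> fb bE; rewrite /orient; congr (sgz (\det _)); apply/matrixP => i j.
rewrite mxE bE (eq_bigr (fun j => M i j *: b`_j)) => [|k _]; last by rewrite (tnth_nth 0).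
by rewrite (coord_sum_free (fun j => M i j)).
Qed.

Lemma span_coord n (b : n.-tuple 'M[R]_2) v : v \in <<b>>%VS ->
  v = \sum_j coord b j v *: tnth b j.
Proof.
move=> vb; rewrite {1}(coord_span vb); apply: eq_bigr => j _.
by rewrite (tnth_nth 0).
Qed.

Lemma orient_trans n (b b' b'' : n.-tuple 'M[R]_2) : free b -> free b' ->
  (forall i, tnth b' i \in <<b>>%VS) -> (forall i, tnth b'' i \in <<b'>>%VS) ->
  orient b b'' = orient b b' * orient b' b''.
Proof.
move=> fb fb' sb sb'; rewrite /orient mulrC -sgzM -det_mulmx.
apply: orient_mx => // i; rewrite {1}(span_coord (sb' i)).
transitivity (\sum_j coord b' j (tnth b'' i) *:
    \sum_k coord b k (tnth b' j) *: tnth b k).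
  by apply: eq_bigr => j _; rewrite -span_coord.
under eq_bigr do rewrite scaler_sumr.
rewrite exchange_big; apply: eq_bigr => k _.
rewrite mxE scaler_suml; apply: eq_bigr => j _.
by rewrite !mxE scalerA.
Qed.

Lemma orient_perm n (b b' : n.-tuple 'M[R]_2) (s : 'S_n) : free b ->
  (forall i, tnth b' i = tnth b (s i)) -> orient b b' = (-1) ^+ s.
Proof.
move=> fb bE; rewrite (@orient_mx _ _ _ (perm_mx s))//.
  by rewrite det_perm; case: (odd_perm s); rewrite ?expr1 ?expr0 ?sgzN ?sgz1.
move=> i; rewrite bE (bigD1 (s i))//= !mxE eqxx scale1r big1 ?addr0// => j js.
by rewrite !mxE eq_sym (negbTE js) scale0r.
Qed.

Lemma orient_id n (b : n.-tuple 'M[R]_2) : free b -> orient b b = 1.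
Proof. by move=> fb; rewrite (orient_perm (s := 1%g)) ?odd_perm1// => i; rewrite perm1. Qed.

Lemma frame_span n C (b b' : n.-tuple 'M[R]_2) : frame C b -> frame C b' ->
  forall i, tnth b' i \in <<b>>%VS.
Proof. by move=> [_ _ sb] [cb' _ _] i; exact: sb. Qed.

Lemma orient_frame n C (b b' b'' : n.-tuple 'M[R]_2) : frame C b -> frame C b' ->
  frame C b'' -> orient b b'' = orient b b' * orient b' b''.
Proof.
move=> h h' h''; apply: orient_trans; [by case: h|by case: h'| |].
  exact: frame_span h h'.
exact: frame_span h' h''.
Qed.

(** All frames of a set span the same space. Their size is what separates triangles from edges in
    [cell_tri] and [cell_edg]. *)
Lemma frame_size n m C (b : n.-tuple 'M[R]_2) (b' : m.-tuple 'M[R]_2) :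
  frame C b -> frame C b' -> n = m.
Proof.
have le n' m' (c : n'.-tuple 'M[R]_2) (c' : m'.-tuple 'M[R]_2) :
    frame C c -> frame C c' -> (n' <= m')%N.
  move=> [cC fc _] [_ _ sc].
  have : (<<c>> <= <<c'>>)%VS.
    by apply/span_subvP => v /tnthP [i ->]; exact: sc.
  move=> /dimvS; move: fc => /eqP ->; rewrite size_tuple => h.
  by apply: leq_trans h _; rewrite -{2}(size_tuple c') dim_span.
by move=> h h'; apply/eqP; rewrite eqn_leq (le _ _ _ _ h h') (le _ _ _ _ h' h).
Qed.

Lemma frame_intro n C (b b' : n.-tuple 'M[R]_2) : frame C b ->
  (forall i, C (tnth b' i)) -> free b' -> frame C b'.
Proof.
move=> [cb fb sb] cb' fb'; split=> // q Cq.
have sub : (<<b'>> <= <<b>>)%VS by apply/span_subvP => v /tnthP [i ->]; exact: sb.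
have /eqP -> : <<b'>>%VS == <<b>>%VS.
  rewrite eqEdim sub /=; move: fb fb' => /eqP -> /eqP ->.
  by rewrite !size_tuple.
exact: sb.
Qed.

Variable E : 'M[R]_2.
Local Notation pt := (phil E).

Definition fr k (l : 'I_k.+1 -> lat2) : k.+1.-tuple 'M[R]_2 :=
  [tuple phi (lvec E (l i)) | i < k.+1].

Lemma fr_tnth k (l : 'I_k.+1 -> lat2) i : tnth (fr l) i = pt (l i).
Proof. by rewrite tnth_mktuple. Qed.

Section Dual.
Variables (k : nat) (l : 'I_k.+1 -> lat2).
Variable d : 'I_k.+1 -> {linear 'M[R]_2 -> R^o}.
Hypothesis dl : forall i j, d i (pt (l j)) = (i == j)%:R.

Lemma fr_free : free (fr l).
Proof.
apply/freeP => c c0 i.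
have <- := dual_sum dl c i.
rewrite (_ : \sum_j _ = 0) ?linear0// -[RHS]c0; apply: eq_bigr => j _.
by rewrite -tnth_nth fr_tnth.
Qed.

Lemma simplexP q : simplex E l q <->
  exists s : 'I_k.+1 -> R, [/\ forall i, 0 <= s i, 0 < \sum_i s i &
    q = \sum_i s i *: pt (l i)].
Proof. exact: finite_coneP. Qed.

Lemma simplex_pt i : simplex E l (pt (l i)).
Proof.
apply/simplexP; exists (fun j => (j == i)%:R); split=> [j||].
- exact: ler0n.
- by rewrite (bigD1 i)//= eqxx big1 ?addr0 ?ltr01// => j /negbTE ->.
- by rewrite (bigD1 i)//= eqxx scale1r big1 ?addr0// => j /negbTE ->; rewrite scale0r.
Qed.

Lemma fr_frame : frame (simplex E l) (fr l).
Proof.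
split=> [i||q /simplexP [s [_ _ ->]]].
- by rewrite fr_tnth; exact: simplex_pt.
- exact: fr_free.
- apply: memv_suml => i _; apply/memvZ/memv_span.
  by rewrite -fr_tnth mem_tnth.
Qed.

End Dual.

Lemma simplex_eq k (l l' : 'I_k.+1 -> lat2) (s : 'S_k.+1) :
  (forall i, pt (l' i) = pt (l (s i))) -> simplex E l' = simplex E l.
Proof.
move=> e; rewrite /simplex; congr (cone (convex_hull _)); apply/seteqP; split=> _ [i _ <-].
  by exists (s i) => //; exact: esym (e i).
by exists (s^-1%g i) => //; rewrite [LHS]e permKV.
Qed.

End Orientation.

(** * Effect of the symmetries on the vertices of a cell *)

Section Words.
Variables (R : realType) (E : 'M[R]_2).
Hypothesis Eu : E \in unitmx.
Local Notation pt := (phil E).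

Lemma tri_swap y i : pt (tri (swap y) i) = pt (tri y (tperm ord0 (inord 1) i)).
Proof.
have [e1 e2 e3] := triE y; have [f1 f2 f3] := triE (swap y).
rewrite val_swap /= in f1 f2 f3.
case: (ord3P i) => ->.
- by rewrite tpermL e2 f1.
- by rewrite tpermR e1 f2.
- rewrite tpermD ?e3 ?f3 -?val_eqE /= ?inordK//.
  by congr pt; rewrite addrC.
Qed.

(** Written as a product of two transpositions, so that its parity can be read off. *)
Definition cyc3 : 'S_3 := (tperm ord0 (inord 1) * tperm ord0 ord_max)%g.

Lemma tri_rot y i : pt (tri (rot y) i) = pt (tri y (cyc3 i)).
Proof.
have [e1 e2 e3] := triE y; have [f1 f2 f3] := triE (rot y).
rewrite val_rot /= in f1 f2 f3.
case: (ord3P i) => ->; rewrite permM.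
- rewrite tpermL tpermD ?e2 ?f1 -?val_eqE /= ?inordK//.
- by rewrite tpermR tpermL e3 f2.
- rewrite [tperm _ (inord 1) _]tpermD ?tpermR ?e1 ?f3 -?val_eqE /= ?inordK//.
  by congr pt; rewrite opprB opprK addKr.
Qed.

Lemma tri_neg y i : pt (tri (neg y) i) = pt (tri y i).
Proof.
have [e1 e2 e3] := triE y; have [f1 f2 f3] := triE (neg y).
rewrite val_neg /= in f1 f2 f3.
case: (ord3P i) => ->; rewrite ?e1 ?e2 ?e3 ?f1 ?f2 ?f3 ?ptN//.
by rewrite -[RHS]ptN !opprD !opprK.
Qed.

Lemma edg_swap y i : pt (edg (swap y) i) = pt (edg y (tperm ord0 ord_max i)).
Proof.
have [e1 e2] := edgE y; have [f1 f2] := edgE (swap y); rewrite val_swap /= in f1 f2.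
by case: (ord2P i) => ->; rewrite ?tpermL ?tpermR ?e1 ?e2 ?f1 ?f2.
Qed.

Lemma edg_neg y i : pt (edg (neg y) i) = pt (edg y i).
Proof.
have [e1 e2] := edgE y; have [f1 f2] := edgE (neg y); rewrite val_neg /= in f1 f2.
by case: (ord2P i) => ->; rewrite ?e1 ?e2 ?f1 ?f2 ptN.
Qed.

Lemma edg_neg1 y i : pt (edg (neg1 y) i) = pt (edg y i).
Proof.
have [e1 e2] := edgE y; have [f1 f2] := edgE (neg1 y); rewrite val_neg1 /= in f1 f2.
by case: (ord2P i) => ->; rewrite ?e1 ?e2 ?f1 ?f2 ?ptN.
Qed.

End Words.

(** * Symbols as chains of oriented cells *)

Section GL2Action.
Variables (R : realType) (E : 'M[R]_2).
Hypothesis Eu : E \in unitmx.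
Local Notation pt := (phil E).
Local Notation gf := (@gform R E).

Lemma gform_pt g l : gf g (pt l) = pt (val g *m l).
Proof.
rewrite /gform /phil /phi; set hh := E *m _ *m _.
have <- : hh *m lvec E l = lvec E (val g *m l).
  by rewrite /hh /lvec map_mxM !mulmxA mulmxKV.
by rewrite (trmx_mul hh) !mulmxA.
Qed.

Lemma gform_lin g (a : R) q q' : gf g (a *: q + q') = a *: gf g q + gf g q'.
Proof. by rewrite /gform mulmxDr mulmxDl -scalemxAr -scalemxAl. Qed.

Lemma gformZ g (a : R) q : gf g (a *: q) = a *: gf g q.
Proof. by rewrite /gform -scalemxAr -scalemxAl. Qed.

Lemma gform0 g : gf g 0 = 0.
Proof. by rewrite -(scale0r (0 : 'M[R]_2)) gformZ !scale0r. Qed.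

Lemma gform_sum g n (s : 'I_n -> R) (x : 'I_n -> 'M[R]_2) :
  gf g (\sum_i s i *: x i) = \sum_i s i *: gf g (x i).
Proof.
elim/big_rec2: _ => [|i a b _ <-]; first exact: gform0.
by rewrite gform_lin.
Qed.

Lemma gformK g : cancel (gf g) (gf g^-1%g).
Proof.
move=> q; rewrite /gform; set a := E *m _ *m _; set b := E *m map_mx intr (val g) *m _.
have K : a *m b = 1%:M.
  rewrite /a /b !mulmxA mulmxKV// -[E *m _ *m _]mulmxA -map_mxM.
  rewrite -[val g^-1%g *m _]/(val (g^-1 * g)%g) mulVg.
  by rewrite map_mx1 mulmx1 mulmxV.
by clearbody a b; rewrite !mulmxA K mul1mx -mulmxA -trmx_mul K trmx1 mulmx1.
Qed.

Lemma gformKV g : cancel (gf g^-1%g) (gf g).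
Proof. by move=> q; rewrite -{1}[g]invgK gformK. Qed.

Lemma gform_simplex g k (l l' : 'I_k.+1 -> lat2) :
  (forall i, l' i = val g *m l i) -> gf g @` simplex E l = simplex E l'.
Proof.
move=> e; apply/seteqP; split=> [_ [q /finite_coneP [s [s0 s1 ->]] <-]|q].
  apply/finite_coneP; exists s; split=> //.
  by rewrite gform_sum; apply: eq_bigr => i _; rewrite e; congr (_ *: _); exact: gform_pt.
move=> /finite_coneP [s [s0 s1 ->]]; exists (\sum_i s i *: pt (l i)).
  by apply/finite_coneP; exists s.
by rewrite gform_sum; apply: eq_bigr => i _; rewrite e; congr (_ *: _); exact: gform_pt.
Qed.

Lemma gform_free g n (b : n.-tuple 'M[R]_2) :
  free b -> free [tuple of map (gf g) b].
Proof.
move=> /freeP fb; apply/freeP => c c0; apply: fb.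
apply: (can_inj (gformK g)); rewrite gform_sum.
rewrite gform0 -[RHS]c0; apply: eq_bigr => i _.
by rewrite (nth_map 0) ?size_tuple.
Qed.

Lemma gform_frame g n C (b : n.-tuple 'M[R]_2) : frame C b ->
  frame (gf g @` C) [tuple of map (gf g) b].
Proof.
move=> [cb fb sb]; split=> [i||_ [q Cq <-]].
- by rewrite tnth_map; exists (tnth b i).
- exact: gform_free.
- rewrite (span_coord (sb q Cq)) gform_sum; apply: memv_suml => i _.
  by apply/memvZ/memv_span; rewrite map_f ?mem_tnth.
Qed.

Lemma gform_orient g n (b b' : n.-tuple 'M[R]_2) : free b ->
  (forall i, tnth b' i \in <<b>>%VS) ->
  orient [tuple of map (gf g) b] [tuple of map (gf g) b'] = orient b b'.
Proof.
move=> fb sb; apply: orient_mx; first exact: gform_free.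
move=> i; rewrite tnth_map {1}(span_coord (sb i)) gform_sum.
by apply: eq_bigr => j _; rewrite mxE tnth_map.
Qed.

End GL2Action.

(* The common treatment of the triangles [h = tri] and of the edges [h = edg]. *)
Section Symbols.
Variables (R : realType) (E : 'M[R]_2).
Hypothesis Eu : E \in unitmx.
Local Notation pt := (phil E).
Variables (k : nat) (h : basis -> 'I_k.+1 -> lat2).
Variables (J : finType) (w wV : J -> basis -> basis) (e : J -> int).
Variables (D : set (basis -> int)) (sD : subgroup D).
Hypothesis wK : forall j y, w j (wV j y) = y.
Hypothesis wVK : forall j y, wV j (w j y) = y.
Hypothesis wi : forall y, injective (w^~ y).
Hypothesis wact : forall g j y, w j (bact g y) = bact g (w j y).
Hypothesis Dw : forall j r, D ((r \o wV j) - (fun y => e j * r y)).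
Hypothesis D0 : forall f y, D f -> \sum_j e j * f (w j y) = 0.
Hypothesis dual : forall y, exists d : 'I_k.+1 -> {linear 'M[R]_2 -> R^o},
  forall i j, d i (pt (h y j)) = (i == j)%:R.
Hypothesis hact : forall g y i, h (bact g y) i = val g *m h y i.
Hypothesis hcell : forall y, cell E (simplex E (h y)).
Hypothesis hP : forall x y, simplex E (h x) = simplex E (h y) <-> exists j, x = w j y.
Hypothesis horient : forall j y b, frame (simplex E (h y)) b ->
  orient (fr E (h (w j y))) b = e j * orient (fr E (h y)) b.
Hypothesis cell_h : forall C (b : k.+1.-tuple 'M[R]_2), cell E C -> frame C b ->
  exists y, C = simplex E (h y).

Definition term (f : basis -> int) (x : basis) C b : int :=
  f x * simplex_chain E (h x) C b.
Definition Psi (f : basis -> int) C b : int := \sum_(x \in [set: basis]) term f x C b.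

Lemma h_frame y : frame (simplex E (h y)) (fr E (h y)).
Proof. by have [d dE] := dual y; exact: fr_frame dE. Qed.

Lemma simplex_chainE x y b : frame (simplex E (h y)) b ->
  simplex_chain E (h x) (simplex E (h y)) b =
  if `[< simplex E (h y) = simplex E (h x) >] then orient (fr E (h x)) b else 0.
Proof.
move=> fb; rewrite /simplex_chain.
case: (asboolP (simplex E (h y) = simplex E (h x))) => e0.
  by rewrite ifT//; apply/asboolP; split.
by rewrite ifF//; apply/asboolP => -[].
Qed.

Lemma simplex_chain0 x C b : ~ (cell E C /\ frame C b) -> simplex_chain E (h x) C b = 0.
Proof. by move=> n; rewrite /simplex_chain ifF//; apply/asboolP => -[? ? _]; exact: n. Qed.

Lemma term_support f C b : exists s : seq basis, uniq s /\
  forall x, term f x C b <> 0 -> x \in s.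
Proof.
have [[cC fb]|n] := pselect (cell E C /\ frame C b); last first.
  by exists [::]; split=> // x; rewrite /term simplex_chain0// mulr0.
have [y yC] := cell_h cC fb.
exists [seq w j y | j <- enum J]; split.
  by rewrite map_inj_uniq ?enum_uniq//; exact: wi.
move=> x; rewrite /term yC simplex_chainE; last by rewrite -yC.
case: asboolP => [/esym/hP [j ->]|_]; last by rewrite mulr0.
by move=> _; apply/mapP; exists j; rewrite ?mem_enum.
Qed.

Lemma Psi_sum f : infinite_sum (term f) (Psi f).
Proof.
move=> C b; split=> //; have [s [_ sP]] := term_support f C b.
by apply: (sub_finite_set _ (finite_seq s)) => x /= /sP.
Qed.

Lemma Psi0 f C b : ~ (cell E C /\ frame C b) -> Psi f C b = 0.
Proof.
move=> n; rewrite /Psi (@fsum_supported _ _ _ [::])// ?big_nil// => x.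
by rewrite /term simplex_chain0// mulr0.
Qed.

(** Only the bases [w j y] have the cell of [y], and each contributes with the sign of its word. *)
Lemma PsiE f y b : frame (simplex E (h y)) b ->
  Psi f (simplex E (h y)) b = (\sum_j e j * f (w j y)) * orient (fr E (h y)) b.
Proof.
move=> fb; rewrite /Psi (@fsum_supported _ _ _ [seq w j y | j <- enum J]).
- rewrite big_map big_enum /= mulr_suml; apply: eq_bigr => j _.
  rewrite /term simplex_chainE// asboolT; last by apply/esym/hP; exists j.
  by rewrite horient//; ring.
- by rewrite map_inj_uniq ?enum_uniq//; exact: wi.
- move=> x; rewrite /term simplex_chainE//.
  case: asboolP => [/esym/hP [j ->]|_]; last by rewrite mulr0.
  by move=> _; apply/mapP; exists j; rewrite ?mem_enum.
Qed.

Lemma Psi_vchain f : vchain E (Psi f).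
Proof.
split=> [C b|C b b' cC fb fb']; first exact: Psi0.
have [y yC] := cell_h cC fb; rewrite yC in fb fb' *.
rewrite !PsiE// (orient_frame (h_frame y) fb fb'); ring.
Qed.

Definition psi_of (f : basis -> int) : Vor E k :=
  insubd 0 (Psi f : set 'M[R]_2 -> k.+1.-tuple 'M[R]_2 -> int).

Lemma val_psi_of f : val (psi_of f) = Psi f.
Proof. by rewrite val_insubd ifT//; apply/zclosedP; exact: Psi_vchain. Qed.

Lemma PsiB f f' : Psi (f - f') = Psi f - Psi f'.
Proof.
apply/funext => C; apply/funext => b.
rewrite [RHS](_ : _ = Psi f C b - Psi f' C b)//.
have [[cC fb]|n] := pselect (cell E C /\ frame C b); last by rewrite !Psi0// subrr.
have [y yC] := cell_h cC fb; rewrite yC in fb *; rewrite !PsiE// -mulrBl -sumrB.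
by congr (_ * _); apply: eq_bigr => j _; rewrite fsubE mulrBr.
Qed.

Lemma Psi_D f : D f -> Psi f = 0.
Proof.
move=> Df; apply/funext => C; apply/funext => b; rewrite [RHS]/(0 : int).
have [[cC fb]|n] := pselect (cell E C /\ frame C b); last exact: Psi0.
by have [y yC] := cell_h cC fb; rewrite yC in fb *; rewrite PsiE// D0// mul0r.
Qed.

Local Notation M := (subquot (zclosed (@locfin_subgroup basis basis int idfun)) (zclosed sD)).
Local Notation mcls := (cls (zclosed (@locfin_subgroup basis basis int idfun)) (zclosed sD)).

Lemma all_locfin (f : basis -> int) : f \in zclosed (@locfin_subgroup basis basis int idfun).
Proof. by apply/zclosedP; exact: locfin_id. Qed.

Let psi_rel f : f \in zclosed (@locfin_subgroup basis basis int idfun) ->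
  f \in zclosed sD -> psi_of f = 0.
Proof. by move=> _ /zclosedP Df; apply: val_inj; rewrite val_psi_of Psi_D. Qed.

Let psi_sub : {in zclosed (@locfin_subgroup basis basis int idfun) &,
  {morph psi_of : f f' / f - f'}}.
Proof.
move=> f f' _ _; apply: val_inj; rewrite val_psi_of PsiB -!val_psi_of.
exact: esym (raddfB _ _ _).
Qed.

Definition psi (m : M) : Vor E k := qlift psi_of m.

Lemma val_psi f : val (psi (mcls f)) = Psi f.
Proof. by rewrite /psi (qliftE psi_rel psi_sub) ?val_psi_of ?all_locfin. Qed.

Lemma psi_additive : zmod_morphism psi.
Proof. exact: (qliftB psi_rel psi_sub). Qed.

Lemma psi_inj : injective psi.
Proof.
move=> m m' /eqP; rewrite -subr_eq0 -psi_additive => /eqP H.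
apply/eqP; rewrite -subr_eq0; apply/eqP; move: H; move: (m - m') => {m m'} m.
have [f _ ->] := cls_surj m => /(congr1 val); rewrite val_psi => f0.
apply/cls_eq0; first exact: all_locfin.
apply/zclosedP; apply: (class_kernel sD wK wVK wi Dw hP) => y.
have := congr1 (fun F => F (simplex E (h y)) (fr E (h y))) f0.
rewrite PsiE; last exact: h_frame.
rewrite orient_id ?mulr1//; last by case: (h_frame y).
Qed.

Lemma psi_surj (v : Vor E k) : exists m, psi m = v.
Proof.
pose F y := val v (simplex E (h y)) (fr E (h y)).
pose rep := class_rep (fun y => simplex E (h y)).
(* The coefficient of each cell is put on a single basis; spread over all the bases of the cell it
   would be counted once for each word. *)
pose f y := if y == rep y then F y else 0.
exists (mcls f); apply: val_inj; rewrite val_psi.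
have [v0 vo] : vchain E (val v) := (zclosedP (@vchain_subgroup R E k) (val v)).1 (subz_valP v).
apply/funext => C; apply/funext => b.
have [[cC fb]|n] := pselect (cell E C /\ frame C b); last by rewrite Psi0// v0.
have [z zC] := cell_h cC fb.
have [y [yr yC]] : exists y, y = rep y /\ C = simplex E (h y).
  exists (rep z); split; last by rewrite zC /rep (class_repP (fun y => simplex E (h y))).
  by apply: class_rep_eq; rewrite (class_repP (fun y => simplex E (h y))).
rewrite yC in cC fb *; rewrite PsiE// (class_sum e hP)//.
have w1 : exists j, w j y = y by have [j jE] := (hP y y).1 erefl; exists j.
have [j0 j0E] := w1.
rewrite (bigD1 j0) /=; last by rewrite j0E.
rewrite big1 ?addr0 => [|j /andP[/eqP jE /eqP jj]]; last first.
  by case: jj; apply: (wi (y := y)); rewrite /= jE j0E.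
have e1 : e j0 = 1.
  have := horient j0 (h_frame y); rewrite j0E orient_id ?mulr1 //.
  by case: (h_frame y).
rewrite e1 mul1r /F (vo _ (fr E (h y)) b)//; last exact: h_frame.
by rewrite mulrC.
Qed.

Lemma psi_bij : bijective psi.
Proof.
pose inv v := projT1 (cid (psi_surj v)).
have invK v : psi (inv v) = v by exact: projT2 (cid (psi_surj v)).
by exists inv => // m; apply: psi_inj; rewrite invK.
Qed.

Lemma symbols_iso : exists2 p : {additive M -> Vor E k},
  forall f, val (p (mcls f)) = Psi f & bijective p.
Proof.
pose p : {additive M -> Vor E k} := HB.pack psi
  (GRing.isZmodMorphism.Build _ _ psi psi_additive).
by exists p; [exact: val_psi|exact: psi_bij].
Qed.

Lemma Psi_act g f : Psi (f \o bact g^-1%g) = vact E g (Psi f).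
Proof.
apply/funext => C; apply/funext => b; rewrite /vact.
have [[cC fb]|n] := pselect (cell E C /\ frame C b); last first.
  rewrite [LHS]Psi0// [RHS]Psi0// => -[cC fb]; apply: n.
  have [y yC] := cell_h cC fb.
  have CE : C = simplex E (h (bact g y)).
    rewrite -(gform_simplex Eu (g := g) (hact g y)) -yC image_comp.
    by rewrite (_ : _ \o _ = id) ?image_id//; apply/funext => q; exact: gformKV.
  split; first by rewrite CE.
  have := gform_frame Eu g fb; rewrite image_comp.
  rewrite (_ : _ \o _ = id) ?image_id; last by apply/funext => q; exact: gformKV.
  congr frame; apply: val_inj; rewrite /= -map_comp map_id_in// => q _.
  exact: gformKV.
have [y yC] := cell_h cC fb; rewrite yC in fb *.
have gC : gform E g^-1%g @` simplex E (h y) = simplex E (h (bact g^-1%g y)).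
  exact: (gform_simplex Eu (hact g^-1%g y)).
have fb' := gform_frame Eu g^-1%g fb; rewrite gC in fb' *.
rewrite !PsiE//; congr (_ * _).
  by apply: eq_bigr => j _; rewrite /= wact.
have -> : fr E (h (bact g^-1%g y)) = [tuple of map (gform E g^-1%g) (fr E (h y))].
  apply: eq_from_tnth => i; rewrite tnth_map !fr_tnth hact gform_pt//.
rewrite gform_orient//; first by case: (h_frame y).
exact: frame_span (h_frame y) fb.
Qed.

End Symbols.

(** * Which bases give the same cell *)

Section Classes.
Variables (R : realType) (E : 'M[R]_2).
Hypothesis Eu : E \in unitmx.
Local Notation pt := (phil E).
Local Notation "'T' y" := (simplex E (tri y)) (at level 10, y at level 9).
Local Notation "'S' y" := (simplex E (edg y)) (at level 10, y at level 9).

Lemma primitive_lin y (a : int) (b : int * int) : primitive (lin y (a * b.1, a * b.2)) ->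
  a = 1 \/ a = -1.
Proof.
move=> [_ /(_ a (lin y b))]; rewrite /lin scalerDr !scalerA => /(_ erefl).
exact: unitz.
Qed.

(** The forms a (a - b), b (b - a) and a b are nonnegative at the three vertices, hence on the cone.
    Integers with this property satisfy a = 0, b = 0 or a = b, and primitivity leaves the six
    vectors of the hexagon. *)
Lemma tri_mem y w : primitive w -> T y (pt w) -> exists2 a, w = lin y a & a \in hexagon.
Proof.
have [a [b ->]] := vec_ex y w => wp wT; exists (a, b) => //.
have key (al be ga : R) : 0 <= al -> 0 <= be -> 0 <= al + be + ga ->
    0 <= al * a%:~R ^+ 2 + be * b%:~R ^+ 2 + ga * a%:~R * b%:~R.
  move=> h1 h2 h3; have [u uE] := form_ex Eu y al be ga.
  rewrite -uE; move: wT => /finite_coneP [s [s0 _ ->]].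
  rewrite linear_sum; apply: sumr_ge0 => i _; rewrite lformZ mulr_ge0//.
  have [e1 e2 e3] := tri_vec y; rewrite -/(phil E _).
  case: (ord3P i) => ->; [rewrite e1|rewrite e2|rewrite e3]; rewrite uE; lra.
have k1 : 0 <= a * (a - b).
  have h : (0 : R) <= (a * (a - b))%:~R.
    have h1 : (0 : R) <= 1 + 0 + -1 by lra.
    by have := key _ _ _ ler01 (lexx 0) h1; rewrite intrM intrB; lra.
  by move: h; rewrite ler0z.
have k2 : 0 <= b * (b - a).
  have h : (0 : R) <= (b * (b - a))%:~R.
    have h1 : (0 : R) <= 0 + 1 + -1 by lra.
    by have := key _ _ _ (lexx 0) ler01 h1; rewrite intrM intrB; lra.
  by move: h; rewrite ler0z.
have k3 : 0 <= a * b.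
  have h : (0 : R) <= (a * b)%:~R.
    have h1 : (0 : R) <= 0 + 0 + 1 by lra.
    by have := key _ _ _ (lexx 0) (lexx 0) h1; rewrite intrM; lra.
  by move: h; rewrite ler0z.
have [b0|a0|ab] : [\/ b = 0, a = 0 | a = b].
  have [->|b0] := eqVneq b 0; first exact: Or31.
  have [->|a0] := eqVneq a 0; first exact: Or32.
  by apply: Or33; nia.
- have := @primitive_lin y a (1, 0); rewrite /= mulr1 mulr0 -{1}b0 => /(_ wp).
  by rewrite b0; case=> ->.
- have := @primitive_lin y b (0, 1); rewrite /= mulr1 mulr0 -{1}a0 => /(_ wp).
  by rewrite a0; case=> ->.
- have := @primitive_lin y a (1, 1); rewrite /= mulr1 {2}ab => /(_ wp).
  by rewrite -ab; case=> ->.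
Qed.

Lemma edg_mem y w : primitive w -> S y (pt w) -> exists2 a, w = lin y a & a \in square.
Proof.
have [a [b ->]] := vec_ex y w => wp wT; exists (a, b) => //.
have [u uE] := form_ex Eu y 0 0 1.
have ab : a * b = 0.
  apply: (@intr_inj R); rewrite intrM.
  transitivity (u (pt (vec y a b))); first by rewrite uE; ring.
  move: wT => /finite_coneP [s [_ _ ->]]; rewrite linear_sum big1// => i _.
  rewrite lformZ; have [e1 e2] := edg_vec y; rewrite -/(phil E _).
  by case: (ord2P i) => ->; [rewrite e1|rewrite e2]; rewrite uE; ring.
move/eqP: ab; rewrite mulf_eq0 => /orP[/eqP a0|/eqP b0].
- have := @primitive_lin y b (0, 1); rewrite /= mulr1 mulr0 -{1}a0 => /(_ wp).
  by rewrite a0; case=> ->.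
- have := @primitive_lin y a (1, 0); rewrite /= mulr1 mulr0 -{1}b0 => /(_ wp).
  by rewrite b0; case=> ->.
Qed.

Lemma tri_pt y i : T y (pt (tri y i)).
Proof. exact: simplex_pt. Qed.
Lemma edg_pt y i : S y (pt (edg y i)).
Proof. exact: simplex_pt. Qed.

Lemma simplex_eq1 k (l l' : 'I_k.+1 -> lat2) :
  (forall i, pt (l' i) = pt (l i)) -> simplex E l' = simplex E l.
Proof. by move=> e; apply: (@simplex_eq _ _ _ _ _ 1%g) => i; rewrite perm1. Qed.

Lemma T_swap y : T (swap y) = T y. Proof. exact: (simplex_eq (tri_swap E y)). Qed.
Lemma T_rot y : T (rot y) = T y. Proof. exact: (simplex_eq (tri_rot E y)). Qed.
Lemma T_neg y : T (neg y) = T y. Proof. exact: (simplex_eq1 (tri_neg E y)). Qed.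
Lemma S_swap y : S (swap y) = S y. Proof. exact: (simplex_eq (edg_swap E y)). Qed.
Lemma S_neg y : S (neg y) = S y. Proof. exact: (simplex_eq1 (edg_neg E y)). Qed.
Lemma S_neg1 y : S (neg1 y) = S y. Proof. exact: (simplex_eq1 (edg_neg1 E y)). Qed.

Lemma tri_class x y : T x = T y <-> exists j, x = tword j y.
Proof.
split=> [xy|[[[i s] n] ->]]; last first.
  rewrite /tword /=.
  have -> z : T (iter n neg z) = T z by case: n => //=; exact: T_neg.
  have -> z : T (iter s swap z) = T z by case: s => //=; exact: T_swap.
  by elim: (val i) => //= m <-; exact: T_rot.
have mem i : exists2 a, tri x i = lin y a & a \in hexagon.
  by apply: tri_mem; [exact: tri_primitive|rewrite -xy; exact: tri_pt].
have [e1 e2 e3] := triE x.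
have [a aE ha] := mem ord0; have [b bE hb] := mem (inord 1); have [c cE hc] := mem ord_max.
rewrite e1 in aE; rewrite e2 in bE; rewrite e3 in cE.
exact: (tword_complete aE bE cE ha hb hc).
Qed.

Lemma edg_class x y : S x = S y <-> exists j, x = eword j y.
Proof.
split=> [xy|[[[s n] m] ->]]; last first.
  rewrite /eword /=.
  have -> z : S (iter m neg1 z) = S z by case: m => //=; exact: S_neg1.
  have -> z : S (iter n neg z) = S z by case: n => //=; exact: S_neg.
  by case: s => //=; exact: S_swap.
have mem i : exists2 a, edg x i = lin y a & a \in square.
  by apply: edg_mem; [exact: edg_primitive|rewrite -xy; exact: edg_pt].
have [e1 e2] := edgE x.
have [a aE ha] := mem ord0; have [b bE hb] := mem ord_max.
rewrite e1 in aE; rewrite e2 in bE.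
exact: (eword_complete aE bE ha hb).
Qed.

Lemma tri_frame y : frame (T y) (fr E (tri y)).
Proof. by have [d dE] := tri_dual Eu y; exact: (fr_frame dE). Qed.
Lemma edg_frame y : frame (S y) (fr E (edg y)).
Proof. by have [d dE] := edg_dual Eu y; exact: (fr_frame dE). Qed.

Lemma fr_perm k (l l' : 'I_k.+1 -> lat2) (s : 'S_k.+1) C b :
  (forall i, pt (l' i) = pt (l (s i))) -> frame C (fr E l) -> frame C b ->
  orient (fr E l') b = (-1) ^+ s * orient (fr E l) b.
Proof.
move=> e fl fb.
have fl' : frame C (fr E l').
  apply: (frame_intro fl) => [i|].
    by rewrite fr_tnth e; have [cl _ _] := fl; have := cl (s i); rewrite fr_tnth.
  apply/freeP => c c0 i; have [_ /freeP ff _] := fl.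
  have := ff (fun j => c (s^-1%g j)) _ (s i); rewrite permK; apply.
  rewrite -[RHS]c0 (reindex_inj (perm_inj (s := s))) /=; apply: eq_bigr => j _.
  rewrite permK; congr (_ *: _).
  by rewrite -[LHS](tnth_nth 0 (fr E l)) -[RHS](tnth_nth 0 (fr E l')) !fr_tnth e.
rewrite (orient_frame fl' fl fb); congr (_ * _).
rewrite (@orient_perm _ _ _ _ s^-1%g); [by rewrite odd_permV| by case: fl'|].
by move=> i; rewrite !fr_tnth e permKV.
Qed.

Lemma orient_tri_swap y b : frame (T y) b ->
  orient (fr E (tri (swap y))) b = - orient (fr E (tri y)) b.
Proof.
move=> fb; rewrite (fr_perm (tri_swap E y) (tri_frame y) fb) odd_tperm.
by rewrite -val_eqE /= inordK//= expr1 mulN1r.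
Qed.

Lemma orient_tri_rot y b : frame (T y) b ->
  orient (fr E (tri (rot y))) b = orient (fr E (tri y)) b.
Proof.
move=> fb; rewrite (fr_perm (tri_rot E y) (tri_frame y) fb) /cyc3 odd_permM !odd_tperm.
by rewrite -!val_eqE /= inordK//= expr0 mul1r.
Qed.

Lemma orient_same k (l l' : 'I_k.+1 -> lat2) b :
  (forall i, pt (l' i) = pt (l i)) -> orient (fr E l') b = orient (fr E l) b.
Proof.
move=> e; suff -> : fr E l' = fr E l by [].
by apply: eq_from_tnth => i; rewrite !fr_tnth e.
Qed.

Lemma orient_tword j y b : frame (T y) b ->
  orient (fr E (tri (tword j y))) b = (-1) ^+ j.1.2 * orient (fr E (tri y)) b.
Proof.
move=> fb; case: j => [[i s] n]; rewrite /tword /=.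
have -> z : orient (fr E (tri (iter n neg z))) b = orient (fr E (tri z)) b.
  by case: n => //=; apply: orient_same; exact: tri_neg.
have [fi oi] : frame (T (iter i rot y)) b /\
    orient (fr E (tri (iter i rot y))) b = orient (fr E (tri y)) b.
  elim: (val i) => //= m [fm om]; split; first by rewrite T_rot.
  by rewrite orient_tri_rot.
case: s => /=; last by rewrite expr0 mul1r.
by rewrite orient_tri_swap// oi expr1 mulN1r.
Qed.

Lemma orient_eword j y b : frame (S y) b ->
  orient (fr E (edg (eword j y))) b = (-1) ^+ j.1.1 * orient (fr E (edg y)) b.
Proof.
move=> fb; case: j => [[s n] m]; rewrite /eword /=.
have -> z : orient (fr E (edg (iter m neg1 z))) b = orient (fr E (edg z)) b.
  by case: m => //=; apply: orient_same; exact: edg_neg1.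
have -> z : orient (fr E (edg (iter n neg z))) b = orient (fr E (edg z)) b.
  by case: n => //=; apply: orient_same; exact: edg_neg.
case: s => /=; last by rewrite expr0 mul1r.
by rewrite (fr_perm (edg_swap E y) (edg_frame y) fb) odd_tperm.
Qed.

Lemma cell_tri C (b : 3.-tuple 'M[R]_2) : cell E C -> frame C b -> exists y, C = T y.
Proof.
move=> /(cell_simplex Eu) [y [->|->]] fb; first by exists y.
by have := frame_size fb (edg_frame y).
Qed.

Lemma cell_edg C (b : 2.-tuple 'M[R]_2) : cell E C -> frame C b -> exists y, C = S y.
Proof.
move=> /(cell_simplex Eu) [y [->|->]] fb; last by exists y.
by have := frame_size fb (tri_frame y).
Qed.

Lemma tri_bact g y i : tri (bact g y) i = val g *m tri y i.
Proof.
have [e1 e2 e3] := triE y; have [f1 f2 f3] := triE (bact g y); rewrite /= in f1 f2 f3.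
case: (ord3P i) => ->; rewrite ?e1 ?e2 ?e3 ?f1 ?f2 ?f3//.
by rewrite mulmxBr mulmxN.
Qed.

Lemma edg_bact g y i : edg (bact g y) i = val g *m edg y i.
Proof.
have [e1 e2] := edgE y; have [f1 f2] := edgE (bact g y); rewrite /= in f1 f2.
by case: (ord2P i) => ->; rewrite ?e1 ?e2 ?f1 ?f2.
Qed.

Lemma DS_sum (f : basis -> int) y : double_shuffles idfun f ->
  \sum_(j : 'I_3 * bool * bool) (-1) ^+ j.1.2 * f (tword j y) = 0.
Proof.
by move=> Df; rewrite tword_sum S1E -[LHS]/(vavg (sgn f) y *~ bdet y) (sgn_DS y Df) mul0rz.
Qed.

Lemma WR_sum (f : basis -> int) y : wedge_rels idfun f ->
  \sum_(j : bool * bool * bool) (-1) ^+ j.1.1 * f (eword j y) = 0.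
Proof.
by move=> Df; rewrite eword_sum S2E -[LHS]/(eavg (sgn f) y *~ bdet y) (sgn_WR y Df) mul0rz.
Qed.

(** The determinant changes sign across the edge, which turns the difference of [eavg_rsum] into a
    sum: both triangles on the edge enter with the same sign. *)
Lemma mdiff_S2 (f : basis -> int) y : S2 (mdiff f) y = - (S1 f y + S1 f (neg1 y)).
Proof.
rewrite S2E !S1E.
have -> : sgn (mdiff f) = - rsum (sgn f) by apply/funext => z; rewrite mdiff_sgn.
by rewrite /sgn eavgN eavg_rsum bdet_neg1 mulrNz -mulrzBl mulNrz.
Qed.

End Classes.

Lemma lift_max_widen n (j : 'I_n) : lift ord_max j = widen_ord (leqnSn n) j.
Proof. by apply: val_inj; exact: lift_max. Qed.

(** * The boundary *)

Section Boundary.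
Variables (R : realType) (E : 'M[R]_2).
Hypothesis Eu : E \in unitmx.
Local Notation pt := (phil E).
Local Notation "'T' y" := (simplex E (tri y)) (at level 10, y at level 9).
Local Notation "'S' y" := (simplex E (edg y)) (at level 10, y at level 9).

Lemma tri_edg y (j : 'I_2) : tri y (lift ord_max j) = edg y j.
Proof.
have [e1 e2 _] := triE y; have [f1 f2] := edgE y.
case: (ord2P j) => ->; [rewrite f1 -e1|rewrite f2 -e2]; congr (tri y _); apply: val_inj => //=.
by rewrite inordK.
Qed.

Lemma edg_sub y : S y `<=` T y.
Proof.
move=> _ /simplexP [s [s0 s1 ->]]; apply/simplexP.
exists (fun i => if unlift ord_max i is Some j then s j else 0); split.
- by move=> i; case: unlift.
- rewrite big_ord_recr unlift_none /= addr0; move: s1; congr (0 < _).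
  by apply: eq_bigr => j _; rewrite -lift_max_widen liftK.
- rewrite [RHS]big_ord_recr unlift_none /= scale0r addr0; apply: eq_bigr => j _.
  by rewrite -lift_max_widen liftK tri_edg.
Qed.

(** The ends [a], [b] of the edge form a basis inside the hexagon of [x], so either -a - b or a - b
    lies in that hexagon as well: the third vertex for [y] or for [neg1 y]. *)
Lemma tri_over_edg x y : S y `<=` T x -> T x = T y \/ T x = T (neg1 y).
Proof.
move=> yx; have [f1 f2] := edgE y.
have mem i : exists2 a, edg y i = lin x a & a \in hexagon.
  by apply: (tri_mem Eu); [exact: edg_primitive|apply/yx; exact: edg_pt].
have [a aE ha] := mem ord0; have [b bE hb] := mem ord_max.
rewrite f1 in aE; rewrite f2 in bE.
have hN c : c \in hexagon -> (- c.1, - c.2) \in hexagon.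
  by rewrite /hexagon !inE; case/or4P => [/eqP ->|/eqP ->|/eqP ->|/or3P[]/eqP ->].
have linN c : lin x (- c.1, - c.2) = - lin x c by rewrite /lin /= !scaleNr opprD.
have linB c d : lin x (c.1 - d.1, c.2 - d.2) = lin x c - lin x d.
  by rewrite /lin /= !scalerBl opprD addrACA.
have [hc|hc] : (- a.1 - b.1, - a.2 - b.2) \in hexagon \/
               (a.1 - b.1, a.2 - b.2) \in hexagon.
  have [g _ [z _ zab]] := lin_cor aE bE.
  have := bdet2 z; rewrite /bdet; move: zab => [-> ->] /eqP d.
  move: ha hb d; rewrite /hexagon !inE.
  by case/or4P => [/eqP ->|/eqP ->|/eqP ->|/or3P[]/eqP ->];
    case/or4P => [/eqP ->|/eqP ->|/eqP ->|/or3P[]/eqP ->]; vm_compute; auto.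
- left; apply/esym/(tri_class Eu); apply: (tword_complete aE bE _ ha hb hc).
  by rewrite (linB (- a.1, - a.2)) linN aE bE.
- right; apply/esym/(tri_class Eu).
  apply: (tword_complete (x := neg1 y) _ bE _ (hN _ ha) hb hc).
    by rewrite linN -aE.
  by rewrite val_neg1 /= opprK linB aE bE.
Qed.

Lemma tri_neg1_neq y : T y <> T (neg1 y).
Proof.
move=> e; have [_ _ e3] := triE (neg1 y).
have : T y (pt (tri (neg1 y) ord_max)) by rewrite e; exact: tri_pt.
move=> /(tri_mem Eu (tri_primitive _ _)) [a]; rewrite e3 val_neg1 /= opprK => aE.
suff -> : a = (1, -1) by [].
by apply: (@lin_inj y); rewrite -aE /lin /= scale1r scaleN1r.
Qed.

(** The vertex opposite to the edge qualifies: otherwise the two vectors of [b] would span the three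
    independent vertices of the triangle. *)
Lemma off_span y (b : 2.-tuple 'M[R]_2) : frame (S y) b ->
  exists q, T y q /\ q \notin <<b>>%VS.
Proof.
move=> [_ _ sb]; exists (pt (tri y ord_max)); split; first exact: tri_pt.
apply/negP => hb; have [_ /eqP ft _] := tri_frame Eu y.
suff /dimvS : (<<fr E (tri y)>> <= <<b>>)%VS.
  rewrite ft size_tuple => h; have := leq_trans h (dim_span b).
  by rewrite size_tuple.
apply/span_subvP => _ /tnthP [i ->]; rewrite fr_tnth.
by case: (unliftP ord_max i) => [j|] ->//; rewrite tri_edg; apply: sb; exact: edg_pt.
Qed.

Lemma frame_over y q (b : 2.-tuple 'M[R]_2) : frame (S y) b -> T y q ->
  q \notin <<b>>%VS -> frame (T y) [tuple of q :: b].
Proof.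
move=> [cb fb _] Tq qb; apply: (frame_intro (tri_frame Eu y)).
  move=> i; case: (unliftP ord0 i) => [j|] ->; rewrite ?tnth0// tnthS.
  exact/edg_sub.
by rewrite free_cons qb.
Qed.

(** In the change of frame the column of the opposite vertex has a single nonzero entry, the
    coordinate of [q]. It is positive since [q] lies in the cone and off the span of the edge, and
    its place (0, 2) carries the sign +1, so the cofactor compares the orientations of the edge. *)
Lemma orient_over y q (b : 2.-tuple 'M[R]_2) : frame (S y) b -> T y q ->
  q \notin <<b>>%VS ->
  orient (fr E (tri y)) [tuple of q :: b] = orient (fr E (edg y)) b.
Proof.
move=> fb Tq qb.
have [_ ft _] := tri_frame Eu y; have [_ fe _] := edg_frame Eu y.
have [s [s0 _ qE]] := (simplexP _ _ _).1 Tq.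
pose c i j := coord (fr E (edg y)) j (tnth b i).
have bE i : tnth b i = \sum_j c i j *: pt (edg y j).
  rewrite {1}(span_coord (frame_span (edg_frame Eu y) fb i)).
  by apply: eq_bigr => j _; rewrite fr_tnth.
pose M := \matrix_(i < 3, j < 3) if unlift ord0 i is Some i' then
   (if unlift ord_max j is Some j' then c i' j' else 0) else s j.
have s3 : 0 < s ord_max.
  rewrite lt_neqAle s0 andbT; apply/eqP => s30; case/negP: qb.
  rewrite qE big_ord_recr /= -s30 scale0r addr0; apply: memv_suml => j _.
  apply: memvZ; rewrite -lift_max_widen tri_edg.
  by have [_ _ sb] := fb; apply: sb; exact: edg_pt.
rewrite (@orient_mx _ _ _ _ M)//; last first.
  move=> i; case: (unliftP ord0 i) => [i'|] ->.
    rewrite tnthS bE [RHS]big_ord_recr !mxE liftK unlift_none /= scale0r addr0.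
    by apply: eq_bigr => j _; rewrite mxE liftK -lift_max_widen liftK fr_tnth tri_edg.
  rewrite tnth0 qE; apply: eq_bigr => j _.
  by rewrite mxE unlift_none fr_tnth.
rewrite (expand_det_col M ord_max) big_ord_recl big1 ?addr0; last first.
  by move=> i _; rewrite mxE liftK unlift_none mul0r.
rewrite mxE unlift_none sgzM gtr0_sgz// mul1r /cofactor /= expr2 mulN1r opprK mul1r.
rewrite /orient; congr (sgz (\det _)); apply/matrixP => i j.
by rewrite !mxE liftK liftK.
Qed.

Let PsiTE f y b := PsiE tword_inj (tri_cell Eu) (tri_class Eu) (orient_tword Eu)
  f (y := y) (b := b).
Let PsiSE f y b := PsiE eword_inj (edg_cell Eu) (edg_class Eu) (orient_eword Eu)
  f (y := y) (b := b).

Lemma vboundary_Psi f : vboundary E (Psi E tri f) = Psi E edg (mdiff f).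
Proof.
apply/funext => C; apply/funext => b; rewrite /vboundary.
case: asboolP => [[cC fb]|n]; last by rewrite Psi0.
have [y yC] := cell_edg Eu cC fb; subst C.
pose q C' : 'M[R]_2 := xget 0 [set q | C' q /\ q \notin <<b>>%VS].
have TS z : S z = S y -> T z (q (T z)) /\ q (T z) \notin <<b>>%VS.
  move=> zy; apply: (@xgetPex _ _ [set q | T z q /\ q \notin <<b>>%VS]).
  by apply: off_span; rewrite zy.
have val_over z : S z = S y ->
    Psi E tri f (T z) [tuple of q (T z) :: b] = S1 f z * orient (fr E (edg z)) b.
  move=> zy; have [Tq qb] := TS z zy; have fz : frame (S z) b by rewrite zy.
  by rewrite PsiTE ?tword_sum ?orient_over//; exact: frame_over.
have n1 := S_neg1 E y.
have nS := tri_neg1_neq (y := y).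
rewrite -[\sum_(C' \in _) _]/(\sum_(C' \in [set C' | cell E C' /\ S y `<=` C'])
  Psi E tri f C' [tuple of q C' :: b]).
have -> : \sum_(C' \in [set C' | cell E C' /\ S y `<=` C'])
    Psi E tri f C' [tuple of q C' :: b] =
  \sum_(C' <- [:: T y; T (neg1 y)]) Psi E tri f C' [tuple of q C' :: b].
  rewrite [RHS]fsbig_seq; last first.
    by rewrite /= andbT inE; apply/eqP.
  apply/esym/fsbig_widen.
    move=> C'; rewrite /= !inE => /orP[/eqP ->|/eqP ->]; split; try exact: tri_cell.
      exact: edg_sub.
    by rewrite -n1; exact: edg_sub.
  move=> C' /= [[cC' sC'] /negP nC']; rewrite !inE negb_or in nC'.
  (* A cell over the edge for which [q C' :: b] is no frame contributes nothing. This includes the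
     edge itself, which has no point off the span, so that [xget] returns 0. *)
  have [fC'|nf] := pselect (frame C' [tuple of q C' :: b]); last first.
    by rewrite Psi0// => -[].
  have [x xC] := cell_tri Eu cC' fC'; move: nC' sC'; rewrite xC => /andP[/eqP h1 /eqP h2].
  by move=> /tri_over_edg [].
rewrite big_cons big_seq1 !val_over// PsiSE// eword_sum mdiff_S2.
rewrite (orient_same _ (edg_neg1 E y)); ring.
Qed.

End Boundary.

Theorem theorem6p1 :
  (forall (R : realType) (E : 'M[R]_2), E \in unitmx ->
     exists (psi1 : {additive M1 -> Vor E 2}) (psi2 : {additive M2 -> Vor E 1}),
       [/\ forall f : basis -> int,
             infinite_sum
               (fun x C b => f x *
                  simplex_chain E
                    (tnth [tuple (val x).1; (val x).2; - (val x).1 - (val x).2])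
                    C b)
               (val (psi1 (M1cls f))),
           forall f : basis -> int,
             infinite_sum
               (fun x C b => f x *
                  simplex_chain E (tnth [tuple (val x).1; (val x).2]) C b)
               (val (psi2 (M2cls f))),
           bijective psi1 /\ bijective psi2,
           forall m : M1, val (psi2 (dM m)) = vboundary E (val (psi1 m)) &
           forall g : GL2Z,
             (forall m, val (psi1 (M1act g m)) = vact E g (val (psi1 m))) /\
             (forall m, val (psi2 (M2act g m)) = vact E g (val (psi2 m)))])
  /\
  (forall (Gam : groupClosed GL2Z) (n : nat),
     (exists theta : forall V : rmod GL2Z,
         {additive tens (HM Gam V n.+1) rat ->
                   tens (Hgrp (subG Gam) (res Gam (det_twist V)) n) rat},
        (forall V, bijective (theta V)) /\
        (forall (V W : rmod GL2Z) (f : V -> W), rmod_hom f ->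
           forall x,
             theta W (tens_map (HM_map Gam f n.+1) x) =
             tens_map (Hgrp_map (res Gam (det_twist V))
                                 (res Gam (det_twist W)) f n)
                      (theta V x)))
     /\
     ((forall g, g \in Gam -> \det (val g) = 1) ->
      exists theta : forall V : rmod GL2Z,
         {additive tens (HM Gam V n.+1) rat ->
                   tens (Hgrp (subG Gam) (res Gam V) n) rat},
        (forall V, bijective (theta V)) /\
        (forall (V W : rmod GL2Z) (f : V -> W), rmod_hom f ->
           forall x,
             theta W (tens_map (HM_map Gam f n.+1) x) =
             tens_map (Hgrp_map (res Gam V) (res Gam W) f n)
                      (theta V x)))).
Proof.
split=> [R E Eu|Gam n]; last first.
  split=> [|det1].
    exact: (@modular_cohomology Gam n
      (fun V => @res_act _ Gam (det_twist V)) _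
      (fun V => @res_act1 _ Gam (det_twist V))
      (fun V => @res_actM _ Gam (det_twist V)) (fun V v g => erefl)).
  (* With all determinants equal to 1, the untwisted action satisfies the formula of the twist. *)
  apply: (@modular_cohomology Gam n (fun V => @res_act _ Gam V) _
    (fun V => @res_act1 _ Gam V) (fun V => @res_actM _ Gam V)) => V v g.
  by rewrite det1 ?mulr1z//; exact: subG_valP.
have [p1 v1 b1] := symbols_iso (@double_shuffles_subgroup basis idfun int)
  twordK twordVK tword_inj DS_tword DS_sum (tri_dual Eu) (tri_cell Eu)
  (tri_class Eu) (orient_tword Eu) (@cell_tri _ _ Eu).
have [p2 v2 b2] := symbols_iso (@wedge_rels_subgroup basis idfun int)
  ewordK ewordVK eword_inj WR_eword WR_sum (edg_dual Eu) (edg_cell Eu)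
  (edg_class Eu) (orient_eword Eu) (@cell_edg _ _ Eu).
exists p1, p2; split=> // [f|f|m|g].
- rewrite v1; exact: (Psi_sum tword_inj (tri_cell Eu) (tri_class Eu) (@cell_tri _ _ Eu)).
- rewrite v2; exact: (Psi_sum eword_inj (edg_cell Eu) (edg_class Eu) (@cell_edg _ _ Eu)).
- by have [f _ ->] := cls_surj m; rewrite dM_cls v1 v2 vboundary_Psi.
- split=> m; have [f _ ->] := cls_surj m.
    rewrite M1act_cls !v1 push_bact.
    exact: (Psi_act Eu tword_inj tword_bact (tri_dual Eu) tri_bact (tri_cell Eu)
      (tri_class Eu) (orient_tword Eu) (@cell_tri _ _ Eu)).
  rewrite M2act_cls !v2 push_bact.
  exact: (Psi_act Eu eword_inj eword_bact (edg_dual Eu) edg_bact (edg_cell Eu)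
    (edg_class Eu) (orient_eword Eu) (@cell_edg _ _ Eu)).
Qed.
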